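(* Let $\mathcal{A},\mathcal{B}\subsetneq\mathbb{Z}_M^2$ be a pair of alphabets with dimensions $\delta_A=\log_M|\mathcal{A}|$, $\delta_B=\log_M|\mathcal{B}|$, Cantor iterates $\mathcal{X}_k,\mathcal{Y}_k$ and limiting Cantor sets $\mathbf{X},\mathbf{Y}\subset\mathbb{T}^2$. There exist $\beta>\max\big(0,1-\frac{\delta_A+\delta_B}{2}\big)$ and $C>0$ such that $$\|1_{\mathcal{Y}_k}\,\mathcal{F}\,1_{\mathcal{X}_k}\|_{2\to2}\le CM^{-k\beta}\quad\text{for all }k\ge1$$ if and only if at least one of the following holds: (i) $\delta_A+\delta_B\ge2$, and there do not exist $\mathbf{v}\in\mathbb{R}^2\setminus\{0\}$ and $\mathbf{p},\mathbf{q}\in\mathbb{T}^2$ with $\mathbb{R}\mathbf{v}+\mathbf{p}\subset\mathbf{X}$ and $\mathbb{R}\mathbf{v}^\perp+\mathbf{q}\subset\mathbf{Y}$; (ii) $\delta_A+\delta_B\le2$, and there exist $\mathbf{j},\mathbf{j}'\in\mathcal{A}$ and $\mathbf{k},\mathbf{k}'\in\mathcal{B}$ with $\langle\mathbf{j}-\mathbf{j}',\mathbf{k}-\mathbf{k}'\rangle\neq0$ as an inner product in $\mathbb{Z}$.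
   Context: $M\ge2$ is an integer (the base), $\mathbb{Z}_N=\mathbb{Z}/N\mathbb{Z}$. An alphabet is a nonempty proper subset $\mathcal{A}\subsetneq\mathbb{Z}_M^2$, with $\mathbb{Z}_M$ identified with $\{0,\dots,M-1\}$; in (ii) elements of alphabets are regarded as vectors in $\{0,\dots,M-1\}^2\subset\mathbb{Z}^2$. The $k$-th Cantor iterate of $\mathcal{A}$ is $$\mathcal{X}_k=\Big\{\Big(\sum_{j=0}^{k-1}a_jM^j,\ \sum_{j=0}^{k-1}b_jM^j\Big):(a_j,b_j)\in\mathcal{A}\text{ for all }j\Big\}\subset\mathbb{Z}_N^2,\qquad N=M^k,$$ and $\mathcal{Y}_k$ is defined in the same way from $\mathcal{B}$. $\mathbb{T}^2=\mathbb{R}^2/\mathbb{Z}^2$, identified as a set with $[0,1)^2$. The limiting Cantor set of $\mathcal{A}$ is $\mathbf{X}=\bigcap_{k\ge1}\mathbf{X}_k$, where $\mathbf{X}_k$ is the closure in $\mathbb{T}^2$ of $\{(x,y)\in[0,1)^2:(\lfloor M^kx\rfloor,\lfloor M^ky\rfloor)\in\mathcal{X}_k\}$. Equivalently, $\mathbf{X}$ is the set of points $(x,y)\in\mathbb{T}^2$ having some base-$M$ expansions $x=0.a_0a_1\dots$, $y=0.b_0b_1\dots$ with $(a_j,b_j)\in\mathcal{A}$ for all $j\ge0$ (if a coordinate has two expansions, either may be used). $\mathbf{Y}$ is defined in the same way from $\mathcal{B}$. For $\mathbf{v}=(a,b)\in\mathbb{R}^2$, $\mathbf{v}^\perp=(-b,a)$;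 $\mathbb{R}\mathbf{v}+\mathbf{p}\subset\mathbb{T}^2$ denotes $\{t\mathbf{v}+\mathbf{p}\bmod\mathbb{Z}^2:t\in\mathbb{R}\}$. $\mathcal{F}$ is the unitary discrete Fourier transform on $\ell^2(\mathbb{Z}_N^2)$: $\mathcal{F}f(\boldsymbol\xi)=\frac1N\sum_{\mathbf{x}\in\mathbb{Z}_N^2}f(\mathbf{x})e^{-\frac{2\pi i}{N}\mathbf{x}\cdot\boldsymbol\xi}$. For a set $S$, $1_S$ denotes multiplication by the indicator function of $S$, and $\|\cdot\|_{2\to2}$ is the operator norm on $\ell^2(\mathbb{Z}_N^2)$. *)

(* Defs.v *)
From HB Require Import structures.
From mathcomp Require Import all_boot all_order all_algebra generic_quotient.
From mathcomp Require Import ring_quotient.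
From mathcomp Require Import all_classical all_reals all_analysis.
From mathcomp Require Import complex.

Set Implicit Arguments.
Unset Strict Implicit.
Unset Printing Implicit Defensive.

Import Order.TTheory GRing.Theory Num.Theory.
Import numFieldNormedType.Exports.

Local Open Scope ring_scope.

Definition alphabet (M : nat) (A : {set 'I_M * 'I_M}) : Prop :=
  A != finset.set0 /\ A \proper finset.setT.

Definition alphabet_dim (R : realType) (M : nat) (A : {set 'I_M * 'I_M}) : R :=
  ln #|A|%:R / ln M%:R.

(** The group Z/NZ is used only through its representatives 0, ..., N-1 and is
    encoded by ['I_N], so that Z_N^2 is ['I_N * 'I_N].  The sums of digits below
    are taken in [nat]: they are smaller than M^k, so no reduction occurs. *)
Definition cantor_iterate (M : nat) (A : {set 'I_M * 'I_M}) (k : nat) :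
    {set 'I_(M ^ k) * 'I_(M ^ k)} :=
  [set x : 'I_(M ^ k) * 'I_(M ^ k) |
    [exists d : {ffun 'I_k -> 'I_M * 'I_M},
      [&& [forall j, d j \in A],
          nat_of_ord x.1 == (\sum_(j < k) (d j).1 * M ^ j)%N
        & nat_of_ord x.2 == (\sum_(j < k) (d j).2 * M ^ j)%N]]]%SET.

Section FourierTransform.
Context (R : realType) (N : nat).

Definition ell2 := {ffun 'I_N * 'I_N -> R[i]}.

Definition ell2_norm (f : ell2) : R :=
  Num.sqrt (\sum_x ComplexField.Normc.normc (f x) ^+ 2).

Definition expi (t : R) : R[i] := (cos t +i* sin t)%C.

(** The frequency pairing [x . xi] is computed on representatives; the
    exponential only depends on it modulo N. *)
Definition dft (f : ell2) : ell2 :=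
  [ffun xi : 'I_N * 'I_N => (N%:R)^-1 *
     \sum_(x : 'I_N * 'I_N)
        f x * expi (- (2 * pi / N%:R) * (x.1 * xi.1 + x.2 * xi.2)%N%:R)].

Definition indic_mul (S : {set 'I_N * 'I_N}) (f : ell2) : ell2 :=
  [ffun x => (x \in S)%:R * f x].

Local Open Scope classical_set_scope.

(** Meaningful for linear [T], whose values on the unit ball are bounded. *)
Definition op_norm (T : ell2 -> ell2) : R :=
  sup [set ell2_norm (T f) | f in [set f : ell2 | ell2_norm f <= 1]].

End FourierTransform.

Section Torus.
Context (R : realType).

Definition lattice : {pred R * R} :=
  fun p => (p.1 \is a Num.int) && (p.2 \is a Num.int).

Fact lattice_zmod_closed : zmod_closed lattice.
Proof.
split=> [|x y /andP[x1 x2] /andP[y1 y2]]; apply/andP; split.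
- exact: rpred0.
- exact: rpred0.
- exact: (rpredB x1 y1).
- exact: (rpredB x2 y2).
Qed.

HB.instance Definition _ :=
  GRing.isZmodClosed.Build _ lattice lattice_zmod_closed.

(** R^2/Z^2, as a quotient group, with the quotient topology. *)
Definition torus : Type := quotient_topology (Quotient.quot lattice).

HB.instance Definition _ := Topological.on torus.
HB.instance Definition _ := Quotient.on torus.
HB.instance Definition _ := GRing.isZmodule.Build torus
  (@Quotient.addqA _ lattice) (@Quotient.addqC _ lattice)
  (@Quotient.add0q _ lattice) (@Quotient.addNq _ lattice).

Definition torus_proj (p : R * R) : torus := (\pi_torus p)%qT.

Local Open Scope classical_set_scope.

(** [Num.floor] is [int]-valued; [M ^ k * p.i] lies in [0, M ^ k), so its floor
    is compared with the representatives in ['I_(M ^ k)]. *)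
Definition cantor_level (M : nat) (A : {set 'I_M * 'I_M}) (k : nat) :
    set torus :=
  closure (torus_proj @`
    [set p : R * R | [/\ 0 <= p.1 < 1, 0 <= p.2 < 1 &
       exists2 u, u \in cantor_iterate A k &
         Num.floor ((M ^ k)%:R * p.1) = Posz u.1 /\
         Num.floor ((M ^ k)%:R * p.2) = Posz u.2]]).

Definition limit_cantor_set (M : nat) (A : {set 'I_M * 'I_M}) : set torus :=
  \bigcap_(k in [set k | (1 <= k)%N]) cantor_level A k.

Definition perp (v : R * R) : R * R := (- v.2, v.1).

Definition torus_line (v : R * R) (p : torus) : set torus :=
  [set torus_proj (t * v.1, t * v.2) + p | t in [set: R]].

End Torus.

Definition int_inner (u v : int * int) : int := u.1 * v.1 + u.2 * v.2.

Definition digit_vec (M : nat) (j : 'I_M * 'I_M) : int * int :=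
  (Posz j.1, Posz j.2).

(* Main.v *)
Require Import Defs.
From mathcomp Require Import all_boot all_order all_algebra all_field.
From mathcomp Require Import generic_quotient ring_quotient.
From mathcomp Require Import all_classical all_reals all_analysis.
From mathcomp Require Import complex.
From mathcomp Require Import zify ring lra.

Set Implicit Arguments.
Unset Strict Implicit.
Unset Printing Implicit Defensive.

Import Order.TTheory GRing.Theory Num.Theory.
Import numFieldNormedType.Exports.

Local Open Scope ring_scope.

(** Write [N = M ^ k], [delta = dA + dB], and [r_k] for the norm in the theorem.  A
    Cooley-Tukey step makes [r_k] submultiplicative in [k] ([fourier_bound_add]), so
    that the decay holds as soon as, at one single scale, [r_k] is smaller than the
    trivial bound with exponent [max (0, 1 - delta / 2)] ([uncertainty_of_gap]).  The
    trivial bounds are [r_k <= 1] and the Hilbert-Schmidt bound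
    [r_k <= (|A| |B|) ^ (k / 2) / N].

    The Hilbert-Schmidt bound is an equality exactly for matrices of rank one.  If some
    inner product of digit differences is nonzero then it stays nonzero modulo [M ^ 3],
    and the truncated Fourier matrix of level 3 contains a nonzero 2 x 2 minor
    ([gap_of_independent_phases]); if all of them vanish then the matrix has rank one
    at every level ([rank_one_bound]).

    Orthogonal lines in the limiting sets prevent any decay.  Such a line has a
    rational slope, for otherwise it would be dense and enter the cell of a digit
    missing from the alphabet ([torus_line_slope]).  Discretised at scale [k] the two
    lines become progressions of directions [(a, b)] and [(- b, a)] inside the
    iterates, up to nine possible rounding errors; fixing the errors leaves a rank-one
    submatrix with sides at least [N / 9], so that [r_k >= 1 / 9]
    ([orthogonal_lines_obstruct]).

    It remains to find orthogonal lines when [r_k = 1] for all [k].  By finite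
    dimension there is then, for every [k], a nonzero [f] supported in the iterate of
    [A] whose transform is supported in the iterate of [B].  The conditions on [f]
    are linear with coefficients in a cyclotomic field, so [f] may be assumed to have
    algebraic values ([solution_transfer]), and Galois automorphisms become
    available.  Since [f] vanishes on the block of a missing digit, the transform of
    [f], seen as a function [h] on the points [(z, w)] of the torus whose coordinates
    are [N]-th roots of unity, is after a modulation orthogonal to the monomials
    [z ^ i w ^ j] of a box of side [D = M ^ (k - 1)].

    The support of [h] is so small that it lies on a curve whose degrees are
    negligible against [D]; let [g] be an indecomposable component that still
    annihilates a nonzero multiple of [h].  Two coprime equations of small degree cannot both
    annihilate a function orthogonal to the box ([common_eq0]).  For a small prime [l]
    not dividing [M], the automorphism raising [N]-th roots of unity to the power [l]
    turns [g] into a second equation, of the form [g' (z ^ l, w ^ l)], which [g] must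
    then divide.  So do all translates of [g] by [l]-torsion points; they are too many
    to be pairwise coprime, and an identity between two of them forces [l] to divide
    all the determinants formed with the exponents of [g]
    ([prime_dvd_exponent_det]).  A nonzero determinant would escape some small prime
    ([enough_primes]), hence the exponents are collinear and [g] is an equation in a
    single quantity [z ^ a w ^ b].  Multiplying [h] by a small polynomial confines it
    to one line [a t1 + b t2 = kappa], where orthogonality to the box gives it at
    least [D / 2] nonzero values and bounds [|a|] and [|b|] by [2 M]
    ([uncertainty_line]).  Dually, the iterate of [A] comes close to all the points
    of a progression of direction [(a, b)] ([extremizer_lines]).

    One direction serves infinitely many [k].  For [A] a compactness argument yields a
    line in the limiting set ([near_lines_torus_line]).  For [B] the number of points on
    lines is submultiplicative in the level, so that a fixed proportion of a line at
    infinitely many levels forces full lines at all levels ([full_counts]). *)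

(** * Functions orthogonal to a box of monomials *)

Lemma prim_root_neq0 (F : fieldType) (N : nat) (z : F) : N.-primitive_root z -> z != 0.
Proof.
move=> zp; apply/negP => /eqP z0; have := prim_expr_order zp.
by rewrite z0 expr0n gtn_eqF ?(prim_order_gt0 zp) // => /eqP; rewrite eq_sym oner_eq0.
Qed.

Lemma separator (F : fieldType) (s : seq F) (x : F) : uniq s -> x \in s ->
  exists P : {poly F}, [/\ size P = size s, P.[x] != 0
                         & forall y, y \in s -> y != x -> P.[y] = 0].
Proof.
move=> us xs; exists (\prod_(y <- rem x s) ('X - y%:P)); split.
- by rewrite size_prod_XsubC size_rem // prednK //; case: s xs {us}.
- by rewrite -/(root _ x) root_prod_XsubC mem_rem_uniq // inE eqxx.
by move=> y ys yx; apply/eqP; rewrite -/(root _ y) root_prod_XsubC mem_rem_uniq // !inE yx.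
Qed.

Section BoxAnnihilators.

Variables (K : closedFieldType) (T : finType) (zc wc : T -> K).

(** The outer variable of [{poly {poly K}}] is [w] and the inner one is [z]: [size]
    measures the degree in [w] and [sizeY] the degree in [z]. *)
Definition ev (p : {poly {poly K}}) (t : T) : K := p.[(wc t)%:P].[zc t].

(** When [zc] and [wc] take their values in roots of unity, these sums are the values of
    the Fourier transform of [h] on a box. *)
Definition kills (h : T -> K) (d1 d2 : nat) : Prop :=
  forall i j, (i < d1)%N -> (j < d2)%N ->
    \sum_t h t * (zc t ^+ i * wc t ^+ j) = 0.

Lemma evM p q t : ev (p * q) t = ev p t * ev q t.
Proof. by rewrite /ev !hornerE. Qed.

Lemma evD p q t : ev (p + q) t = ev p t + ev q t.
Proof. by rewrite /ev !hornerE. Qed.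

Lemma evB p q t : ev (p - q) t = ev p t - ev q t.
Proof. by rewrite /ev !hornerE. Qed.

Lemma evE (p : {poly {poly K}}) t d1 d2 : (sizeY p <= d1)%N -> (size p <= d2)%N ->
  ev p t = \sum_(j < d2) \sum_(i < d1) p`_j`_i * (zc t ^+ i * wc t ^+ j).
Proof.
move=> p1 p2; rewrite /ev (horner_coef_wide _ p2) horner_sum.
apply: eq_bigr => j _; rewrite hornerM horner_exp hornerC.
rewrite (horner_coef_wide _ (leq_trans (max_size_coefXY _ _) p1)) mulr_suml.
by apply: eq_bigr => i _; rewrite mulrA.
Qed.

Lemma kills_ev h d1 d2 (p : {poly {poly K}}) : kills h d1 d2 ->
  (sizeY p <= d1)%N -> (size p <= d2)%N -> \sum_t h t * ev p t = 0.
Proof.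
move=> hk p1 p2.
under eq_bigr => t _ do rewrite (evE t p1 p2) mulr_sumr.
rewrite exchange_big big1 // => j _.
under eq_bigr => t _ do rewrite mulr_sumr.
rewrite exchange_big big1 // => i _.
under eq_bigr => t _ do rewrite mulrCA.
by rewrite -mulr_sumr hk ?mulr0.
Qed.

Lemma sizeYM (p q : {poly {poly K}}) : p != 0 -> q != 0 ->
  sizeY (p * q) = (sizeY p + sizeY q).-1.
Proof. by move=> p0 q0; rewrite !sizeYE rmorphM size_mul ?swapXY_eq0. Qed.

Lemma sizeYM_leq (p q : {poly {poly K}}) : (sizeY (p * q) <= (sizeY p + sizeY q).-1)%N.
Proof. by rewrite !sizeYE rmorphM size_polyMleq. Qed.

Lemma sizeYD (p q : {poly {poly K}}) : (sizeY (p + q) <= maxn (sizeY p) (sizeY q))%N.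
Proof. by rewrite !sizeYE rmorphD size_polyD. Qed.

Lemma sizeYN (p : {poly {poly K}}) : sizeY (- p) = sizeY p.
Proof. by rewrite !sizeYE raddfN size_polyN. Qed.

Lemma sizeY_leqP (p : {poly {poly K}}) d :
  (forall j : nat, (size (p`_j)%R <= d)%N) -> (sizeY p <= d)%N.
Proof. by move=> H; apply/bigmax_leqP. Qed.

Definition mono i j : {poly {poly K}} := ('X^i)%:P * 'X^j.

Lemma size_mono_leq i j : (size (mono i j) <= j.+1)%N.
Proof.
apply: (leq_trans (size_polyMleq _ _)); rewrite size_polyXn.
by rewrite addnS -[j.+1]add1n leq_add2r size_polyC_leq1.
Qed.

Lemma sizeY_mono_leq i j : (sizeY (mono i j) <= i.+1)%N.
Proof.
apply: sizeY_leqP => k; rewrite coefCM coefXn.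
by case: eqP; rewrite ?mulr1 ?mulr0 ?size_polyXn ?size_poly0.
Qed.

Lemma ev_mono i j t :
  ev (mono i j) t = zc t ^+ i * wc t ^+ j.
Proof. rewrite /ev hornerM hornerC hornerM; by rewrite !hornerXn horner_exp hornerC. Qed.

Lemma kills_mul h d1 d2 (p : {poly {poly K}}) e1 e2 : kills h d1 d2 ->
  (sizeY p <= e1.+1)%N -> (size p <= e2.+1)%N ->
  kills (fun t => ev p t * h t) (d1 - e1) (d2 - e2).
Proof.
move=> hk p1 p2 i j id jd.
have E t : ev p t * h t * (zc t ^+ i * wc t ^+ j) =
  h t * ev (p * mono i j) t.
  by rewrite evM ev_mono; ring.
under eq_bigr => t _ do rewrite E.
apply: (kills_ev hk).
  apply: (leq_trans (sizeYM_leq _ _)).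
  have := sizeY_mono_leq i j.
  by move: id p1; move: (sizeY p) (sizeY (mono i j)) => a b; lia.
apply: (leq_trans (size_polyMleq _ _)).
have := size_mono_leq i j.
by move: jd p2; move: (size p) (size (mono i j)) => a b; lia.
Qed.

(** The equation restricted to the vertical line [z = th]. *)
Definition at1 (th : K) (p : {poly {poly K}}) : {poly K} := map_poly (horner_eval th) p.

Lemma ev_at1 p t : ev p t = (at1 (zc t) p).[wc t].
Proof. by rewrite /ev /at1 -horner_swapXY horner2_swapXY. Qed.

(** Divide each coefficient by ['X - th]; only the degree in [z] drops. *)
Lemma at1_root th (r : {poly {poly K}}) : at1 th r = 0 ->
  exists p : {poly {poly K}},
    [/\ r = ('X - th%:P)%:P * p, (sizeY p <= (sizeY r).-1)%N & size p = size r].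
Proof.
move=> r0.
have rt (j : nat) : root (r`_j) th.
  by apply/rootP; rewrite -[LHS]/(horner_eval th r`_j) -coef_map -/(at1 th r) r0 coef0.
pose p := \poly_(j < size r) (r`_j %/ ('X - th%:P)).
have Er : r = ('X - th%:P)%:P * p.
  apply/polyP => j; rewrite coefCM coef_poly; case: ltnP => [jr|jr].
    have := rt j; rewrite root_factor_theorem => /divpK {1}<-.
    by rewrite mulrC.
  by rewrite mulr0 nth_default.
have X0 : ('X - th%:P)%:P != 0 :> {poly {poly K}}.
  by rewrite polyC_eq0 polyXsubC_eq0.
have sX : sizeY (('X - th%:P)%:P : {poly {poly K}})%R = 2%N.
  by rewrite sizeYE swapXY_polyC size_map_polyC size_XsubC.
have s0 : sizeY (0 : {poly {poly K}}) = 0%N by apply/eqP; rewrite sizeY_eq0.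
exists p; have [p0|p0] := eqVneq p 0; split=> //.
- by rewrite Er p0 mulr0 s0.
- by rewrite Er p0 mulr0.
- by rewrite Er sizeYM // sX.
by rewrite [in RHS]Er size_mul // size_polyC -polyC_eq0 X0 add1n.
Qed.

(** The univariate core of the elimination: multiply a Bezout identity by [q] and reduce
    the coefficient of [v] modulo [u]; the degree of the other coefficient is then
    forced. *)
Lemma coprime_span (u v q : {poly K}) e e' : size u = e.+1 -> (size v <= e'.+1)%N ->
  coprimep u v -> (size q <= e + e')%N ->
  exists a b : {poly K}, [/\ q = a * u + b * v, (size a <= e')%N & (size b <= e)%N].
Proof.
move=> su sv cuv sq.
have u0 : u != 0 by rewrite -size_poly_eq0 su.
have /Bezout_eq1_coprimepP [[x y] /= xy] := cuv.
pose b := (q * y) %% u; pose a := q * x + ((q * y) %/ u) * v.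
have E : q = a * u + b * v.
  rewrite /a /b -[LHS]mulr1 -xy mulrDr !mulrA {1}(divp_eq (q * y) u).
  by ring.
have sb : (size b <= e)%N by rewrite -ltnS -su ltn_modp.
exists a, b; split=> //.
have [->|a0] := eqVneq a 0; first by rewrite size_poly0.
have : (size (a * u)%R <= e + e')%N.
  have -> : a * u = q - b * v by rewrite [in RHS]E; ring.
  rewrite (leq_trans (size_polyD _ _)) // size_polyN geq_max sq /=.
  apply: (leq_trans (size_polyMleq _ _)).
  by move: sv sb; move: (size b) (size v) => c c'; lia.
by rewrite size_mul // su; move: (size a) => c; lia.
Qed.

Variables (g g' : {poly {poly K}}) (e e' d : nat).
Hypotheses (sg : size g = e.+1) (sg' : (size g' <= e'.+1)%N).
Hypotheses (yg : (sizeY g <= d.+1)%N) (yg' : (sizeY g' <= d.+1)%N).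
Hypothesis cop : Pdiv.Idomain.coprimep g g'.
Hypothesis d_gt0 : (0 < d)%N.

Definition common (h : T -> K) : Prop :=
  [/\ forall t, ev g t * h t = 0, forall t, ev g' t * h t = 0
     & kills h d (e + e')].

(** All but finitely many [th] will do: avoid the points of the support, the zeros of the
    leading coefficient, and those of the constant in a Bezout identity over the
    fractions in [z]. *)
Lemma good_slice : exists th, [/\ forall t, zc t != th,
  size (at1 th g) = e.+1 & coprimep (at1 th g) (at1 th g')].
Proof.
have /Pdiv.Idomain.Bezout_coprimepP [[u v] /= /eqpP [[c1 c2] /= /andP[c10 c20] E]] := cop.
rewrite -[_ *: 1]mul_polyC mulr1 in E.
have g0 : g != 0 by rewrite -size_poly_eq0 sg.
pose P := c2 * lead_coef g * \prod_t ('X - (zc t)%:P).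
have P0 : P != 0.
  rewrite !mulf_neq0 ?lead_coef_eq0 //.
  by apply/prodf_neq0 => t _; rewrite polyXsubC_eq0.
have /closed_nonrootP [th] := P0.
rewrite /root !hornerM horner_prod => /eqP/eqP; rewrite !mulf_eq0 !negb_or.
case/andP=> /andP[c2th lth] /prodf_neq0 zth.
exists th; split.
- by move=> t; have := zth t isT; rewrite !hornerE subr_eq0 eq_sym.
- by rewrite /at1 size_map_poly_id0 // sg.
apply/coprimepP => w wg wg'.
have : w %| (horner_eval th c2)%:P.
  rewrite -(map_polyC (horner_eval th)) -E linearZ /= rmorphD !rmorphM /=.
  by rewrite -mul_polyC dvdp_mull // dvdp_add // dvdp_mull.
have c1' : (horner_eval th c2)%:P %= 1 by rewrite polyC_eqp1.
by rewrite (eqp_dvdr _ c1') dvdp1 size_poly_eq1.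
Qed.

Hypothesis g_prim : forall th, at1 th g != 0.
Hypothesis inj_zw : forall s t, zc s = zc t -> wc s = wc t -> s = t.

(** At [z = th] the two equations are coprime, so that a monomial of the box is, modulo
    [z - th], a combination of them.  The quotient by [z - th] has smaller degree in [z],
    and its pairing with [h] vanishes by hypothesis. *)
Lemma common_shift th h : (forall t, zc t != th) ->
  size (at1 th g) = e.+1 -> coprimep (at1 th g) (at1 th g') ->
  common h -> common (fun t => (zc t - th)^-1 * h t).
Proof.
move=> zth sth cth [gh g'h kh].
have zth0 t : zc t - th != 0 by rewrite subr_eq0.
split; first by move=> t; rewrite mulrCA gh mulr0.
  by move=> t; rewrite mulrCA g'h mulr0.
rewrite /kills => i j id jd; pose q := mono i j.
have sq : (size q <= e + e')%N by apply: leq_trans (size_mono_leq i j) _.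
have yq : (sizeY q <= d)%N by apply: leq_trans (sizeY_mono_leq i j) _.
have s1q : (size (at1 th q) <= e + e')%N by apply: leq_trans (size_poly _ _) sq.
have s1g' : (size (at1 th g') <= e'.+1)%N by apply: leq_trans (size_poly _ _) sg'.
have [a [b [Eq sa sb]]] := coprime_span sth s1g' cth s1q.
pose lift (c : {poly K}) : {poly {poly K}} := map_poly polyC c.
have slift c : size (lift c) = size c by rewrite size_map_polyC.
have ylift c : (sizeY (lift c) <= 1)%N.
  by apply: sizeY_leqP => k; rewrite coef_map /= size_polyC_leq1.
have lift1 c : at1 th (lift c) = c.
  by apply/polyP => k; rewrite !coef_map /= /horner_eval hornerC.
pose r := q - lift a * g - lift b * g'.
have r0 : at1 th r = 0.
  have -> : at1 th r = at1 th q - at1 th (lift a) * at1 th g - at1 th (lift b) * at1 th g'.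
    by rewrite /r /at1 !rmorphB !rmorphM.
  by rewrite !lift1 Eq; ring.
have [p [Er yp sp]] := at1_root r0.
have bnd2 (F : {poly {poly K}} -> nat) (x y z : {poly {poly K}}) n :
    (forall x y, (F (x + y)%R <= maxn (F x) (F y))%N) ->
    (forall x, F (- x) = F x) ->
    (F x <= n)%N -> (F y <= n)%N -> (F z <= n)%N -> (F (x - y - z)%R <= n)%N.
  move=> FD FN xn yn zn; apply: (leq_trans (FD _ _)); rewrite FN geq_max zn andbT.
  by apply: (leq_trans (FD _ _)); rewrite FN geq_max xn yn.
have yr : (sizeY r <= d.+1)%N.
  apply: bnd2 => //; [exact: sizeYD|exact: sizeYN|by rewrite ltnW| |].
    apply: (leq_trans (sizeYM_leq _ _)).
    by have := ylift a; move: yg; move: (sizeY g) (sizeY _) => x y; lia.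
  apply: (leq_trans (sizeYM_leq _ _)).
  by have := ylift b; move: yg'; move: (sizeY g') (sizeY _) => x y; lia.
have sr : (size r <= e + e')%N.
  apply: (@bnd2 (fun p => size p)) => //; [exact: size_polyD|exact: size_polyN| |].
    apply: (leq_trans (size_polyMleq _ _)); rewrite slift sg.
    by move: sa; move: (size a) => x; lia.
  apply: (leq_trans (size_polyMleq _ _)); rewrite slift.
  by move: sb sg'; move: (size b) (size g') => x y; lia.
have Dr : q = r + lift a * g + lift b * g' by rewrite /r; ring.
clearbody r.
have ykp : (sizeY p <= d)%N by move: yr yp; move: (sizeY r) (sizeY p) => x y; lia.
rewrite -sp in sr.
rewrite -[RHS](kills_ev kh ykp sr); apply: eq_bigr => t _.
have -> : zc t ^+ i * wc t ^+ j = ev q t by rewrite ev_mono.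
rewrite Dr !evD !evM Er evM {1}/ev !hornerE.
have := gh t; have := g'h t; have := zth0 t.
move: (ev p t) (ev g t) (ev g' t) (ev (lift a) t) (ev (lift b) t) (h t) => P G G' A B H.
move=> z0 G'H GH.
have -> : (zc t - th)^-1 * H * ((zc t - th) * P + A * G + B * G') =
  (zc t - th)^-1 * (zc t - th) * (H * P) + (zc t - th)^-1 * (A * (G * H) + B * (G' * H)).
  by ring.
by rewrite GH G'H mulVf // !mulr0 addr0 mulr0 mul1r addr0.
Qed.

Lemma common_sum (I : Type) (s : seq I) (c : I -> K) (h : I -> T -> K) :
  (forall i, common (h i)) -> common (fun t => \sum_(i <- s) c i * h i t).
Proof.
move=> H; split; [move=> t|move=> t|rewrite /kills => i j id jd].
- rewrite mulr_sumr big1 // => i _.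
  by have [Hi _ _] := H i; rewrite mulrCA Hi mulr0.
- rewrite mulr_sumr big1 // => i _.
  by have [_ Hi _] := H i; rewrite mulrCA Hi mulr0.
under eq_bigr => t _ do rewrite mulr_suml.
rewrite exchange_big big1 // => k _.
under eq_bigr => t _ do rewrite -mulrA.
by rewrite -mulr_sumr; have [_ _ Hi] := H k; rewrite Hi ?mulr0.
Qed.

Lemma common_ext h h' : h =1 h' -> common h -> common h'.
Proof.
move=> hh' [gh g'h kh]; split; [by move=> t; rewrite -hh'|by move=> t; rewrite -hh'|].
rewrite /kills => i j id jd.
by rewrite -[RHS](kh i j id jd); apply: eq_bigr => t _; rewrite hh'.
Qed.

Lemma common_pow th h n : (forall t, zc t != th) ->
  size (at1 th g) = e.+1 -> coprimep (at1 th g) (at1 th g') ->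
  common h -> common (fun t => (zc t - th)^-1 ^+ n * h t).
Proof.
move=> zth sth cth; elim: n => [|n IH] ch.
  by apply: (common_ext _ ch) => t; rewrite mul1r.
by apply: (common_ext _ (common_shift zth sth cth (IH ch))) => t; rewrite exprS mulrA.
Qed.

(** Curves without a common component meet in few points, in the following dual form.
    By [common_shift], [h] may be multiplied by every polynomial in [(z - th)^-1], hence
    restricted to a vertical line; there [g] has at most [e] zeros, and the monomials in
    [w] of the box separate them. *)
Lemma common_eq0 h : common h -> forall t, h t = 0.
Proof.
move=> ch t0; apply/eqP; apply/negP => /negP h0.
have [th [zth sth cth]] := good_slice.
pose y t := (zc t - th)^-1.
have zth0 t : zc t - th != 0 by rewrite subr_eq0.
have yinj s t : y s = y t -> zc s = zc t.
  by move=> /invr_inj /addIr.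
have [P [_ Py0 Py]] := @separator K (undup [seq y t | t <- enum T]) (y t0)
  (undup_uniq _) (ltac:(by rewrite mem_undup map_f ?mem_enum)).
(* [phi] is [h] cut off to the vertical line through [t0], up to a nonzero factor *)
pose phi t := P.[y t] * h t.
have cphi : common phi.
  have := common_sum (index_enum 'I_(size P)) (fun i => P`_i)
    (fun i : 'I_(size P) => common_pow i zth sth cth ch).
  apply: common_ext => t; rewrite /phi horner_coef mulr_suml.
  by apply: eq_bigr => i _; rewrite mulrA.
have phi0 : phi t0 != 0 by rewrite mulf_neq0.
have phiz t : phi t != 0 -> zc t = zc t0.
  move=> pt; apply: yinj; apply/eqP; apply: contraR pt => yt.
  by rewrite /phi Py ?mul0r // mem_undup map_f ?mem_enum.
pose ws := undup [seq wc t | t <- enum T & phi t != 0].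
have wws t : phi t != 0 -> wc t \in ws.
  by move=> pt; rewrite mem_undup map_f // mem_filter pt mem_enum.
have sws : (size ws <= e)%N.
  rewrite -ltnS; apply: leq_trans (_ : size (at1 (zc t0) g) <= _)%N; last first.
    by rewrite -sg; apply: size_poly.
  apply: max_poly_roots (g_prim _) _ (undup_uniq _); apply/allP => w.
  rewrite mem_undup => /mapP [t]; rewrite mem_filter => /andP[pt _] ->.
  rewrite /root -(phiz t pt) -ev_at1; have [gphi _ _] := cphi.
  by have /eqP := gphi t; rewrite mulf_eq0 (negPf pt) orbF.
(* [Q] isolates [t0] on that line *)
have [Q [sQ Qw0 Qw]] := @separator K ws (wc t0) (undup_uniq _) (wws _ phi0).
have [_ _ kphi] := cphi.
have : \sum_t phi t * Q.[wc t] = 0.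
  under eq_bigr => t _ do rewrite horner_coef mulr_sumr.
  rewrite exchange_big big1 // => j _.
  under eq_bigr => t _ do rewrite mulrCA -[wc t ^+ _]mul1r -[1](expr0 (zc t)).
  rewrite -mulr_sumr (kphi 0%N j) ?mulr0 //.
  by apply: leq_trans (ltn_ord j) _; rewrite sQ (leq_trans sws) // leq_addr.
rewrite (bigD1 t0) //= big1 ?addr0 => [|t tt0].
  by move/eqP; rewrite mulf_eq0 (negPf phi0) (negPf Qw0).
have [->|pt] := eqVneq (phi t) 0; first by rewrite mul0r.
rewrite Qw ?mulr0 ?wws //; apply: contra tt0 => /eqP wt; apply/eqP.
exact: inj_zw (phiz t pt) wt.
Qed.

End BoxAnnihilators.

(** * Factorisation of plane curves *)

Section Factorisation.

Variable K : closedFieldType.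
Implicit Types (p q g u v d e : {poly {poly K}}) (c : {poly K}).

Definition biconst p := (size p <= 1)%N && (sizeY p <= 1)%N.

(** Irreducibility in [K[z, w]], constants being admitted; a factor in [z] alone is not
    a unit there. *)
Definition indecomposable g : Prop :=
  forall u v, g = u * v -> biconst u \/ biconst v.

(** As long as the equation decomposes, either the first factor annihilates [h] and
    replaces it, or it is absorbed in [h] and the second factor takes over. *)
Lemma indecomposable_factor (T : finType) (zc wc : T -> K) g (h : T -> K) :
  g != 0 -> (exists t, h t != 0) -> (forall t, ev zc wc g t * h t = 0) ->
  exists q g' r, [/\ g = q * g' * r, indecomposable g',
    exists t, ev zc wc q t * h t != 0
    & forall t, ev zc wc g' t * (ev zc wc q t * h t) = 0].
Proof.
move: {2}(size g + sizeY g)%N (leqnn (size g + sizeY g)%N) => n.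
elim: n g h => [|n IH] g h.
  by rewrite leqn0 addn_eq0 size_poly_eq0 => /andP[/eqP-> _]; rewrite eqxx.
move=> gn g0 h0 gh; have [ig|] := pselect (indecomposable g).
  have ev1 t : ev zc wc 1 t = 1 by rewrite /ev !hornerE.
  exists 1, g, 1; rewrite mul1r mulr1; split=> //.
    by case: h0 => t ht; exists t; rewrite ev1 mul1r.
  by move=> t; rewrite ev1 mul1r.
move=> /existsNP [u /existsNP [v /not_implyP [Eg /not_orP [/negP cu /negP cv]]]].
have : u * v != 0 by rewrite -Eg.
rewrite mulf_eq0 negb_or => /andP[u0 v0].
have meas : (size u + sizeY u <= n)%N /\ (size v + sizeY v <= n)%N.
  move: gn cu cv; rewrite Eg size_mul // sizeYM // /biconst.
  have : (0 < sizeY u)%N by rewrite lt0n sizeY_eq0.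
  have : (0 < sizeY v)%N by rewrite lt0n sizeY_eq0.
  have : (0 < size u)%N by rewrite size_poly_gt0.
  have : (0 < size v)%N by rewrite size_poly_gt0.
  move: (size u) (size v) (sizeY u) (sizeY v) => a b c d; lia.
have [uh|uh] := pselect (forall t, ev zc wc u t * h t = 0).
  have [q [g' [r [Eu ig' qh g'h]]]] := IH u h meas.1 u0 h0 uh.
  by exists q, g', (r * v); split; rewrite // Eg Eu mulrA.
have uh' : exists t, ev zc wc u t * h t != 0.
  by move/existsNP: uh => [t /eqP]; exists t.
have vuh t : ev zc wc v t * (ev zc wc u t * h t) = 0.
  by rewrite mulrA -evM [v * u]mulrC -Eg.
have [q [g' [r [Ev ig' qh g'h]]]] := IH v _ meas.2 v0 uh' vuh.
exists (q * u), g', r; split=> //.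
- by rewrite Eg Ev; ring.
- by case: qh => t qt; exists t; rewrite evM -mulrA.
by move=> t; rewrite evM -mulrA.
Qed.

Lemma at1_eq0_factor th d : at1 th d = 0 ->
  exists2 p, d = ('X - th%:P)%:P * p & size p = size d.
Proof. by case/at1_root => p [Ed _ sp]; exists p. Qed.

Lemma scalepI c p q : c != 0 -> c *: p = c *: q -> p = q.
Proof. by move=> c0; rewrite -!mul_polyC; apply: mulfI; rewrite polyC_eq0. Qed.

(** Gauss's lemma.  Since [K] is algebraically closed, [c] splits into linear factors
    ['X - th], and such a factor divides one of [d] and [e] as soon as it divides their
    product, because the restrictions to [z = th] have no zero divisors. *)
Lemma gauss_factor c g d e : c != 0 -> c *: g = d * e ->
  exists d' e', [/\ g = d' * e', size d' = size d & size e' = size e].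
Proof.
move: {2}(size c) (leqnn (size c)) => n.
elim: n c d e => [|n IH] c d e; first by rewrite leqn0 size_poly_eq0 => ->.
move=> cn c0 Ecg; have [/eqP c1|c1] := eqVneq (size c) 1%N.
  have [a a0 Ec] := size_poly1P _ c1.
  exists (a^-1%:P *: d), e; split=> //; last first.
    by rewrite size_scale // polyC_eq0 invr_eq0.
  by rewrite -scalerAl -Ecg Ec scalerA -polyCM mulVf // scale1r.
have /closed_rootP [th cth] : size c != 1%N by [].
have [c' Ec] : exists c', c = c' * ('X - th%:P) by apply/factor_theorem.
have X0 : 'X - th%:P != 0 by rewrite polyXsubC_eq0.
have c'0 : c' != 0 by apply: contra c0 => /eqP c'0; rewrite Ec c'0 mul0r.
have c'n : (size c' <= n)%N.
  by move: cn; rewrite Ec size_mul // size_XsubC addn2 ltnS.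
have : at1 th d * at1 th e = 0.
  rewrite /at1 -rmorphM -Ecg -mul_polyC rmorphM /= map_polyC /= /horner_eval.
  by rewrite (rootP cth) mul0r.
move/eqP; rewrite mulf_eq0 => /orP[] /eqP /at1_eq0_factor [p Ep sp].
  have [|d' [e' [Eg sd' se']]] := IH c' p e c'n c'0.
    apply: (scalepI X0).
    by rewrite scalerA [('X - _) * _]mulrC -Ec Ecg Ep -mul_polyC mulrA.
  by exists d', e'; rewrite sd'.
have [|d' [e' [Eg sd' se']]] := IH c' d p c'n c'0.
  apply: (scalepI X0).
  by rewrite scalerA [('X - _) * _]mulrC -Ec Ecg Ep -mul_polyC mulrCA.
by exists d', e'; rewrite se'.
Qed.

(** Divisibility and coprimality are those over the fractions in [z].  The greatest
    common divisor divides [g] up to a factor in [z] alone, which Gauss's lemma clears. *)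
Lemma indecomposable_coprime g u : indecomposable g -> (1 < size g)%N ->
  coprimep g u \/ g %| u.
Proof.
move=> ig sg; have [|ncop] := boolP (coprimep g u); first by left.
right; pose d := gcdp g u.
have g0 : g != 0 by rewrite -size_poly_gt0 ltnW.
have d0 : d != 0 by rewrite /d gcdp_eq0 (negPf g0).
have sd : (1 < size d)%N.
  by move: ncop d0; rewrite coprimep_def -size_poly_gt0 -/d; case: (size d) => [|[]].
have /Pdiv.Idomain.dvdpP [[c e] /= c0 Ecg] := Pdiv.Idomain.dvdp_gcdl g u.
have [e' [d' [Eg se' sd']]] := gauss_factor c0 Ecg.
case: (ig _ _ Eg) => /andP[s1 _]; last by move: sd; rewrite -/d -sd' ltnNge s1.
suff : d %= g by move=> /Pdiv.Idomain.eqp_dvdl <-; apply: Pdiv.Idomain.dvdp_gcdr.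
rewrite -Pdiv.Idomain.dvdp_size_eqp ?Pdiv.Idomain.dvdp_gcdl // -/d.
have : e' * d' != 0 by rewrite -Eg.
rewrite mulf_eq0 negb_or => /andP[e'0 d'0].
rewrite Eg size_mul // sd' -/d; move: s1; rewrite leq_eqVlt ltnS leqn0 size_poly_eq0.
by rewrite (negPf e'0) orbF => /eqP ->.
Qed.

(** As neither curve contains a vertical line, the roots of [a] and [b] agree and can be
    cancelled one by one. *)
Lemma associate_scalar g u (a b : {poly K}) : (forall th, at1 th g != 0) ->
  (forall th, at1 th u != 0) -> a != 0 -> a *: g = b *: u ->
  exists2 lam : K, lam != 0 & g = lam%:P *: u.
Proof.
move=> gp up; move: {2}(size a) (leqnn (size a)) => n.
have g0 : g != 0 by apply: contra (gp 0) => /eqP->; rewrite /at1 rmorph0.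
have u0 : u != 0 by apply: contra (up 0) => /eqP->; rewrite /at1 rmorph0.
have at1Z th c p : at1 th (c *: p) = c.[th] *: at1 th p by rewrite /at1 linearZ.
elim: n a b => [|n IH] a b; first by rewrite leqn0 size_poly_eq0 => ->.
move=> an a0 E.
have b0 : b != 0.
  by apply: contra a0 => /eqP b0; move/eqP: E; rewrite b0 scale0r -mul_polyC mulf_eq0 polyC_eq0 (negPf g0) orbF.
have [/eqP a1|/closed_rootP [th ath]] := eqVneq (size a) 1%N; last first.
  have bth : root b th.
    have /eqP := congr1 (at1 th) E; rewrite !at1Z (rootP ath) scale0r eq_sym.
    by rewrite scaler_eq0 (negPf (up th)) orbF.
  have [a' Ea] : exists c', a = c' * ('X - th%:P) by apply/factor_theorem.
  have [b' Eb] : exists c', b = c' * ('X - th%:P) by apply/factor_theorem.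
  have X0 : 'X - th%:P != 0 by rewrite polyXsubC_eq0.
  have a'0 : a' != 0 by apply: contra a0 => /eqP a'0; rewrite Ea a'0 mul0r.
  apply: (IH a' b' _ a'0).
    by move: an; rewrite Ea size_mul // size_XsubC addn2 ltnS.
  apply: (scalepI X0).
  by rewrite !scalerA ![('X - _) * _]mulrC -Ea -Eb.
have [al al0 Ea] := size_poly1P _ a1.
have [/eqP b1|/closed_rootP [th bth]] := eqVneq (size b) 1%N; last first.
  have /eqP := congr1 (at1 th) E; rewrite !at1Z (rootP bth) scale0r.
  by rewrite scaler_eq0 (negPf (gp th)) orbF Ea hornerC (negPf al0).
have [be be0 Eb] := size_poly1P _ b1.
exists (al^-1 * be); first by rewrite mulf_neq0 // invr_eq0.
apply: (scalepI a0).
by rewrite E Ea Eb scalerA -polyCM mulrA divff // mul1r.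
Qed.

Lemma dvdp_prod_coprime (I : eqType) (s : seq I) (G : I -> {poly {poly K}}) p :
  uniq s -> (forall i, i \in s -> G i %| p) ->
  (forall i j, i \in s -> j \in s -> i != j -> coprimep (G i) (G j)) ->
  \prod_(i <- s) G i %| p.
Proof.
elim: s => [|i s IH] /=; first by move=> *; rewrite big_nil Pdiv.Idomain.dvd1p.
move=> /andP[iNs us] Gp Gc; rewrite big_cons Pdiv.Idomain.Gauss_dvdp.
  rewrite Gp ?mem_head // IH // => [j js|j k js ks]; first by rewrite Gp // inE js orbT.
  by apply: Gc; rewrite inE ?js ?ks orbT.
have : {subset s <= s} by [].
elim: {1 3}s => [|j t IHt] st; first by rewrite big_nil Pdiv.Idomain.coprimep1.
rewrite big_cons Pdiv.Idomain.coprimepMr IHt => [|k kt]; last by rewrite st // inE kt orbT.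
have js : j \in s by rewrite st ?mem_head.
rewrite Gc ?mem_head // ?inE ?js ?orbT //.
by apply: contraNneq iNs => ->.
Qed.

End Factorisation.

(** * Translations and power maps *)

Section Substitutions.

Variable K : closedFieldType.
Implicit Types (p q g u v : {poly {poly K}}).

(** The translation [(z, w) |-> (c1 z, c2 w)] of the torus, acting on equations. *)
Definition translate (c1 c2 : K) p : {poly {poly K}} :=
  map_poly (comp_poly (c1 *: 'X)) p \Po (c2%:P *: 'X).

(** The isogeny [(z, w) |-> (z ^ l, w ^ l)], acting on equations. *)
Definition power_pullback (l : nat) p : {poly {poly K}} :=
  map_poly (comp_poly 'X^l) p \Po 'X^l.

Lemma coef_comp_scaleX (R : comNzRingType) (c : R) (p : {poly R}) i :
  (p \Po (c *: 'X))`_i = c ^+ i * p`_i.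
Proof.
elim/poly_ind: p i => [|p a IH] i; first by rewrite comp_poly0 !coef0 mulr0.
rewrite comp_poly_MXaddC -scalerAr !(coefD, coefZ, coefMX, coefC).
case: i => [|i] /=; first by rewrite mulr0 mul1r.
by rewrite !addr0 IH mulrA exprS.
Qed.

Lemma coef_translate c1 c2 p i j :
  (translate c1 c2 p)`_j`_i = c1 ^+ i * c2 ^+ j * p`_j`_i.
Proof.
rewrite /translate coef_comp_scaleX coef_map /= -rmorphXn coefCM coef_comp_scaleX.
by ring.
Qed.

Lemma translateM c1 c2 p q :
  translate c1 c2 (p * q) = translate c1 c2 p * translate c1 c2 q.
Proof. by rewrite /translate !rmorphM. Qed.

Lemma translateZ c1 c2 (a : {poly K}) p :
  translate c1 c2 (a *: p) = (a \Po (c1 *: 'X)) *: translate c1 c2 p.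
Proof.
by rewrite -[_ *: p]mul_polyC -[RHS]mul_polyC translateM {1}/translate map_polyC comp_polyC.
Qed.

Lemma coef_power_pullback l p i j : (0 < l)%N -> (power_pullback l p)`_j`_i =
  if (l %| i)%N && (l %| j)%N then p`_(j %/ l)`_(i %/ l) else 0.
Proof.
move=> l0; rewrite /power_pullback coef_comp_poly_Xn //.
case: ifP => lj; last by rewrite andbF coef0.
by rewrite andbT coef_map /= coef_comp_poly_Xn.
Qed.

Lemma polyP2 p q : (forall i j, p`_j`_i = q`_j`_i) -> p = q.
Proof. by move=> H; apply/polyP => j; apply/polyP => i. Qed.

Lemma translateK c1 c2 p : c1 != 0 -> c2 != 0 ->
  translate c1^-1 c2^-1 (translate c1 c2 p) = p.
Proof.
move=> c10 c20; apply: polyP2 => i j; rewrite !coef_translate !exprVn.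
by field; rewrite !expf_neq0.
Qed.

Lemma translate_power_pullback l c1 c2 p : (0 < l)%N -> c1 ^+ l = 1 -> c2 ^+ l = 1 ->
  translate c1 c2 (power_pullback l p) = power_pullback l p.
Proof.
move=> l0 c1l c2l; apply: polyP2 => i j; rewrite coef_translate coef_power_pullback //.
case: ifP => [/andP[/dvdnP[i' ->] /dvdnP[j' ->]]|]; last by rewrite mulr0.
by rewrite ![(_ * l)%N]mulnC !exprM c1l c2l !expr1n !mul1r.
Qed.

Lemma size_translate_leq c1 c2 p : (size (translate c1 c2 p) <= size p)%N.
Proof.
apply/leq_sizeP => j jp; apply/polyP => i.
by rewrite coef_translate [p`_j]nth_default // !coef0 mulr0.
Qed.

Lemma sizeY_translate_leq c1 c2 p : (sizeY (translate c1 c2 p) <= sizeY p)%N.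
Proof.
apply: sizeY_leqP => j; apply/leq_sizeP => i ip.
rewrite coef_translate [p`_j`_i]nth_default ?mulr0 //.
exact: leq_trans (max_size_coefXY _ _) ip.
Qed.

Lemma size_translate c1 c2 p : c1 != 0 -> c2 != 0 -> size (translate c1 c2 p) = size p.
Proof.
move=> c10 c20; apply/anti_leq; rewrite size_translate_leq /=.
by rewrite -{1}(translateK p c10 c20) size_translate_leq.
Qed.

Lemma indecomposable_translate c1 c2 g : c1 != 0 -> c2 != 0 ->
  indecomposable g -> indecomposable (translate c1 c2 g).
Proof.
move=> c10 c20 ig u v /(congr1 (translate c1^-1 c2^-1)).
rewrite translateK // translateM => /ig.
have H p : biconst (translate c1^-1 c2^-1 p) -> biconst p.
  case/andP=> s1 s2; have := @translateK c1^-1 c2^-1 p.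
  rewrite !invr_eq0 !invrK => /(_ c10 c20) <-; apply/andP; split.
    exact: leq_trans (size_translate_leq _ _ _) s1.
  exact: leq_trans (sizeY_translate_leq _ _ _) s2.
by case=> /H; [left|right].
Qed.

Lemma at1_translate c1 c2 p th : c2 != 0 ->
  at1 (c1 * th) p != 0 -> at1 th (translate c1 c2 p) != 0.
Proof.
move=> c20; apply: contra => /eqP E; apply/eqP/polyP => j.
have := congr1 (fun p : {poly K} => p`_j) E.
rewrite /at1 !coef_map !coef0 /= /horner_eval /translate coef_comp_scaleX coef_map /=.
rewrite -rmorphXn hornerM hornerC horner_comp hornerZ hornerX => /eqP.
by rewrite mulf_eq0 expf_eq0 (negPf c20) andbF => /eqP.
Qed.

Lemma dvdp_translate c1 c2 g p : c1 != 0 -> c2 != 0 ->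
  g %| p -> translate c1 c2 g %| translate c1 c2 p.
Proof.
move=> c10 c20 /Pdiv.Idomain.dvdpP [[a q] /= a0 E]; apply/Pdiv.Idomain.dvdpP.
exists (a \Po (c1 *: 'X), translate c1 c2 q) => /=.
  by rewrite comp_poly2_eq0 // size_scale // size_polyX.
by rewrite -translateZ E translateM.
Qed.

Lemma size_power_pullback l p : (size (power_pullback l p) <= l * (size p).-1 + 1)%N.
Proof.
rewrite /power_pullback; have := size_comp_poly (map_poly (comp_poly 'X^l) p) 'X^l.
rewrite size_polyXn /=; have : (size (map_poly (comp_poly 'X^l) p) <= size p)%N.
  exact: size_poly.
by move: (size _) (size _) (size _) => a b c; nia.
Qed.

Lemma sizeY_power_pullback l p : (0 < l)%N ->
  (sizeY (power_pullback l p) <= l * (sizeY p).-1 + 1)%N.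
Proof.
move=> l0; apply: sizeY_leqP => j; apply/leq_sizeP => i ip.
rewrite coef_power_pullback //; case: ifP => // /andP[/dvdnP[i' Ei] _].
rewrite nth_default // (leq_trans (max_size_coefXY _ _)) // Ei mulnK //.
by move: ip; rewrite Ei; move: (sizeY p) => a; nia.
Qed.

Lemma ev_power_pullback (T : finType) (zc wc : T -> K) l p t :
  ev zc wc (power_pullback l p) t =
  ev (fun t => zc t ^+ l) (fun t => wc t ^+ l) p t.
Proof.
rewrite /ev /power_pullback horner_comp hornerXn -rmorphXn.
rewrite -[X in (map_poly _ p).[X]](comp_polyC _ 'X^l) horner_map /=.
by rewrite horner_comp hornerXn.
Qed.

Lemma ev_map (T : finType) (zc wc : T -> K) (s : {rmorphism K -> K}) p t :
  ev (fun t => s (zc t)) (fun t => s (wc t)) (map_poly (map_poly s) p) t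
  = s (ev zc wc p t).
Proof. by rewrite /ev -(map_polyC s) horner_map /= horner_map. Qed.

Lemma size_map2 (s : {rmorphism K -> K}) p : size (map_poly (map_poly s) p) = size p.
Proof. by rewrite size_map_inj_poly ?map_poly0 //; apply: map_poly_inj. Qed.

Lemma sizeY_map2 (s : {rmorphism K -> K}) p :
  (sizeY (map_poly (map_poly s) p) <= sizeY p)%N.
Proof.
apply: sizeY_leqP => j; rewrite coef_map /= size_map_poly.
exact: max_size_coefXY.
Qed.

End Substitutions.

(** * Exponents of a curve modulo a prime *)

Section PowerMapStep.

Variables (K : closedFieldType) (T : finType) (zc wc : T -> K).
Hypothesis inj_zw : forall s t, zc s = zc t -> wc s = wc t -> s = t.
Variables (l : nat) (sigma : {rmorphism K -> K}) (om : K).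
Hypotheses (l_gt1 : (1 < l)%N) (om_prim : l.-primitive_root om).
Hypotheses (sz : forall t, sigma (zc t) = zc t ^+ l)
           (sw : forall t, sigma (wc t) = wc t ^+ l).
Variables (g : {poly {poly K}}) (h : T -> K) (m D : nat).
Hypotheses (ig : indecomposable g) (size_g : (1 < size g)%N).
Hypotheses (gm : (size g <= m.+1)%N) (ygm : (sizeY g <= m.+1)%N).
Hypotheses (mD : (l.+1 * m <= D)%N) (kh : kills zc wc h D D).
Hypotheses (gh : forall t, ev zc wc g t * h t = 0) (h0 : exists t, h t != 0).

Lemma indecomposable_primitive th : at1 th g != 0.
Proof.
apply/eqP => /at1_eq0_factor [p Eg sp].
case: (ig Eg) => /andP[s1 s2].
  by move: s2; rewrite sizeYE swapXY_polyC size_map_polyC size_XsubC.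
by move: size_g; rewrite -sp ltnNge s1.
Qed.

(** [sigma] acts on the support of [h] as the [l]-th power map, so that the conjugate of [g]
    pulled back by that map annihilates [h] too.  By [common_eq0] it is not coprime to [g]. *)
Lemma dvdp_power_pullback :
  g %| power_pullback l (map_poly (map_poly sigma) g).
Proof.
set g' := power_pullback _ _.
have l_gt0 : (0 < l)%N by apply: ltnW.
have g'h t : ev zc wc g' t * h t = 0.
  have [->|ht] := eqVneq (h t) 0; first by rewrite mulr0.
  have /eqP := gh t; rewrite mulf_eq0 (negPf ht) orbF => /eqP gt.
  have E : ev zc wc g' t = sigma (ev zc wc g t).
    by rewrite /g' ev_power_pullback -ev_map /ev sz sw.
  by rewrite E gt rmorph0 mul0r.
have [cop|//] := indecomposable_coprime g' ig size_g; exfalso.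
have [e Ee] : exists e, size g = e.+1 by exists (size g).-1; rewrite prednK // ltnW.
have em : (e <= m)%N by rewrite -ltnS -Ee.
have e1 : (0 < e)%N by rewrite -ltnS -Ee.
have sg' : (size g' <= (l * e).+1)%N.
  by rewrite (leq_trans (size_power_pullback _ _)) // size_map2 Ee addn1.
have yg : (sizeY g <= D.+1)%N by move: ygm mD; move: (sizeY g) => y; nia.
have yg' : (sizeY g' <= D.+1)%N.
  rewrite (leq_trans (sizeY_power_pullback _ l_gt0)) //.
  have := sizeY_map2 sigma g; move: ygm mD.
  by move: (sizeY g) (sizeY _) => y y'; nia.
have D0 : (0 < D)%N by move: mD em e1; nia.
have [t /eqP[]] := h0.
apply: (common_eq0 Ee sg' yg yg' cop D0 indecomposable_primitive inj_zw).
split=> //; move=> i j id jd; apply: kh => //.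
by apply: leq_trans jd _; move: mD em; nia.
Qed.

(** The pullback is invariant under the [l ^ 2] translations by [l]-torsion points, so that
    the translates of [g] all divide it.  Its degree in [w] is only [l] times that of [g],
    hence these translates are not pairwise coprime. *)
Lemma two_translates_associate : exists (a b : 'I_l * 'I_l) (lam : K),
  [/\ a != b, lam != 0 & forall i j,
    om ^+ (a.1 * i + a.2 * j) * g`_j`_i = lam * (om ^+ (b.1 * i + b.2 * j) * g`_j`_i)].
Proof.
have l_gt0 : (0 < l)%N by apply: ltnW.
have om0 := prim_root_neq0 om_prim.
pose G (c : 'I_l * 'I_l) := translate (om ^+ c.1) (om ^+ c.2) g.
have omn n : om ^+ n != 0 by rewrite expf_neq0.
have Gg' c : G c %| power_pullback l (map_poly (map_poly sigma) g).
  have := dvdp_translate (omn c.1) (omn c.2) dvdp_power_pullback.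
  by rewrite translate_power_pullback // -exprM mulnC exprM (prim_expr_order om_prim) expr1n.
have sG c : size (G c) = size g by rewrite size_translate.
have [/existsP [a /existsP [b /andP[ab ncop]]]|] :=
    boolP [exists a, exists b, (a != b) && ~~ coprimep (G a) (G b)]; last first.
  rewrite negb_exists => /forallP H; exfalso.
  have pG : \prod_c G c %| power_pullback l (map_poly (map_poly sigma) g).
    apply: dvdp_prod_coprime (index_enum_uniq _) (fun c _ => Gg' c) _ => a b _ _ ab.
    have := H a; rewrite negb_exists => /forallP /(_ b).
    by rewrite negb_and ab /= negbK.
  have g0 : power_pullback l (map_poly (map_poly sigma) g) != 0.
    apply/eqP => E; have : lead_coef g != 0 by rewrite lead_coef_eq0 -size_poly_gt0 ltnW.
    rewrite -lead_coef_eq0 lead_coefE; set i := _.-1; set j := (size g).-1.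
    have := coef_power_pullback (map_poly (map_poly sigma) g) (l * i) (l * j) l_gt0.
    rewrite E !coef0 !dvdn_mulr // ![(l * _)%N]mulnC !mulnK // !coef_map /=.
    by move/esym/eqP; rewrite fmorph_eq0 => ->.
  (* degree in [w]: [l ^ 2 d] for the product, at most [l d] for the pullback *)
  have := Pdiv.Idomain.dvdp_leq g0 pG.
  rewrite size_prod => [|c _]; last by rewrite -size_poly_gt0 sG ltnW.
  under eq_bigr => c _ do rewrite sG.
  rewrite sum_nat_const card_prod card_ord.
  have := size_power_pullback l (map_poly (map_poly sigma) g); rewrite size_map2.
  move: size_g l_gt1; case: (size g) => [|[|x]] // _ l2.
  move: (size _) => y y1 y2; have := leq_trans y2 y1.
  have -> : ((l * l * x.+2).+1 - l * l = l * l * x.+1 + 1)%N by nia.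
  by rewrite leq_add2r /= leq_mul2r /= -[X in (_ <= X)%N]muln1 leq_mul2l; lia.
have gp := indecomposable_primitive.
have [|dG] := @indecomposable_coprime K (G a) (G b)
  (indecomposable_translate (omn a.1) (omn a.2) ig) (ltac:(by rewrite sG)).
  by move=> cop; rewrite cop in ncop.
have /Pdiv.Idomain.dvdpP [[c q] /= c0 Ecq] := dG.
have Gb0 : G b != 0 by rewrite -size_poly_gt0 sG ltnW.
have q0 : q != 0.
  apply: contraNneq c0 => q0; have /eqP := Ecq.
  by rewrite q0 mul0r -mul_polyC mulf_eq0 (negPf Gb0) orbF polyC_eq0.
have q1 : size q == 1%N.
  have := congr1 (fun p : {poly {poly K}} => size p) Ecq.
  rewrite size_scale // size_mul //; last by rewrite -size_poly_gt0 sG ltnW.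
  rewrite !sG; move: size_g; rewrite -(size_poly_gt0 q) in q0.
  by move: (size g) (size q) q0 => x y; move=> ? ? ?; apply/eqP; lia.
have [q' q'0 Eq] := size_poly1P _ q1.
rewrite Eq mul_polyC in Ecq.
have Gp c' th : at1 th (G c') != 0 by rewrite at1_translate.
have [lam lam0 El] := associate_scalar (Gp a) (Gp b) q'0 (esym Ecq).
exists a, b, lam; split=> // i j.
have := congr1 (fun p : {poly {poly K}} => p`_j`_i) El.
rewrite coefZ coefCM !coef_translate -!exprM -!exprD => ->.
by [].
Qed.

(** Comparing the identity between two translates at two exponents of [g] eliminates the
    constant and leaves a power of [om] equal to [1]. *)
Lemma exponents_in_sublattice : exists x y : int,
  ~~ ((l%:Z %| x)%Z && (l%:Z %| y)%Z) /\
  forall i j i' j', g`_j`_i != 0 -> g`_j'`_i' != 0 ->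
    (l%:Z %| x * (i%:Z - i'%:Z) + y * (j%:Z - j'%:Z))%Z.
Proof.
have [a [b [lam [ab lam0 H]]]] := two_translates_associate.
have om0 := prim_root_neq0 om_prim.
exists (a.1%:Z - b.1%:Z), (a.2%:Z - b.2%:Z); split.
  apply: contra ab; rewrite -!eqz_mod_dvd !modz_nat !eqz_nat => /andP[].
  rewrite !modn_small // => /eqP e1 /eqP e2.
  by rewrite -pair_eqE; apply/andP; split; apply/eqP/val_inj.
move=> i j i' j' gij gij'.
have H1 : om ^+ (a.1 * i + a.2 * j) = lam * om ^+ (b.1 * i + b.2 * j).
  by apply: (mulIf gij); rewrite H mulrA.
have H2 : om ^+ (a.1 * i' + a.2 * j') = lam * om ^+ (b.1 * i' + b.2 * j').
  by apply: (mulIf gij'); rewrite H mulrA.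
have /eqP : om ^+ (a.1 * i + a.2 * j + (b.1 * i' + b.2 * j'))
     = om ^+ (b.1 * i + b.2 * j + (a.1 * i' + a.2 * j')).
  by rewrite [LHS]exprD [RHS]exprD H1 H2; ring.
rewrite (eq_prim_root_expr om_prim) => /eqP E.
have -> : (a.1%:Z - b.1%:Z) * (i%:Z - i'%:Z) + (a.2%:Z - b.2%:Z) * (j%:Z - j'%:Z)
   = (a.1 * i + a.2 * j + (b.1 * i' + b.2 * j'))%N%:Z
     - (b.1 * i + b.2 * j + (a.1 * i' + a.2 * j'))%N%:Z.
  by rewrite !PoszD !PoszM; ring.
by rewrite -eqz_mod_dvd !modz_nat E.
Qed.

Definition exponent_det (i j i' j' i'' j'' : nat) : int :=
  (i%:Z - i''%:Z) * (j'%:Z - j''%:Z) - (i'%:Z - i''%:Z) * (j%:Z - j''%:Z).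

(** Modulo [l], both exponent differences are orthogonal to the same nonzero vector. *)
Lemma prime_dvd_exponent_det i j i' j' i'' j'' : prime l ->
  g`_j`_i != 0 -> g`_j'`_i' != 0 -> g`_j''`_i'' != 0 ->
  (l%:Z %| exponent_det i j i' j' i'' j'')%Z.
Proof.
move=> pl g1 g2 g3; have [x [y [xy H]]] := exponents_in_sublattice.
have /dvdzP [u Eu] := H _ _ _ _ g1 g3; have /dvdzP [v Ev] := H _ _ _ _ g2 g3.
rewrite /exponent_det; set d := (X in (_ %| X)%Z).
have key z : ~~ (l%:Z %| z)%Z -> (l%:Z %| z * d)%Z -> (l%:Z %| d)%Z.
  by rewrite {1}dvdzE => lz; rewrite Gauss_dvdzr // coprimezE absz_nat prime_coprime.
move: xy; rewrite negb_and => /orP[] /key; apply; apply/dvdzP.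
  exists (u * (j'%:Z - j''%:Z) - v * (j%:Z - j''%:Z)).
  rewrite mulrBl -!mulrA ![_ * l%:Z]mulrC !mulrA ![_ * l%:Z]mulrC.
  rewrite [l%:Z * u]mulrC [l%:Z * v]mulrC -Eu -Ev /d; ring.
exists (v * (i%:Z - i''%:Z) - u * (i'%:Z - i''%:Z)).
rewrite mulrBl -!mulrA ![_ * l%:Z]mulrC !mulrA ![_ * l%:Z]mulrC.
rewrite [l%:Z * u]mulrC [l%:Z * v]mulrC -Eu -Ev /d; ring.
Qed.

End PowerMapStep.

(** * Functions carried by curves through roots of unity *)

Section SmallCurve.

Variables (K : closedFieldType) (T : finType) (zc wc : T -> K).

(** There are more monomials of bidegree at most [m] than points. *)
Lemma vanishing_curve (Y : {set T}) m : (#|Y| < m.+1 * m.+1)%N ->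
  exists g : {poly {poly K}}, [/\ g != 0, (size g <= m.+1)%N, (sizeY g <= m.+1)%N
    & forall t, t \in Y -> ev zc wc g t = 0].
Proof.
move=> Ym; pose I := ('I_m.+1 * 'I_m.+1)%type.
pose W : 'M[K]_(#|{: I}|, #|Y|) := \matrix_(r, c)
  (zc (enum_val c) ^+ (enum_val r : I).1 * wc (enum_val c) ^+ (enum_val r : I).2).
have : kermx W != 0.
  rewrite kermx_eq0 /row_free neq_ltn; apply/orP; left.
  by rewrite (leq_ltn_trans (rank_leq_col _)) // card_prod card_ord.
move/rowV0Pn => [v /sub_kermxP vW v0].
pose g : {poly {poly K}} := \poly_(j < m.+1) \poly_(i < m.+1)
  v 0 (enum_rank (inord i : 'I_m.+1, inord j : 'I_m.+1)).
have sg : (size g <= m.+1)%N by apply: size_poly.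
have yg : (sizeY g <= m.+1)%N.
  apply: sizeY_leqP => j; rewrite coef_poly; case: ifP => _; first exact: size_poly.
  by rewrite size_poly0.
have gc (i j : 'I_m.+1) : g`_j`_i = v 0 (enum_rank (i, j)).
  by rewrite !coef_poly !ltn_ord coef_poly ltn_ord !inord_val.
exists g; split=> //.
  apply: contra v0 => /eqP g0; apply/eqP/rowP => r; rewrite !mxE.
  by rewrite -(enum_valK r); case: (enum_val r) => i j; rewrite -gc g0 !coef0.
move=> t tY; rewrite (evE _ _ _ yg sg) exchange_big pair_bigA /=.
have /rowP /(_ (enum_rank_in tY t)) := vW; rewrite !mxE => E; rewrite -[RHS]E.
rewrite (reindex (fun r : 'I_#|{: I}| => (enum_val r : I))) /=; last first.
  by exists enum_rank => x _; rewrite ?enum_valK ?enum_rankK.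
apply: eq_bigr => r _; rewrite mxE enum_rankK_in //.
by rewrite gc -surjective_pairing enum_valK.
Qed.

End SmallCurve.

Section TorusLines.

Variables (K : closedFieldType) (N : nat) (zeta : K).
Hypothesis zeta_prim : N.-primitive_root zeta.

Let T := ('I_N * 'I_N)%type.
Definition zcoord (t : T) := zeta ^+ t.1.
Definition wcoord (t : T) := zeta ^+ t.2.

Lemma prim_expz_eq1 (n : int) : (zeta ^ n == 1) = (N%:Z %| n)%Z.
Proof.
case: n => n; first by rewrite -exprnP -(prim_order_dvd zeta_prim) dvdzE.
by rewrite NegzE -exprnN invr_eq1 -(prim_order_dvd zeta_prim) dvdzE abszN.
Qed.

Lemma prim_expz_eq (n k : int) : (zeta ^ n == zeta ^ k) = (N%:Z %| n - k)%Z.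
Proof.
have k0 : zeta ^ k != 0 by rewrite expfz_neq0 ?(prim_root_neq0 zeta_prim).
rewrite -prim_expz_eq1 expfzDr ?(prim_root_neq0 zeta_prim) // -invr_expz.
by rewrite -(inj_eq (mulIf (invr_neq0 k0))) divff.
Qed.

Definition on_line (a b kappa : int) (t : T) : bool :=
  (N%:Z %| a * t.1%:Z + b * t.2%:Z - kappa)%Z.

Lemma inj_zw s t : zcoord s = zcoord t -> wcoord s = wcoord t -> s = t.
Proof.
case: s t => [s1 s2] [t1 t2] /eqP; rewrite (eq_prim_root_expr zeta_prim) !modn_small //=.
move=> /eqP/val_inj-> /eqP; rewrite (eq_prim_root_expr zeta_prim) !modn_small //=.
by move=> /eqP/val_inj->.
Qed.

Definition nonzero_set (h : T -> K) : {set T} := [set t | h t != 0]%SET.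

(** On a line [a t1 + b t2 = kappa] with [a], [b] coprime the pairing with a
    frequency [x] is, up to a phase, a function of the integer [- b x1 + a x2] alone;
    the [x] in the box reach all integers of a long interval, so that a function
    annihilated by them cannot have few nonzero values. *)
Lemma kills_on_line_card_pos (a b kappa : int) (h : T -> K) D :
  coprimez a b -> 0 < a ->
  (`|a| <= D)%N -> (forall t, h t != 0 -> on_line a b kappa t) -> (exists t, h t != 0) ->
  kills zcoord wcoord h D D -> (`|a| * (D - 2 * `|b|) < #|nonzero_set h|)%N.
Proof.
move=> /coprimezP [[u v] /= uv] a0 aD hline [t0 ht0] kh.
rewrite ltnNge; apply/negP => small.
set S := nonzero_set h in small.
have z0 := (prim_root_neq0 zeta_prim).
pose s (t : T) : int := u * t.2%:Z - v * t.1%:Z.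
pose rho t := zeta ^ s t.
(* since [u a + v b = 1], the points of the line are parametrised by [s] *)
have t1E t : on_line a b kappa t -> exists n, t.1%:Z = u * kappa - b * s t + n * N%:Z.
  move=> /dvdzP [n En]; exists (u * n); rewrite -mulrA -En /s.
  by rewrite -[LHS]mul1r -uv; ring.
have t2E t : on_line a b kappa t -> exists n, t.2%:Z = v * kappa + a * s t + n * N%:Z.
  move=> /dvdzP [n En]; exists (v * n); rewrite -mulrA -En /s.
  by rewrite -[LHS]mul1r -uv; ring.
have zN n : zeta ^ (n * N%:Z) = 1.
  by apply/eqP; rewrite prim_expz_eq1 dvdz_mull.
have rho_inj t t' : t \in S -> t' \in S -> rho t = rho t' -> t = t'.
  rewrite !inE => /hline lt /hline lt' /eqP; rewrite prim_expz_eq => /dvdzP [n En].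
  have ss : s t = s t' + n * N%:Z by rewrite -En; ring.
  have [n1 E1] := t1E t lt; have [n1' E1'] := t1E t' lt'.
  have [n2 E2] := t2E t lt; have [n2' E2'] := t2E t' lt'.
  apply: inj_zw; rewrite /zcoord /wcoord !exprnP; apply/eqP; rewrite prim_expz_eq; apply/dvdzP.
    by exists (n1 - n1' - b * n); rewrite E1 E1' ss; ring.
  by exists (n2 - n2' + a * n); rewrite E2 E2' ss; ring.
have kill_tau (i : nat) : (i < `|a| * (D - 2 * `|b|))%N ->
    \sum_t h t * (zeta ^ (s t * (`|a| * `|b|)%N%:Z) * rho t ^+ i) = 0.
  move=> iJ; pose tau : int := (`|a| * `|b| + i)%N%:Z.
  have aE : `|a|%N%:Z = a by rewrite gez0_abs // ltW.
  have an0 : a != 0 by rewrite gt_eqF.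
  (* a monomial of the box with [- b x1 + a x2 = tau] *)
  pose x1 := ((- v * tau) %% a)%Z; pose x2 := ((tau + b * x1) %/ a)%Z.
  have x10 : 0 <= x1 by rewrite modz_ge0.
  have x1a : x1 < a by rewrite -[X in _ < X](gtr0_norm a0) ltz_mod.
  have x2E : x2 * a = tau + b * x1.
    apply: divzK; apply/dvdzP.
    exists (u * tau - b * ((- v * tau) %/ a)%Z).
    have := divz_eq (- v * tau) a; rewrite -/x1 => E.
    have -> : x1 = (- v * tau) - ((- v * tau) %/ a)%Z * a by rewrite {1}E; ring.
    rewrite -[X in X + _]mul1r -uv; ring.
  have bx : `|b * x1| <= `|b| * a.
    by rewrite normrM ler_wpM2l // ger0_norm // ltW.
  have bE : `|b|%N%:Z = `|b| by rewrite abszE.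
  have tauE : tau = a * `|b| + i%:Z by rewrite /tau PoszD PoszM aE bE.
  have [bx1 bx2] : - (`|b| * a) <= b * x1 /\ b * x1 <= `|b| * a.
    by apply/andP; rewrite -ler_norml.
  have x20 : 0 <= x2.
    rewrite -(pmulr_lge0 _ a0) x2E tauE.
    by have : 0 <= i%:Z by []; move: bx1; lia.
  have x2D : x2 < D%:Z.
    rewrite -(ltr_pM2r a0) x2E tauE.
    have : i%:Z < a * (D%:Z - 2 * `|b|).
      have DB : (2 * `|b| <= D)%N.
        by case: (leqP (2 * `|b|) D) iJ => // /ltnW; rewrite -subn_eq0 => /eqP->; rewrite muln0.
      by move: iJ; rewrite -ltz_nat PoszM aE -subzn // PoszM bE.
    by move: bx2; lia.
  have [m1 Em1] : exists n : nat, x1 = n%:Z by exists `|x1|%N; rewrite gez0_abs.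
  have [m2 Em2] : exists n : nat, x2 = n%:Z by exists `|x2|%N; rewrite gez0_abs.
  have m1D : (m1 < D)%N.
    by rewrite -ltz_nat -Em1 (lt_le_trans x1a) // -aE lez_nat.
  have m2D : (m2 < D)%N by rewrite -ltz_nat -Em2.
  have := kh m1 m2 m1D m2D.
  have -> : \sum_t h t * (zcoord t ^+ m1 * wcoord t ^+ m2) =
    zeta ^ (kappa * (u * x1 + v * x2)) *
    \sum_t h t * (zeta ^ (s t * (`|a| * `|b|)%N%:Z) * rho t ^+ i).
    rewrite mulr_sumr; apply: eq_bigr => t _.
    have [->|ht] := eqVneq (h t) 0; first by rewrite !mul0r mulr0.
    rewrite [RHS]mulrCA; congr (_ * _).
    have [n1 E1] := t1E t (hline t ht); have [n2 E2] := t2E t (hline t ht).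
    rewrite /zcoord /wcoord /rho !exprnP !exprz_exp -!expfzDr //.
    apply/eqP; rewrite prim_expz_eq; apply/dvdzP; exists (n1 * x1 + n2 * x2).
    rewrite E1 E2 -Em1 -Em2.
    have -> : s t * (`|a| * `|b|)%N%:Z + s t * i%:Z = s t * tau by rewrite /tau PoszD; ring.
    have -> : tau = x2 * a - b * x1 by rewrite x2E; ring.
    by ring.
  by move/eqP; rewrite mulf_eq0 (negPf (expfz_neq0 _ z0)) => /eqP.
have t0S : t0 \in S by rewrite inE.
pose ws := [seq rho t | t <- enum S].
have uws : uniq ws.
  by rewrite map_inj_in_uniq ?enum_uniq // => t t'; rewrite !mem_enum; apply: rho_inj.
have t0e : t0 \in enum S by rewrite mem_enum.
(* [P] isolates [t0]; its degree is at most the size of the support *)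
have [P [sP P0 Pw]] := separator uws (map_f rho t0e).
have : \sum_t h t * (zeta ^ (s t * (`|a| * `|b|)%N%:Z) * P.[rho t]) = 0.
  under eq_bigr => t _ do rewrite horner_coef !mulr_sumr.
  rewrite exchange_big big1 // => i _.
  under eq_bigr => t _ do rewrite [_ * (P`_i * _)]mulrCA [h t * _]mulrCA.
  rewrite -mulr_sumr kill_tau ?mulr0 //.
  by apply: leq_trans (ltn_ord i) _; rewrite sP size_map -cardE.
rewrite (bigD1 t0) //= big1 ?addr0 => [|t tt0].
  move/eqP; rewrite !mulf_eq0 (negPf ht0) (negPf P0) orbF.
  by rewrite (negPf (expfz_neq0 _ z0)).
have [->|ht] := eqVneq (h t) 0; first by rewrite mul0r.
have tS : t \in S by rewrite inE.
rewrite Pw ?mulr0 ?mem_enum ?map_f ?mem_enum //.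
by apply: contra tt0 => /eqP /(rho_inj _ _ tS t0S) ->.
Qed.

Lemma kills_on_line_card (a b kappa : int) (h : T -> K) D :
  coprimez a b -> a != 0 ->
  (`|a| <= D)%N -> (forall t, h t != 0 -> on_line a b kappa t) -> (exists t, h t != 0) ->
  kills zcoord wcoord h D D -> (`|a| * (D - 2 * `|b|) < #|nonzero_set h|)%N.
Proof.
move=> cab; rewrite neq_lt => /orP[] a0; last exact: (kills_on_line_card_pos cab a0).
move=> aD hl; rewrite -[in X in (X < _)%N](abszN a) -(abszN b).
apply: (@kills_on_line_card_pos _ _ (- kappa)); rewrite ?abszN ?oppr_gt0 //.
  by move: cab; rewrite !coprimezE !abszN.
move=> t /hl; rewrite /on_line !dvdzE => H.
have -> : - a * t.1%:Z + - b * t.2%:Z - - kappa = - (a * t.1%:Z + b * t.2%:Z - kappa) by ring.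
by rewrite abszN.
Qed.

Lemma sum_swap (F : T -> K) : \sum_t F t = \sum_(t : T) F (t.2, t.1).
Proof.
rewrite (reindex (fun t : T => (t.2, t.1))) //=.
by exists (fun t : T => (t.2, t.1)) => -[].
Qed.

Lemma kills_on_line_card_swap (a b kappa : int) (h : T -> K) D :
  coprimez a b -> b != 0 ->
  (`|b| <= D)%N -> (forall t, h t != 0 -> on_line a b kappa t) -> (exists t, h t != 0) ->
  kills zcoord wcoord h D D -> (`|b| * (D - 2 * `|a|) < #|nonzero_set h|)%N.
Proof.
move=> cab b0 bD hl [t0 ht0] kh.
have -> : #|nonzero_set h| = #|nonzero_set (fun t => h (t.2, t.1))|.
  rewrite -(card_imset _ (_ : injective (fun t : T => (t.2, t.1)))); last first.
    by move=> [x y] [x' y'] [-> ->].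
  congr #|pred_of_set _|; apply/setP => -[x y]; rewrite !inE /=.
  apply/imsetP/idP => [[[x' y']] | hyx]; first by rewrite inE /= => ht [-> ->].
  by exists (y, x); rewrite ?inE.
apply: (@kills_on_line_card _ _ kappa); rewrite 1?coprimez_sym //.
- by move=> [x y] /hl; rewrite /on_line /= [_ * _ + _]addrC.
- by exists (t0.2, t0.1) => /=; rewrite -surjective_pairing.
move=> i j iD jD; rewrite sum_swap -[RHS](kh j i jD iD) /=.
by apply: eq_bigr => -[x y] _ /=; rewrite /zcoord /wcoord /= [_ ^+ i * _]mulrC.
Qed.

Lemma dist_lt (x y m : nat) : (x < m.+1)%N -> (y < m.+1)%N -> (`|(x%:Z - y%:Z)%R| <= m)%N.
Proof. by lia. Qed.

Lemma pred_add_leq (x y p q : nat) :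
  (x <= p.+1)%N -> (y <= q.+1)%N -> ((x + y).-1 <= (p + q).+1)%N.
Proof. by lia. Qed.

(** A curve whose exponents all lie on one line of direction [(a, b)] is, on the
    torus, an equation in the single quantity [z^a w^b]: it confines the support of
    [h] to few cosets of a one-dimensional subgroup, and multiplying by binomials
    removes all of them but one. *)
Lemma collinear_exponents_line (g : {poly {poly K}}) (h : T -> K) m :
  (size g <= m.+1)%N -> (sizeY g <= m.+1)%N -> (exists t, h t != 0) ->
  (forall t, ev zcoord wcoord g t * h t = 0) -> g != 0 ->
  (forall i j i' j' i'' j'', g`_j`_i != 0 -> g`_j'`_i' != 0 -> g`_j''`_i'' != 0 ->
     exponent_det i j i' j' i'' j'' = 0) ->
  exists (a b kappa : int) (q : {poly {poly K}}), [/\ coprimez a b, (`|a| <= m)%N, (`|b| <= m)%N,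
     (size q <= m.+1)%N & (sizeY q <= m.+1)%N] /\
     [/\ exists t, ev zcoord wcoord q t * h t != 0
      & forall t, ev zcoord wcoord q t * h t != 0 -> on_line a b kappa t].
Proof.
move=> sg yg [t0 ht0] gh g0 col.
pose I := ('I_m.+1 * 'I_m.+1)%type.
pose sp (s : I) := g`_s.2`_s.1 != 0.
have Eev t : ev zcoord wcoord g t =
    \sum_(s : I | sp s) g`_s.2`_s.1 * (zcoord t ^+ s.1 * wcoord t ^+ s.2).
  rewrite (evE _ _ t yg sg) exchange_big pair_bigA /= big_mkcond [RHS]big_mkcond /=.
  by apply: eq_bigr => s _; case: ifP => // /negbFE/eqP ->; rewrite mul0r.
have sp_ex : exists s, sp s.
  apply/existsP; apply: contraR g0; rewrite negb_exists => /forallP H.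
  apply/eqP/polyP2 => i j; rewrite !coef0.
  have [im|im] := ltnP i m.+1; last first.
    by rewrite nth_default // (leq_trans (max_size_coefXY _ _)) // (leq_trans yg).
  have [jm|jm] := ltnP j m.+1; last by rewrite [g`_j]nth_default ?coef0 // (leq_trans sg).
  by have := H (Ordinal im, Ordinal jm); rewrite negbK => /eqP.
have [sx spx] := sp_ex.
(* injective on exponents and linear, hence monotone along their common line *)
pose lam (s : I) := (s.1 * m.+1 + s.2)%N.
have lam_inj s s' : lam s = lam s' -> s = s'.
  rewrite /lam => E; have e2 : s.2 = s'.2 :> nat.
    by have := congr1 (modn^~ m.+1) E; rewrite /= !modnMDl !modn_small.
  have e1 : s.1 = s'.1 :> nat by move: E; rewrite e2 => /addIn /eqP; rewrite eqn_pmul2r // => /eqP.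
  by case: s s' e1 e2 {E} => [x y] [x' y'] /= /val_inj -> /val_inj ->.
case: (@arg_minnP _ sx sp lam spx) => s0 sp0 min0.
case: (@arg_maxnP _ sx sp lam spx) => s1 sp1 max1_.
have max1 s : sp s -> (lam s <= lam s1)%N by apply: max1_.
have z0 := (prim_root_neq0 zeta_prim).
have s01 : s0 != s1.
  apply: contra ht0 => /eqP s01; have := gh t0; rewrite Eev (big_pred1 s0).
    by move/eqP; rewrite mulf_eq0 mulf_eq0 (negPf sp0) mulf_eq0 !expf_eq0 (negPf z0) !andbF.
  move=> s; apply/idP/eqP => [sps|-> //]; apply: lam_inj; apply/eqP.
  by rewrite eqn_leq min0 // s01 max1.
pose di (s s' : I) (f : I -> nat) : int := (f s)%:Z - (f s')%:Z.
pose f1 (s : I) : nat := s.1; pose f2 (s : I) : nat := s.2.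
pose d1 := di s1 s0 f1; pose d2 := di s1 s0 f2.
have d0 : ~~ ((d1 == 0) && (d2 == 0)).
  apply: contra s01; rewrite /d1 /d2 /di !subr_eq0 !eqz_nat /f1 /f2 => /andP[/eqP e1 /eqP e2].
  by case: (s0) (s1) e1 e2 => [x y] [x' y'] /= /val_inj -> /val_inj ->.
pose e := gcdz d1 d2.
have e0 : 0 < e by rewrite /e /gcdz ltz_nat gcdn_gt0 !absz_gt0 -negb_and.
pose a := (d1 %/ e)%Z; pose b := (d2 %/ e)%Z.
have Ea : a * e = d1 by rewrite divzK // dvdz_gcdl.
have Eb : b * e = d2 by rewrite divzK // dvdz_gcdr.
have [u [v uv]] : exists u v : int, u * a + v * b = 1.
  have [u [v E]] := Bezoutz d1 d2; exists u, v.
  apply: (mulIf (lt0r_neq0 e0)); rewrite mul1r -[RHS]E -Ea -Eb; ring.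
have cab : coprimez a b by apply/coprimezP; exists (u, v).
(* the position of [s] on the line, counted from [s0] in steps of [(a, b)] *)
pose tt s := u * di s s0 f1 + v * di s s0 f2.
have Ett s : sp s -> di s s0 f1 = tt s * a /\ di s s0 f2 = tt s * b.
  move=> sps; have := col _ _ _ _ _ _ sps sp1 sp0; rewrite /exponent_det.
  rewrite -/(di s s0 f1) -/(di s s0 f2) -/(di s1 s0 f1) -/(di s1 s0 f2) -/d1 -/d2 -Ea -Eb.
  move=> E; have {}E : di s s0 f1 * b = a * di s s0 f2.
    by apply: (mulIf (lt0r_neq0 e0)); apply/eqP; rewrite -subr_eq0 -[X in _ == X]E; apply/eqP; ring.
  move: E; rewrite /tt; move: (di s s0 f1) (di s s0 f2) => x y E; split.
    have -> : (u * x + v * y) * a = x * (u * a + v * b) + v * (a * y - x * b) by ring.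
    by rewrite uv E subrr mulr0 mulr1 addr0.
  have -> : (u * x + v * y) * b = y * (u * a + v * b) + u * (x * b - a * y) by ring.
  by rewrite uv E subrr mulr0 mulr1 addr0.
pose c : int := m.+1%:Z * a + b.
have lamE s : sp s -> (lam s)%:Z - (lam s0)%:Z = tt s * c.
  move=> /Ett [E1 E2]; rewrite /c mulrDr mulrCA -E1 -E2 /lam /di /f1 /f2 !PoszD !PoszM; ring.
have tt1 : tt s1 = e.
  by rewrite /tt -/d1 -/d2 -Ea -Eb -[RHS]mul1r -uv; ring.
have c0 : 0 < c.
  have : (lam s0)%:Z < (lam s1)%:Z.
    rewrite ltz_nat ltn_neqAle min0 // andbT.
    by apply: contra s01 => /eqP/lam_inj ->.
  by rewrite -subr_gt0 lamE // tt1 pmulr_rgt0.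
have tt_ge0 s : sp s -> 0 <= tt s.
  by move=> sps; rewrite -(pmulr_lge0 _ c0) -lamE // subr_ge0 lez_nat min0.
have tt_le s : sp s -> tt s <= e.
  move=> sps; rewrite -(ler_pM2r c0) -tt1 -!lamE // lerD2r lez_nat; exact: max1.
(* up to a monomial, [g] is this polynomial in [z ^ a w ^ b] *)
pose G := \sum_(s : I | sp s) g`_s.2`_s.1 *: 'X^(`|tt s|).
have sG : (size G <= `|e|.+1)%N.
  apply: (leq_trans (size_sum _ _ _)); apply/bigmax_leqP => s sps.
  rewrite (leq_trans (size_scale_leq _ _)) // size_polyXn ltnS.
  by rewrite -lez_nat !gez0_abs ?tt_le ?tt_ge0 // ltW.
have G0 : G != 0.
  apply: contra (sp0) => /eqP /(congr1 (fun p : {poly K} => p`_0)).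
  rewrite coef0 coef_sum (bigD1 s0) //= big1 => [|s /andP[sps ss0]].
    rewrite addr0 coefZ coefXn (_ : tt s0 = 0) ?absz0 ?eqxx ?mulr1 => [->//|].
    by rewrite /tt /di !subrr !mulr0.
  rewrite coefZ coefXn eq_sym absz_eq0.
  case: eqP => ts; last by rewrite mulr0.
  have := lamE s sps; rewrite ts mul0r => /eqP; rewrite subr_eq0 eqz_nat => /eqP/lam_inj E.
  by rewrite E eqxx in ss0.
pose y (t : T) := zeta ^ (a * t.1%:Z + b * t.2%:Z).
have evG t : ev zcoord wcoord g t = zcoord t ^+ s0.1 * wcoord t ^+ s0.2 * G.[y t].
  rewrite Eev /G horner_sum mulr_sumr; apply: eq_bigr => s sps.
  rewrite hornerZ hornerXn [RHS]mulrCA; congr (_ * _).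
  rewrite /zcoord /wcoord /y !exprnP !exprz_exp -!expfzDr //.
  rewrite gez0_abs ?tt_ge0 //; congr (_ ^ _).
  have [E1 E2] := Ett s sps.
  have -> : s.1%:Z = di s s0 f1 + s0.1%:Z by rewrite /di /f1; ring.
  have -> : s.2%:Z = di s s0 f2 + s0.2%:Z by rewrite /di /f2; ring.
  by rewrite E1 E2; ring.
have Gy t : h t != 0 -> root G (y t).
  move=> ht; have /eqP := gh t; rewrite evG !mulf_eq0 (negPf ht) orbF.
  by rewrite /zcoord /wcoord !expf_eq0 (negPf z0) !andbF.
pose ys := undup [seq y t | t <- enum (nonzero_set h)].
have yys t : h t != 0 -> y t \in ys.
  by move=> ht; rewrite mem_undup map_f // mem_enum inE.
have sys : (size ys <= `|e|)%N.
  rewrite -ltnS; apply: leq_trans sG; apply: max_poly_roots G0 _ (undup_uniq _).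
  apply/allP => w; rewrite mem_undup => /mapP [t]; rewrite mem_enum inE => ht ->.
  exact: Gy.
(* positive and negative parts, to clear the denominators of [z ^ a w ^ b] *)
pose pp (n : int) : nat := if 0 <= n then `|n|%N else 0%N.
pose np (n : int) : nat := if 0 <= n then 0%N else `|n|%N.
have pnE n : (pp n)%:Z - (np n)%:Z = n.
  by case: n => n; rewrite /pp /np /= ?subr0 // sub0r NegzE.
have pnle n : (pp n <= `|n|)%N /\ (np n <= `|n|)%N by rewrite /pp /np; case: ifP.
pose num (y0 : K) : {poly {poly K}} := mono K (pp a) (pp b) - y0%:P%:P * mono K (np a) (np b).
have evnum y0 t : ev zcoord wcoord (num y0) t =
    zcoord t ^+ np a * wcoord t ^+ np b * (y t - y0).
  rewrite evB ev_mono evM ev_mono {1}/ev !hornerC mulrBr [y0 * _]mulrC; congr (_ - _).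
  rewrite /zcoord /wcoord /y !exprnP !exprz_exp -!expfzDr //; congr (_ ^ _).
  have E n : (pp n)%:Z = n + (np n)%:Z by rewrite -{2}(pnE n) subrK.
  by rewrite !E; ring.
(* one factor for each other value of [z ^ a w ^ b] on the support *)
pose q := \prod_(y0 <- rem (y t0) ys) num y0.
have evq t : ev zcoord wcoord q t = \prod_(y0 <- rem (y t0) ys) ev zcoord wcoord (num y0) t.
  rewrite /q; elim: (rem _ _) => [|w r IH]; first by rewrite !big_nil /ev !hornerE.
  by rewrite !big_cons evM IH.
have ev_rem t : h t != 0 -> (ev zcoord wcoord q t != 0) = (y t == y t0).
  move=> ht; rewrite evq; apply/idP/eqP => [|yt].
    apply: contraTeq => yt; rewrite prodf_seq_neq0; apply/negP => /allP /(_ (y t)).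
    by rewrite mem_rem_uniq ?undup_uniq // !inE yt yys // evnum subrr mulr0 eqxx => /(_ isT).
  rewrite prodf_seq_neq0; apply/allP => w; rewrite mem_rem_uniq ?undup_uniq // !inE => /andP[wy _].
  rewrite /= evnum mulf_neq0 //; first by rewrite mulf_neq0 // !expf_neq0.
  by rewrite subr_eq0 yt eq_sym.
exists a, b, (a * t0.1%:Z + b * t0.2%:Z), q.
have ae : (`|a| * `|e| <= m)%N.
  rewrite -abszM Ea /d1 /di /f1; move: (ltn_ord s1.1) (ltn_ord s0.1).
  exact: dist_lt.
have be : (`|b| * `|e| <= m)%N.
  rewrite -abszM Eb /d2 /di /f2; move: (ltn_ord s1.2) (ltn_ord s0.2).
  exact: dist_lt.
have ae1 : (0 < `|e|)%N by rewrite absz_gt0 lt0r_neq0.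
have snum y0 : (size (num y0) <= `|b|.+1)%N.
  rewrite (leq_trans (size_polyD _ _)) // size_polyN geq_max; apply/andP; split.
    by rewrite (leq_trans (size_mono_leq _ _ _)) // ltnS (pnle b).1.
  rewrite mul_polyC (leq_trans (size_scale_leq _ _)) //.
  by rewrite (leq_trans (size_mono_leq _ _ _)) // ltnS (pnle b).2.
have ynum y0 : (sizeY (num y0) <= `|a|.+1)%N.
  rewrite (leq_trans (sizeYD _ _)) // sizeYN geq_max; apply/andP; split.
    by rewrite (leq_trans (sizeY_mono_leq _ _ _)) // ltnS (pnle a).1.
  apply: (leq_trans (sizeYM_leq _ _)).
  have : (sizeY (mono K (np a) (np b)) <= `|a|.+1)%N.
    by rewrite (leq_trans (sizeY_mono_leq _ _ _)) // ltnS (pnle a).2.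
  have : (sizeY (y0%:P%:P : {poly {poly K}})%R <= 1)%N.
    by rewrite sizeYE swapXY_polyC size_map_polyC size_polyC_leq1.
  by move=> h1 h2; rewrite -[`|a|%N]add0n; apply: pred_add_leq.
have srem : (size (rem (y t0) ys) <= `|e|)%N.
  by rewrite size_rem ?yys // (leq_trans (leq_pred _)).
have prod_le (F : {poly {poly K}} -> nat) d (r : seq K) :
    (forall p q, (F (p * q)%R <= (F p + F q).-1)%N) -> (F 1%R <= 1)%N ->
    (forall y0, (F (num y0) <= d.+1)%N) ->
    (F (\prod_(y0 <- r) num y0)%R <= (d * size r).+1)%N.
  move=> FM F1 Fn; elim: r => [|w r IH]; first by rewrite big_nil muln0.
  rewrite big_cons (leq_trans (FM _ _)) //= mulnS.
  exact: pred_add_leq.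
split; split.
- exact: cab.
- by apply: leq_trans ae; rewrite leq_pmulr.
- by apply: leq_trans be; rewrite leq_pmulr.
- apply: leq_trans (prod_le (fun p => size p) _ _ _ _ snum) _.
  + exact: size_polyMleq.
  + by rewrite size_poly1.
  by rewrite ltnS (leq_trans _ be) // leq_mul2l srem orbT.
- apply: leq_trans (prod_le _ _ _ _ _ ynum) _.
  + exact: sizeYM_leq.
  + by rewrite sizeYE rmorph1 size_poly1.
  by rewrite ltnS (leq_trans _ ae) // leq_mul2l srem orbT.
- by exists t0; rewrite mulf_neq0 // ev_rem.
move=> t; rewrite mulf_eq0 negb_or => /andP[qt ht].
by rewrite /on_line -prim_expz_eq -/(y t) -/(y t0) -ev_rem.
Qed.

End TorusLines.

(** * Small support forces a line *)

Lemma inj_on_line (N : nat) (a b kappa u v : int) (t t' : 'I_N * 'I_N) :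
  u * a + v * b = 1 -> on_line a b kappa t -> on_line a b kappa t' ->
  ((u * t.2%:Z - v * t.1%:Z) = (u * t'.2%:Z - v * t'.1%:Z) %[mod N%:Z])%Z -> t = t'.
Proof.
move=> uv /dvdzP [n En] /dvdzP [n' En'] /eqP; rewrite eqz_mod_dvd => /dvdzP [k Ek].
have ord_eq (x x' : 'I_N) : (N%:Z %| x%:Z - x'%:Z)%Z -> x = x'.
  by rewrite -eqz_mod_dvd !modz_nat eqz_nat !modn_small // => /eqP/val_inj.
have e1 : t.1 = t'.1.
  apply: ord_eq; apply/dvdzP; exists (u * (n - n') - b * k).
  rewrite mulrBl -!mulrA mulrBl -En -En' -Ek -[LHS]mul1r -uv; ring.
have e2 : t.2 = t'.2.
  apply: ord_eq; apply/dvdzP; exists (v * (n - n') + a * k).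
  rewrite mulrDl -!mulrA mulrBl -En -En' -Ek -[LHS]mul1r -uv; ring.
by case: t t' e1 e2 {En En' Ek} => [x y] [x' y'] /= -> ->.
Qed.

Lemma card_on_line (N : nat) (a b kappa : int) : (0 < N)%N -> coprimez a b ->
  (#|[set t : 'I_N * 'I_N | on_line a b kappa t]%SET| <= N)%N.
Proof.
move=> N0 /coprimezP [[u v] /= uv].
have N0' : N%:Z != 0 by rewrite eqz_nat -lt0n.
pose s (t : 'I_N * 'I_N) : int := u * t.2%:Z - v * t.1%:Z.
have sN t : (`|(s t %% N%:Z)%Z| < N)%N.
  by rewrite -ltz_nat gez0_abs ?modz_ge0 // -[X in _ < X](@gez0_abs N%:Z) // ltz_mod.
pose f t := Ordinal (sN t).
rewrite -(@card_in_imset _ _ f); first by rewrite -[X in (_ <= X)%N]card_ord max_card.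
move=> t t'; rewrite !inE => lt lt' /(congr1 val) /= /(congr1 Posz).
by rewrite !gez0_abs ?modz_ge0 //; apply: inj_on_line lt lt'.
Qed.

Section UncertaintyLine.

Variables (N D m : nat) (zeta : algC).
Hypothesis zeta_prim : N.-primitive_root zeta.
Let T := ('I_N * 'I_N)%type.
Let zc := @zcoord algC N zeta.
Let wc := @wcoord algC N zeta.

Lemma size_factor_leq (p q : {poly {poly algC}}) : p * q != 0 ->
  [/\ (size p <= size (p * q)%R)%N & (sizeY p <= sizeY (p * q)%R)%N].
Proof.
rewrite mulf_eq0 negb_or => /andP[p0 q0].
have : (0 < sizeY q)%N by rewrite lt0n sizeY_eq0.
have : (0 < size q)%N by rewrite size_poly_gt0.
rewrite size_mul // sizeYM //; move: (size p) (size q) (sizeY p) (sizeY q) => a b c d.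
by move=> b0 d0; split; lia.
Qed.

Lemma exponent_det_leq (i j i' j' i'' j'' : nat) : (i <= m)%N -> (j <= m)%N ->
  (i' <= m)%N -> (j' <= m)%N -> (i'' <= m)%N -> (j'' <= m)%N ->
  (`|exponent_det i j i' j' i'' j''| <= 2 * m * m)%N.
Proof.
move=> h1 h2 h3 h4 h5 h6; rewrite /exponent_det -lez_nat abszE.
have B (x y z t : nat) : (x <= m)%N -> (y <= m)%N -> (z <= m)%N -> (t <= m)%N ->
    `|(x%:Z - y%:Z) * (z%:Z - t%:Z)| <= m%:Z * m%:Z.
  by move=> *; rewrite normrM ler_pM // ler_norml; apply/andP; split; lia.
apply: (le_trans (ler_normB _ _)); apply: (le_trans (lerD (B _ _ _ _ _ _ _ _) (B _ _ _ _ _ _ _ _))) => //.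
by rewrite !PoszM; lia.
Qed.

Variables (Y : {set T}) (h : T -> algC).
Hypotheses (h0 : exists t, h t != 0) (hY : forall t, h t != 0 -> t \in Y).
Hypotheses (Ym : (#|Y| < m.+1 * m.+1)%N) (kh : kills zc wc h D D).
Hypotheses (D_gt0 : (0 < D)%N) (mD : (8 * m <= D)%N).
Hypothesis primes_enough : forall E, (0 < E)%N -> (E <= 2 * m * m)%N ->
  exists l, [/\ prime l, coprime l N, ~~ (l %| E)%N & ((l + 2) * m <= D)%N].

(** An indecomposable curve carrying a nonzero multiple of [h] has collinear exponents: a
    nonzero determinant of exponents is at most [2 m ^ 2] in absolute value, hence prime to
    some admissible [l], against [prime_dvd_exponent_det].  The bounds on [a] and [b]
    compare the number of nonzero values given by [kills_on_line_card] with the number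
    [N] of points of a line. *)
Lemma uncertainty_line : exists (a b kappa : int) (q : {poly {poly algC}}),
  [/\ coprimez a b, (`|a| * D <= 2 * N)%N, (`|b| * D <= 2 * N)%N,
      (size q <= (2 * m).+1)%N & (sizeY q <= (2 * m).+1)%N] /\
  [/\ exists t, ev zc wc q t * h t != 0,
      forall t, ev zc wc q t * h t != 0 -> on_line a b kappa t
    & (D < 2 * #|nonzero_set (fun t : T => (ev zc wc q t * h t)%R)|)%N].
Proof.
have [g0 [g00 sg0 yg0 g0Y]] := vanishing_curve zc wc Ym.
have g0h t : ev zc wc g0 t * h t = 0.
  have [->|ht] := eqVneq (h t) 0; first by rewrite mulr0.
  by rewrite g0Y ?mul0r // hY.
have [q1 [g [r [Eg ig [t0 q1h] gq1h]]]] := indecomposable_factor g00 h0 g0h.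
have [q1m yq1m gm ygm] : [/\ (size q1 <= m.+1)%N, (sizeY q1 <= m.+1)%N,
    (size g <= m.+1)%N & (sizeY g <= m.+1)%N].
  have E : q1 * (g * r) != 0 by rewrite mulrA -Eg.
  have E' : g * (q1 * r) != 0 by rewrite mulrCA mulrA -Eg.
  have [s1 s2] := size_factor_leq E; have [s3 s4] := size_factor_leq E'.
  have e1 : q1 * (g * r) = g0 by rewrite mulrA Eg.
  have e2 : g * (q1 * r) = g0 by rewrite mulrCA mulrA Eg.
  rewrite e1 in s1 s2; rewrite e2 in s3 s4.
  by split; [exact: leq_trans s1 sg0|exact: leq_trans s2 yg0|exact: leq_trans s3 sg0|exact: leq_trans s4 yg0].
have g_neq0 : g != 0 by apply: contra g00 => /eqP E; rewrite Eg E mulr0 mul0r.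
pose h1 t := ev zc wc q1 t * h t.
have kh1 : kills zc wc h1 (D - m) (D - m) by apply: kills_mul.
have h10 : exists t, h1 t != 0 by exists t0.
have zcN t : zc t ^+ N = 1 by rewrite /zc /zcoord exprAC (prim_expr_order zeta_prim) expr1n.
have wcN t : wc t ^+ N = 1 by rewrite /wc /wcoord exprAC (prim_expr_order zeta_prim) expr1n.
have col i j i' j' i'' j'' : g`_j`_i != 0 -> g`_j'`_i' != 0 -> g`_j''`_i'' != 0 ->
    exponent_det i j i' j' i'' j'' = 0.
  have supp x y : g`_y`_x != 0 -> (x <= m)%N /\ (y < size g)%N.
    move=> gxy; split; last first.
      by rewrite ltnNge; apply: contra gxy => /(nth_default 0) ->; rewrite coef0.
    rewrite -ltnS; apply: leq_trans ygm; apply: leq_trans (max_size_coefXY g y).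
    by rewrite ltnNge; apply: contra gxy => /(nth_default 0) ->.
  move=> g1 g2 g3; have [i1 j1] := supp _ _ g1; have [i2 j2] := supp _ _ g2.
  have [i3 j3] := supp _ _ g3.
  have [small|sg] := leqP (size g) 1.
    have z y : (y < size g)%N -> y = 0%N by move/leq_trans/(_ small); case: y.
    by rewrite (z _ j1) (z _ j2) (z _ j3) /exponent_det !subrr !mulr0 subrr.
  have jm y : (y < size g)%N -> (y <= m)%N by move=> yg; rewrite -ltnS (leq_trans yg gm).
  apply/eqP; apply: contraT => dn0.
  have d0 : (0 < `|exponent_det i j i' j' i'' j''|)%N by rewrite absz_gt0.
  have [l [pl cl ld lm]] := primes_enough d0
     (exponent_det_leq i1 (jm _ j1) i2 (jm _ j2) i3 (jm _ j3)).
  have [om omp] := C_prim_root_exists (prime_gt0 pl).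
  have [sigma Hs] := Qn_aut_exists cl.
  have lmD : (l.+1 * m <= D - m)%N.
    move: lm; rewrite addn2 mulSn => lm.
    by rewrite leq_subRL ?(leq_trans (leq_addr _ _) lm).
  have := @prime_dvd_exponent_det _ _ zc wc (inj_zw zeta_prim) l sigma om (prime_gt1 pl) omp
    (fun t => Hs _ (zcN t)) (fun t => Hs _ (wcN t)) g h1 m (D - m) ig sg gm ygm lmD kh1 gq1h h10
    i j i' j' i'' j'' pl g1 g2 g3.
  by rewrite dvdzE absz_nat (negPf ld).
have [a [b [kappa [q2 [[cab am bm sq2 yq2] [[t1 q2h] hline]]]]]] :=
  collinear_exponents_line zeta_prim gm ygm h10 gq1h g_neq0 col.
pose h2 t := ev zc wc q2 t * h1 t.
have kh2 : kills zc wc h2 (D - 2 * m) (D - 2 * m).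
  have := kills_mul kh1 yq2 sq2; rewrite -!subnDA addnn -mul2n; exact.
have E t : ev zc wc (q2 * q1) t * h t = h2 t by rewrite evM /h2 /h1 mulrA.
have En : nonzero_set (fun t : T => ev zc wc (q2 * q1) t * h t) = nonzero_set h2.
  by apply/setP => t; rewrite !inE E.
have h20 : exists t, h2 t != 0 by exists t1.
have cardN : (#|nonzero_set h2| <= N)%N.
  apply: leq_trans (card_on_line kappa (prim_order_gt0 zeta_prim) cab).
  by apply: subset_leq_card; apply/fintype.subsetP => t; rewrite !inE; apply: hline.
have H1 : a != 0 -> (`|a| * (D - 4 * m) < #|nonzero_set h2|)%N.
  move=> a0; apply: leq_ltn_trans (kills_on_line_card zeta_prim cab a0 _ hline h20 kh2).
    by rewrite leq_mul2l; apply/orP; right; move: bm; lia.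
  by move: am mD; lia.
have H2 : b != 0 -> (`|b| * (D - 4 * m) < #|nonzero_set h2|)%N.
  move=> b0; apply: leq_ltn_trans (kills_on_line_card_swap zeta_prim cab b0 _ hline h20 kh2).
    by rewrite leq_mul2l; apply/orP; right; move: am; lia.
  by move: bm mD; lia.
have DN x c : (x * (D - 4 * m) < c)%N -> (c <= N)%N -> (x * D <= 2 * N)%N.
  by move: mD; nia.
exists a, b, kappa, (q2 * q1); split; split.
- exact: cab.
- by have [->|a0] := eqVneq a 0; [rewrite absz0 mul0n|exact: DN (H1 a0) cardN].
- by have [->|b0] := eqVneq b 0; [rewrite absz0 mul0n|exact: DN (H2 b0) cardN].
- rewrite (leq_trans (size_polyMleq _ _)) //.
  by move: q1m sq2; move: (size q1) (size q2) => x y; lia.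
- rewrite (leq_trans (sizeYM_leq _ _)) //.
  by move: yq1m yq2; move: (sizeY q1) (sizeY q2) => x y; lia.
- by exists t1; rewrite E.
- by move=> t; rewrite E; apply: hline.
rewrite En; have : (a != 0) || (b != 0).
  rewrite -negb_and; apply: contraL cab => /andP[/eqP-> /eqP->].
  by rewrite /coprimez gcd0z.
move/orP => [x0|x0]; [have := H1 x0|have := H2 x0]; rewrite -absz_gt0 in x0;
  by move: mD D_gt0 x0; nia.
Qed.

End UncertaintyLine.

(** * Digits *)

Section Digits.

Variables (M : nat) (hM : (2 <= M)%N).

(** The reindexing behind the Cooley-Tukey step: [a + m b] runs once through the integers
    below [m n]. *)
Lemma big_digits (R : Type) (idx : R) (op : Monoid.com_law idx) m n (F : nat -> R) :
  \big[op/idx]_(a < m * n) F a =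
  \big[op/idx]_(a < m) \big[op/idx]_(b < n) F (a + m * b)%N.
Proof.
elim: n => [|n IH].
  by rewrite muln0 big_ord0 big1 // => i _; rewrite big_ord0.
under [RHS]eq_bigr => a _ do rewrite big_ord_recr /=.
rewrite big_split -IH -!(big_mkord xpredT) mulnS addnC.
rewrite (@big_cat_nat _ _ _ (m * n)%N) ?leq_addr //=; congr (op _ _).
rewrite -{1}[(m * n)%N]add0n big_addn addKn !big_mkord.
by apply: eq_bigr => i _; rewrite addnC.
Qed.

Lemma big_digits2 (R : Type) (idx : R) (op : Monoid.com_law idx) m n (F : nat -> nat -> R) :
  \big[op/idx]_(x : 'I_(m * n) * 'I_(m * n)) F x.1 x.2 =
  \big[op/idx]_(y : 'I_m * 'I_m) \big[op/idx]_(z : 'I_n * 'I_n)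
     F (y.1 + m * z.1)%N (y.2 + m * z.2)%N.
Proof.
rewrite -(pair_bigA _ (fun a b : 'I_(m * n) => F a b)) /=.
rewrite (big_digits _ _ _ (fun a => \big[op/idx]_(b < m * n) F a b)).
have E x : \big[op/idx]_(b < m * n) F x b =
    \big[op/idx]_(b < m) \big[op/idx]_(c < n) F x (b + m * c)%N by exact: big_digits.
under [LHS]eq_bigr => a _ do under eq_bigr => a' _ do rewrite E.
under [LHS]eq_bigr => a _ do rewrite exchange_big.
rewrite pair_bigA; apply: eq_bigr => -[a b] _ /=.
by rewrite pair_bigA.
Qed.

Definition digit (j a : nat) : nat := (a %/ M ^ j %% M)%N.

Lemma M_gt0 : (0 < M)%N. Proof. exact: ltnW. Qed.

Lemma Mk_gt0 k : (0 < M ^ k)%N. Proof. by rewrite expn_gt0 M_gt0. Qed.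

Lemma digit_lt j a : (digit j a < M)%N.
Proof. by rewrite ltn_mod M_gt0. Qed.

Lemma digit_expansion k a : (a < M ^ k)%N -> a = (\sum_(j < k) digit j a * M ^ j)%N.
Proof.
suff H : a = (\sum_(j < k) digit j a * M ^ j + a %/ M ^ k * M ^ k)%N.
  by move=> ak; rewrite {1}H [(a %/ _)%N]divn_small // mul0n addn0.
elim: k => [|k IH]; first by rewrite big_ord0 expn0 divn1 muln1.
rewrite big_ord_recr /= -addnA {1}IH; congr (_ + _)%N.
rewrite /digit expnSr divnMA {1}(divn_eq (a %/ M ^ k) M) mulnDl addnC; congr (_ + _)%N.
by rewrite -mulnA [(M * _)%N]mulnC.
Qed.

Lemma digit_sum k (d : nat -> nat) i : (forall j, d j < M)%N -> (i < k)%N ->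
  digit i (\sum_(j < k) d j * M ^ j)%N = d i.
Proof.
elim: k d i => // k IH d i dM ik.
rewrite big_ord_recl expn0 muln1.
have -> : (\sum_(j < k) d (lift ord0 j) * M ^ lift ord0 j =
           M * \sum_(j < k) d j.+1 * M ^ j)%N.
  rewrite big_distrr /=; apply: eq_bigr => j _.
  by rewrite /bump leq0n add1n expnS mulnCA.
case: i ik => [|i] ik; rewrite /digit.
  by rewrite expn0 divn1 addnC mulnC modnMDl modn_small.
rewrite expnS divnMA addnC mulnC divnMDl ?M_gt0 // [(d _ %/ M)%N]divn_small // addn0.
exact: (IH (fun j => d j.+1)).
Qed.

Variable A : {set 'I_M * 'I_M}.

Definition in_alphabet (a b : nat) : bool :=
  [exists p in A, (nat_of_ord p.1 == a) && (nat_of_ord p.2 == b)].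

Lemma in_alphabetE (p : 'I_M * 'I_M) : in_alphabet p.1 p.2 = (p \in A).
Proof.
apply/existsP/idP => [[q /and3P[qA /eqP/val_inj e1 /eqP/val_inj e2]]|pA].
  by rewrite [p]surjective_pairing -e1 -e2 -surjective_pairing.
by exists p; rewrite pA !eqxx.
Qed.

(** The digits from the [k]-th on are ignored, so that the predicate on natural numbers
    is periodic modulo [M ^ k] in both variables. *)
Definition cantor (k a b : nat) : bool :=
  all (fun j => in_alphabet (digit j a) (digit j b)) (iota 0 k).

Lemma cantorP k a b :
  reflect (forall j, (j < k)%N -> in_alphabet (digit j a) (digit j b)) (cantor k a b).
Proof.
apply: (iffP allP) => H j; last by rewrite mem_iota => /andP[_]; apply: H.
by move=> jk; apply: H; rewrite mem_iota.
Qed.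

Lemma mem_cantor_iterate k (x : 'I_(M ^ k) * 'I_(M ^ k)) :
  (x \in cantor_iterate A k) = cantor k x.1 x.2.
Proof.
rewrite inE; apply/existsP/cantorP => [[d /and3P[/forallP dA /eqP e1 /eqP e2]] j jk|H].
  pose d' (f : 'I_M * 'I_M -> 'I_M) (j : nat) : nat :=
    if insub j is Some o then f (d o) else 0%N.
  have d'M f i : (d' f i < M)%N by rewrite /d'; case: insub => *; rewrite ?M_gt0.
  have E (f : 'I_M * 'I_M -> 'I_M) : (\sum_(j < k) f (d j) * M ^ j = \sum_(j < k) d' f j * M ^ j)%N.
    by apply: eq_bigr => i _; rewrite /d' valK.
  rewrite e1 e2 (E fst) (E snd) !digit_sum // /d' insubT /=.
  by rewrite in_alphabetE dA.
pose o a j : 'I_M := Ordinal (digit_lt j a).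
exists [ffun j : 'I_k => (o x.1 j, o x.2 j)]; apply/and3P; split.
- by apply/forallP => j; rewrite ffunE -in_alphabetE; apply: H.
- by apply/eqP; rewrite [LHS](digit_expansion (ltn_ord x.1)); apply: eq_bigr => j _; rewrite ffunE.
- by apply/eqP; rewrite [LHS](digit_expansion (ltn_ord x.2)); apply: eq_bigr => j _; rewrite ffunE.
Qed.

Lemma digit_add j i a : digit (j + i) a = digit i (a %/ M ^ j).
Proof. by rewrite /digit expnD divnMA. Qed.

Lemma digit_mod k j a : (j < k)%N -> digit j (a %% M ^ k) = digit j a.
Proof.
move=> jk; rewrite /digit {2}(divn_eq a (M ^ k)).
have -> : k = ((k - j.+1) + j.+1)%N by rewrite subnK.
rewrite expnD expnS; set u := (a %% _)%N.
rewrite !mulnA divnMDl ?Mk_gt0 // -?mulnA.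
have -> : (a %/ (M ^ (k - j.+1) * (M * M ^ j)) * (M ^ (k - j.+1) * M))%N =
          (a %/ (M ^ (k - j.+1) * (M * M ^ j)) * M ^ (k - j.+1) * M)%N by rewrite mulnA.
by rewrite modnMDl.
Qed.

Lemma cantor_mod k a b : cantor k (a %% M ^ k) (b %% M ^ k) = cantor k a b.
Proof.
by apply/cantorP/cantorP => H j jk; have := H j jk; rewrite !digit_mod.
Qed.

Lemma cantor_add j l a b :
  cantor (j + l) a b = cantor j a b && cantor l (a %/ M ^ j) (b %/ M ^ j).
Proof.
rewrite /cantor iotaD all_cat add0n; congr (_ && _).
rewrite -{1}[j]addn0 iotaDl all_map; apply: eq_all => i /=.
by rewrite !digit_add.
Qed.

Lemma cantor_addM j l (a b c d : nat) : (a < M ^ j)%N -> (b < M ^ j)%N ->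
  cantor (j + l) (a + M ^ j * c) (b + M ^ j * d) = cantor j a b && cantor l c d.
Proof.
move=> aj bj; rewrite cantor_add; congr (_ && _).
  by rewrite -cantor_mod ![(M ^ j * _)%N]mulnC ![(_ + _ * M ^ j)%N]addnC !modnMDl !modn_small.
by rewrite ![(M ^ j * _)%N]mulnC ![(_ + _ * M ^ j)%N]addnC !divnMDl ?Mk_gt0 //
  ![(_ %/ M ^ j)%N]divn_small // !addn0.
Qed.

Lemma cantor1 a b : (a < M)%N -> (b < M)%N -> cantor 1 a b = in_alphabet a b.
Proof. by move=> aM bM; rewrite /cantor /= andbT /digit expn0 !divn1 !modn_small. Qed.

Lemma card_cantor k : #|cantor_iterate A k| = (#|A| ^ k)%N.
Proof.
have E j : #|cantor_iterate A j| = \sum_(x : 'I_(M ^ j) * 'I_(M ^ j)) (cantor j x.1 x.2 : nat).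
  by rewrite -sum1_card big_mkcond; apply: eq_bigr => x _; rewrite mem_cantor_iterate; case: cantor.
rewrite E; elim: k => [|k IH].
  rewrite expn0 (big_pred1 (ord0, ord0)) // => -[a b].
  by rewrite [a]ord1 [b]ord1 /= eqxx.
have -> : (M ^ k.+1 = M ^ k * M)%N by rewrite expnSr.
rewrite (big_digits2 _ _ _ (fun a b => cantor k.+1 a b : nat)) expnSr -IH big_distrl /=.
apply: eq_bigr => y _.
have -> : #|A| = (\sum_(z : 'I_M * 'I_M) (in_alphabet z.1 z.2 : nat))%N.
  by rewrite -sum1_card big_mkcond; apply: eq_bigr => x _; rewrite in_alphabetE; case: (_ \in _).
rewrite big_distrr /=; apply: eq_bigr => z _.
by rewrite -addn1 cantor_addM // cantor1 // mulnb.
Qed.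

End Digits.

(** * Characters of Z/N *)

Section Orthogonality.

Variables (K : fieldType) (N : nat) (z : K).
Hypothesis z_prim : N.-primitive_root z.

Lemma orthogonality (a b : nat) :
  \sum_(j < N) z ^+ (a * j) * z ^- (b * j) = if a == b %[mod N] then N%:R else 0.
Proof.
have z0 := prim_root_neq0 z_prim.
rewrite -(eq_prim_root_expr z_prim); case: eqP => [ab|/eqP ab].
  under eq_bigr => j _ do rewrite !exprM ab divff ?expf_neq0 //.
  by rewrite sumr_const card_ord.
pose w := z ^+ a * z ^- b.
have w1 : w != 1.
  by apply: contra ab => /eqP E; rewrite -[X in _ == X]mul1r -E divfK // expf_neq0.
have wN : w ^+ N = 1.
  by rewrite /w exprMn exprVn exprAC [(z ^+ b) ^+ N]exprAC (prim_expr_order z_prim) !expr1n divr1.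
under eq_bigr => j _ do rewrite !exprM -exprVn -exprMn -/w.
have := subrX1 w N; rewrite wN subrr => /esym/eqP; rewrite mulf_eq0 subr_eq0 (negPf w1).
by move/eqP.
Qed.

Lemma orthogonality2 (a b c d : nat) :
  \sum_(t : 'I_N * 'I_N) z ^+ (a * t.1 + b * t.2) * z ^- (c * t.1 + d * t.2) =
  if (a == c %[mod N]) && (b == d %[mod N]) then N%:R ^+ 2 else 0.
Proof.
transitivity ((\sum_(j < N) z ^+ (a * j) * z ^- (c * j)) *
              (\sum_(j < N) z ^+ (b * j) * z ^- (d * j))).
  rewrite mulr_suml; under [RHS]eq_bigr => j _ do rewrite mulr_sumr.
  rewrite pair_bigA; apply: eq_bigr => -[j j'] _ /=.
  by rewrite !exprD invfM; ring.
by rewrite !orthogonality; case: eqP => _; case: eqP => _ //=; rewrite ?mul0r ?mulr0 ?expr2.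
Qed.

End Orthogonality.

Section ComplexModulus.

Variable R : realType.
Local Notation C := R[i].

Definition abs2 (z : C) : R := let: (a +i* b)%C := z in a ^+ 2 + b ^+ 2.

Lemma normc_sq (z : C) : ComplexField.Normc.normc z ^+ 2 = abs2 z.
Proof. by case: z => a b; rewrite /= sqr_sqrtr // addr_ge0 // sqr_ge0. Qed.

Lemma abs2M (z w : C) : abs2 (z * w) = abs2 z * abs2 w.
Proof.
case: z w => [a b] [c d].
have -> : (a +i* b)%C * (c +i* d)%C = ((a * c - b * d) +i* (a * d + b * c))%C by [].
by rewrite /abs2; ring.
Qed.

Lemma abs2_ge0 (z : C) : 0 <= abs2 z.
Proof. by case: z => a b; rewrite addr_ge0 // sqr_ge0. Qed.

Lemma abs20 : abs2 0 = 0.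
Proof. by rewrite /abs2 /= !expr0n addr0. Qed.

Lemma abs21 : abs2 1 = 1.
Proof. by rewrite /abs2 /= expr1n expr0n addr0. Qed.

Lemma abs2_eq0 (z : C) : (abs2 z == 0) = (z == 0).
Proof.
case: z => a b; rewrite /abs2 paddr_eq0 ?sqr_ge0 // !sqrf_eq0.
by rewrite [RHS]eq_complex.
Qed.

Lemma abs2_real (r : R) : abs2 (r%:C)%C = r ^+ 2.
Proof. by rewrite /abs2 /= expr0n addr0. Qed.

Lemma abs2_natr (n : nat) : abs2 n%:R = n%:R ^+ 2.
Proof. by rewrite -(rmorph_nat (real_complex R)) abs2_real. Qed.

Lemma abs2V (z : C) : abs2 z^-1 = (abs2 z)^-1.
Proof.
have [->|z0] := eqVneq z 0; first by rewrite invr0 abs20 invr0.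
have a0 : abs2 z != 0 by rewrite abs2_eq0.
by apply: (mulfI a0); rewrite -abs2M !divff // abs21.
Qed.

Lemma abs2E (z : C) : ((abs2 z)%:C)%C = z * (z^*)%C.
Proof. by case: z => a b; apply/eqP; rewrite eq_complex /=; apply/andP; split; apply/eqP; ring. Qed.

(** Lagrange's identity, in the form that measures the defect in the
    Cauchy-Schwarz inequality. *)
Lemma lagrange_identity (I : finType) (P : pred I) (u : I -> C) :
  abs2 (\sum_(i | P i) u i) +
    2^-1 * \sum_(i | P i) \sum_(j | P j) abs2 (u i - u j) =
  #|P|%:R * \sum_(i | P i) abs2 (u i).
Proof.
pose re (z : C) := complex.Re z; pose im (z : C) := complex.Im z.
have sumE : \sum_(i | P i) u i =
    ((\sum_(i | P i) re (u i)) +i* (\sum_(i | P i) im (u i)))%C.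
  by elim/big_rec3: _ => // i x y _ _ ->; case: (u i).
have aE z : abs2 z = re z ^+ 2 + im z ^+ 2 by case: z.
have real_id (f : I -> R) : (\sum_(i | P i) f i) ^+ 2 +
    2^-1 * \sum_(i | P i) \sum_(j | P j) (f i - f j) ^+ 2 =
    #|P|%:R * \sum_(i | P i) f i ^+ 2.
  have -> : \sum_(i | P i) \sum_(j | P j) (f i - f j) ^+ 2 =
     2 * (#|P|%:R * \sum_(i | P i) f i ^+ 2) - 2 * (\sum_(i | P i) f i) ^+ 2.
    transitivity (\sum_(i | P i) (#|P|%:R * f i ^+ 2 + \sum_(j | P j) f j ^+ 2
        - 2 * (f i * \sum_(j | P j) f j))).
      apply: eq_bigr => i _; rewrite mulr_natl -sumr_const !mulr_sumr -sumrN -!big_split.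
      by apply: eq_bigr => j _ /=; ring.
    rewrite !big_split /= sumrN -!mulr_sumr -mulr_suml sumr_const -mulr_natl; ring.
  by field.
rewrite sumE aE /=.
have -> : \sum_(i | P i) \sum_(j | P j) abs2 (u i - u j) =
    \sum_(i | P i) \sum_(j | P j) (re (u i) - re (u j)) ^+ 2 +
    \sum_(i | P i) \sum_(j | P j) (im (u i) - im (u j)) ^+ 2.
  rewrite -big_split; apply: eq_bigr => i _; rewrite -big_split; apply: eq_bigr => j _.
  by rewrite aE; case: (u i) (u j) => [a b] [c d].
have -> : \sum_(i | P i) abs2 (u i) =
    \sum_(i | P i) re (u i) ^+ 2 + \sum_(i | P i) im (u i) ^+ 2.
  by rewrite -big_split; apply: eq_bigr => i _; rewrite aE.
by rewrite mulrDr mulrDr -!real_id; ring.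
Qed.

Lemma abs2_sum_le (I : finType) (P : pred I) (u : I -> C) :
  abs2 (\sum_(i | P i) u i) <= #|P|%:R * \sum_(i | P i) abs2 (u i).
Proof.
rewrite -lagrange_identity lerDl mulr_ge0 ?invr_ge0 //.
by apply: sumr_ge0 => i _; apply: sumr_ge0 => j _; apply: abs2_ge0.
Qed.

Lemma expiD (s t : R) : expi (s + t) = expi s * expi t.
Proof. by apply/eqP; rewrite eq_complex /= cosD sinD [X in _ && (X == _)]addrC !eqxx. Qed.

Lemma expi0 : expi 0 = 1 :> C.
Proof. by rewrite /expi cos0 sin0. Qed.

Lemma expiX (s : R) n : expi (s * n%:R) = expi s ^+ n.
Proof.
elim: n => [|n IH]; first by rewrite mulr0 expi0 expr0.
by rewrite -addn1 natrD mulrDr mulr1 expiD IH exprD.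
Qed.

Lemma conjc_expi (s : R) : ((expi s)^*)%C = (expi s)^-1.
Proof.
have E : expi s * (expi s)^*%C = 1.
  by rewrite -abs2E /abs2 /expi cos2Dsin2.
have e0 : expi s != 0.
  by apply/eqP => e0; move/eqP: E; rewrite e0 mul0r eq_sym oner_eq0.
by apply: (mulfI e0); rewrite E divff.
Qed.

Lemma abs2_expi (s : R) : abs2 (expi s) = 1.
Proof. by rewrite /abs2 /expi cos2Dsin2. Qed.

Definition root_of_unity (N : nat) : C := expi (- (2 * pi / N%:R)).

Lemma root_of_unity_prim N : (0 < N)%N -> N.-primitive_root (root_of_unity N).
Proof.
move=> N0; have N0' : N%:R != 0 :> R by rewrite pnatr_eq0 -lt0n.
have wN : root_of_unity N ^+ N = 1.
  rewrite /root_of_unity -expiX mulNr divfK // /expi cosN sinN mulr_natl.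
  by rewrite cos2pi sin2pi oppr0.
have [d dp dN] := prim_order_exists N0 wN.
suff E : N = d by rewrite {1}E.
apply/eqP; apply: contraT => Nd; exfalso.
have d0 := prim_order_gt0 dp.
have dltN : (d < N)%N by rewrite ltn_neqAle eq_sym Nd dvdn_leq.
have := prim_expr_order dp; rewrite /root_of_unity -expiX mulNr.
pose th : R := pi * (d%:R / N%:R).
have -> : 2 * pi / N%:R * d%:R = th *+ 2 by rewrite /th -mulr_natl; ring.
move=> /(congr1 (@complex.Re R)) /=; rewrite cosN cos_mulr2n cos2sin2.
have : 0 < sin th.
  apply: sin_gt0_pi; rewrite /th mulr_gt0 ?pi_gt0 ?divr_gt0 ?ltr0n //=.
  by rewrite gtr_pMr ?pi_gt0 // ltr_pdivrMr ?ltr0n // mul1r ltr_nat.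
move=> s0 E; have s2 : 0 < sin th ^+ 2 by rewrite exprn_gt0.
by move: E s2; rewrite -mulr_natl; lra.
Qed.

End ComplexModulus.

(** * Fourier bounds and their submultiplicativity *)

Section FourierBounds.

Variable R : realType.
Local Notation C := R[i].
Local Notation rho N := (root_of_unity R N).

Definition trunc_fourier (N : nat) (P : nat -> nat -> bool) (f : nat -> nat -> C)
    (a b : nat) : C :=
  (N%:R)^-1 * \sum_(x : 'I_N * 'I_N | P x.1 x.2) f x.1 x.2 * rho N ^+ (x.1 * a + x.2 * b).

Definition energy (N : nat) (P : nat -> nat -> bool) (f : nat -> nat -> C) : R :=
  \sum_(x : 'I_N * 'I_N | P x.1 x.2) abs2 (f x.1 x.2).

Lemma energy_ge0 N P f : 0 <= energy N P f.
Proof. by apply: sumr_ge0 => x _; apply: abs2_ge0. Qed.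

Lemma abs2_rho N n : abs2 (rho N ^+ n) = 1.
Proof. by rewrite -expiX abs2_expi. Qed.

Lemma rho_neq0 N : rho N != 0.
Proof. by rewrite -abs2_eq0 -[rho N]expr1 abs2_rho oner_eq0. Qed.

Lemma conjc_rho N n : ((rho N ^+ n)^*)%C = rho N ^- n.
Proof. by rewrite -expiX conjc_expi. Qed.

Lemma parseval N P (f : nat -> nat -> C) : (0 < N)%N ->
  energy N (fun _ _ => true) (trunc_fourier N P f) = energy N P f.
Proof.
move=> N0; have N0' : N%:R != 0 :> R by rewrite pnatr_eq0 -lt0n.
pose g (x : 'I_N * 'I_N) : C := if P x.1 x.2 then f x.1 x.2 else 0.
pose e (x xi : 'I_N * 'I_N) : C := rho N ^+ (x.1 * xi.1 + x.2 * xi.2).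
have orth x y : \sum_xi e x xi * (e y xi)^*%C = if x == y then N%:R ^+ 2 else 0.
  under eq_bigr => xi _ do rewrite /e conjc_rho.
  by rewrite (orthogonality2 (root_of_unity_prim R N0)) !modn_small.
have step : \sum_xi abs2 (\sum_x g x * e x xi) = N%:R ^+ 2 * \sum_x abs2 (g x).
  apply: (@complexI R); rewrite rmorphM rmorphXn /= !(rmorph_sum, rmorph_nat).
  under eq_bigr => xi _.
    rewrite /= abs2E rmorph_sum mulr_suml.
    under eq_bigr => x _ do rewrite mulr_sumr.
    over.
  rewrite exchange_big mulr_sumr; apply: eq_bigr => x _ /=.
  rewrite exchange_big (bigD1 x) //= [X in _ + X]big1 ?addr0 => [|y yx].
    rewrite abs2E; transitivity (g x * (g x)^*%C * \sum_xi e x xi * (e x xi)^*%C).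
      by rewrite mulr_sumr; apply: eq_bigr => xi _; rewrite rmorphM; ring.
    by rewrite orth eqxx mulrC.
  transitivity (g x * (g y)^*%C * \sum_xi e x xi * (e y xi)^*%C).
    by rewrite mulr_sumr; apply: eq_bigr => xi _; rewrite rmorphM; ring.
  by rewrite orth eq_sym (negPf yx) mulr0.
have -> : energy N P f = \sum_x abs2 (g x).
  rewrite /energy big_mkcond; apply: eq_bigr => x _.
  by rewrite /g; case: ifP; rewrite ?abs20.
rewrite /energy -[RHS](mulKf (expf_neq0 2 N0')) -step mulr_sumr.
apply: eq_bigr => xi _; rewrite /trunc_fourier abs2M abs2V abs2_natr; congr (_ * abs2 _).
rewrite big_mkcond; apply: eq_bigr => x _.
by rewrite /g; case: ifP; rewrite ?mul0r.
Qed.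

Variables (M : nat) (hM : (2 <= M)%N) (A B : {set 'I_M * 'I_M}).

(** A bound on the square of the norm.  The functions are defined on natural numbers, so
    that different levels can be compared without transport between ordinal types. *)
Definition fourier_bound (k : nat) (c : R) : Prop := forall f,
  energy (M ^ k) (cantor B k) (trunc_fourier (M ^ k) (cantor A k) f)
    <= c * energy (M ^ k) (cantor A k) f.

Lemma fourier_bound1 k : fourier_bound k 1.
Proof.
move=> f; rewrite mul1r -(parseval _ f (Mk_gt0 hM k)) /energy [leRHS](bigID (fun x : 'I_(M ^ k) * 'I_(M ^ k) => cantor B k x.1 x.2)) /=.
by rewrite lerDl; apply: sumr_ge0 => x _; apply: abs2_ge0.
Qed.

Lemma rho_expn m n : (0 < m)%N -> rho (m * n) ^+ m = rho n.
Proof.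
move=> m0; rewrite /root_of_unity -expiX natrM; congr expi.
have m0' : m%:R != 0 :> R by rewrite pnatr_eq0 -lt0n.
rewrite invfM mulNr; congr (- _).
have -> : 2 * pi * (m%:R^-1 / n%:R) * m%:R = 2 * pi / n%:R * (m%:R^-1 * m%:R) :> R by ring.
by rewrite mulVf // mulr1.
Qed.

(** A Cooley-Tukey step: writing points as [x + M ^ l y] and frequencies as
    [a + M ^ j a'], the transform of level [j + l] is a transform of level [j] in [y],
    followed by the multiplication by a phase and a transform of level [l] in [x]. *)
Lemma fourier_bound_add j l c c' : 0 <= c' ->
  fourier_bound j c -> fourier_bound l c' -> fourier_bound (j + l) (c * c').
Proof.
move=> c'0 bj bl f.
set m := (M ^ l)%N; set n := (M ^ j)%N.
have EN : (M ^ (j + l) = m * n)%N by rewrite mulnC -expnD.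
have m0 : (0 < m)%N by apply: Mk_gt0.
have n0 : (0 < n)%N by apply: Mk_gt0.
pose fx (x' : nat * nat) (c d : nat) := f (x'.1 + m * c)%N (x'.2 + m * d)%N.
pose G (a b c d : nat) : C :=
  rho (m * n) ^+ (c * a + d * b) * trunc_fourier n (cantor A j) (fx (c, d)) a b.
have FE (a b a' b' : nat) :
  trunc_fourier (m * n) (cantor A (l + j)) f (a + n * a') (b + n * b') =
  trunc_fourier m (cantor A l) (G a b) a' b'.
  rewrite /trunc_fourier big_mkcond /=.
  rewrite (big_digits2 _ _ _ (fun c d => if cantor A (l + j) c d then
     f c d * rho (m * n) ^+ (c * (a + n * a') + d * (b + n * b')) else 0)) /=.
  rewrite [in RHS]big_mkcond !mulr_sumr; apply: eq_bigr => x _ /=.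
  under eq_bigr => y _ do rewrite (cantor_addM hM A _ _ _ (ltn_ord x.1) (ltn_ord x.2)).
  case: ifP => [Ax|_]; last by rewrite big1 ?mulr0.
  rewrite -big_mkcond /= /G /trunc_fourier natrM invfM -!mulrA; congr (_ * _).
  rewrite [RHS]mulrCA; congr (_ * _); rewrite mulr_suml mulr_sumr; apply: eq_bigr => y _ /=.
  rewrite /fx -(rho_expn n m0) -[rho m](rho_expn m n0) [(n * m)%N]mulnC -!exprM.
  have : rho (m * n) ^+ (m * n) = 1.
    by apply/prim_expr_order/root_of_unity_prim; rewrite muln_gt0 m0.
  move: (rho (m * n)) => z z1; rewrite -mulrA mulrCA; congr (_ * _).
  rewrite -!exprD.
  have -> : ((x.1 + m * y.1) * (a + n * a') + (x.2 + m * y.2) * (b + n * b') =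
     (m * n) * (y.1 * a' + y.2 * b') +
     (x.1 * a + x.2 * b + (m * (y.1 * a + y.2 * b) + n * (x.1 * a' + x.2 * b'))))%N by ring.
  by rewrite exprD exprM z1 expr1n mul1r.
have -> : energy (M ^ (j + l)) (cantor B (j + l)) (trunc_fourier (M ^ (j + l)) (cantor A (j + l)) f) =
  \sum_(y : 'I_n * 'I_n | cantor B j y.1 y.2) energy m (cantor B l) (trunc_fourier m (cantor A l) (G y.1 y.2)).
  rewrite /energy EN mulnC big_mkcond /=.
  rewrite (big_digits2 _ _ _ (fun c d => if cantor B (j + l) c d then
     abs2 (trunc_fourier (n * m) (cantor A (j + l)) f c d) else 0)) /=.
  rewrite [RHS]big_mkcond; apply: eq_bigr => y _.
  under eq_bigr => z _ do rewrite (cantor_addM hM B _ _ _ (ltn_ord y.1) (ltn_ord y.2)) mulnC addnC FE.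
  by case: ifP => _ /=; [rewrite -big_mkcond|rewrite big1].
apply: (@le_trans _ _ (\sum_(y : 'I_n * 'I_n | cantor B j y.1 y.2)
   c' * energy m (cantor A l) (G y.1 y.2))).
  by apply: ler_sum => y _; apply: bl.
have -> : \sum_(y : 'I_n * 'I_n | cantor B j y.1 y.2) c' * energy m (cantor A l) (G y.1 y.2) =
  c' * \sum_(x : 'I_m * 'I_m | cantor A l x.1 x.2)
     energy n (cantor B j) (trunc_fourier n (cantor A j) (fx (x.1 : nat, x.2 : nat))).
  rewrite -mulr_sumr; congr (_ * _); rewrite exchange_big; apply: eq_bigr => x _.
  by apply: eq_bigr => y _; rewrite /G abs2M abs2_rho mul1r.
apply: (@le_trans _ _ (c' * \sum_(x : 'I_m * 'I_m | cantor A l x.1 x.2)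
     c * energy n (cantor A j) (fx (x.1 : nat, x.2 : nat)))).
  by rewrite ler_wpM2l //; apply: ler_sum => x _; apply: bj.
rewrite -mulr_sumr mulrA [c' * c]mulrC le_eqVlt; apply/orP; left; apply/eqP; congr (_ * _).
rewrite /energy EN [RHS]big_mkcond /=.
rewrite (big_digits2 _ _ _ (fun c d => if cantor A (j + l) c d then abs2 (f c d) else 0)) /=.
rewrite big_mkcond; apply: eq_bigr => x _ /=.
under [RHS]eq_bigr => y _ do rewrite addnC (cantor_addM hM A _ _ _ (ltn_ord x.1) (ltn_ord x.2)).
by case: ifP => _ /=; [rewrite big_mkcond|rewrite big1].
Qed.

End FourierBounds.

(** * The operator norm *)

Section OperatorNorm.

Variable R : realType.
Local Notation C := R[i].
Local Notation rho N := (root_of_unity R N).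

Lemma ell2_norm_sq N (f : ell2 R N) : ell2_norm f ^+ 2 = \sum_x abs2 (f x).
Proof.
rewrite /ell2_norm sqr_sqrtr; last by apply: sumr_ge0 => x _; rewrite sqr_ge0.
by apply: eq_bigr => x _; rewrite normc_sq.
Qed.

Lemma ell2_norm_ge0 N (f : ell2 R N) : 0 <= ell2_norm f.
Proof. exact: sqrtr_ge0. Qed.

Definition sample N (f : nat -> nat -> C) : ell2 R N := [ffun x : 'I_N * 'I_N => f x.1 x.2].

Lemma sample_surj N (g : ell2 R N) : exists f, g = sample N f.
Proof.
exists (fun a b => if insub a is Some i then if insub b is Some j then g (i, j) else 0 else 0).
by apply/ffunP => -[i j]; rewrite ffunE /= !valK.
Qed.

Variables (M : nat) (hM : (2 <= M)%N) (A B : {set 'I_M * 'I_M}).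

Definition truncated_dft k (f : ell2 R (M ^ k)) : ell2 R (M ^ k) :=
  indic_mul (cantor_iterate B k) (dft (indic_mul (cantor_iterate A k) f)).

Lemma truncated_dft_norm k f :
  ell2_norm (truncated_dft (sample (M ^ k) f)) ^+ 2 =
  energy (M ^ k) (cantor B k) (trunc_fourier (M ^ k) (cantor A k) f).
Proof.
rewrite ell2_norm_sq /energy [RHS]big_mkcond; apply: eq_bigr => xi _.
rewrite !ffunE (mem_cantor_iterate hM); case: ifP => _; last by rewrite mul0r abs20.
rewrite mul1r; congr (abs2 (_ * _)); rewrite [RHS]big_mkcond; apply: eq_bigr => x _.
rewrite !ffunE (mem_cantor_iterate hM); case: ifP => _; last by rewrite !mul0r.
by rewrite mul1r expiX.
Qed.

Lemma energy_sample k f :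
  energy (M ^ k) (cantor A k) f <= ell2_norm (sample (M ^ k) f) ^+ 2.
Proof.
rewrite ell2_norm_sq /energy big_mkcond; apply: ler_sum => x _.
by rewrite ffunE; case: ifP => _; rewrite ?abs2_ge0.
Qed.

Lemma op_norm_le k c : 0 <= c -> fourier_bound A B k c ->
  op_norm (@truncated_dft k) <= Num.sqrt c.
Proof.
move=> c0 bk; apply: ge_sup.
  exists (ell2_norm (truncated_dft (sample (M ^ k) (fun _ _ => 0)))).
  exists (sample (M ^ k) (fun _ _ => 0)) => //=.
  rewrite -(@ler_pXn2r _ 2) ?nnegrE ?ell2_norm_ge0 // ell2_norm_sq expr1n big1 // => x _.
  by rewrite ffunE abs20.
move=> _ [g /= g1 <-]; have [f Eg] := sample_surj g.
rewrite -(@ler_pXn2r _ 2) ?nnegrE ?ell2_norm_ge0 ?sqrtr_ge0 // [leRHS]sqr_sqrtr // Eg truncated_dft_norm.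
apply: le_trans (bk f) _; rewrite -[leRHS]mulr1 ler_wpM2l //.
apply: le_trans (energy_sample _ _) _; rewrite -Eg.
by rewrite -(expr1n _ 2) ler_pXn2r ?nnegrE ?ell2_norm_ge0 ?ler01.
Qed.

Lemma op_norm_bound k : fourier_bound A B k (op_norm (@truncated_dft k) ^+ 2).
Proof.
move=> f; set E := energy _ (cantor A k) f.
have [E0|E0] := eqVneq E 0.
  by have := fourier_bound1 hM A B k f; rewrite -/E E0 !mulr0.
have Epos : 0 < E by rewrite lt_neqAle eq_sym E0 energy_ge0.
pose s : C := ((Num.sqrt E)^-1%:C)%C.
have s2 : abs2 s = E^-1 by rewrite abs2_real exprVn sqr_sqrtr // ltW.
pose f' a b := if cantor A k a b then s * f a b else 0.
have n1 : ell2_norm (sample (M ^ k) f') <= 1.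
  rewrite -(@ler_pXn2r _ 2) ?nnegrE ?ell2_norm_ge0 // ell2_norm_sq expr1n.
  have -> : \sum_x abs2 (sample (M ^ k) f' x) = E^-1 * E.
    rewrite /E /energy mulr_sumr big_mkcond [RHS]big_mkcond; apply: eq_bigr => x _.
    by rewrite ffunE /f'; case: ifP => _; rewrite ?abs20 // abs2M s2.
  by rewrite mulVf.
have ub : has_ubound [set ell2_norm (truncated_dft f) | f in [set f : ell2 R (M ^ k) | ell2_norm f <= 1]]%classic.
  exists 1 => _ [g /= g1 <-]; have [h Eg] := sample_surj g.
  rewrite -(@ler_pXn2r _ 2) ?nnegrE ?ell2_norm_ge0 // Eg truncated_dft_norm expr1n.
  apply: le_trans (fourier_bound1 hM A B k h) _; rewrite mul1r.
  apply: le_trans (energy_sample _ _) _; rewrite -Eg.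
  by rewrite -(expr1n _ 2) ler_pXn2r ?nnegrE ?ell2_norm_ge0 ?ler01.
have := ub_le_sup ub (ex_intro2 _ _ (sample (M ^ k) f') n1 erefl).
rewrite -/(op_norm _) => le1.
have : ell2_norm (truncated_dft (sample (M ^ k) f')) ^+ 2 <= op_norm (@truncated_dft k) ^+ 2.
  by rewrite ler_pXn2r // nnegrE ?ell2_norm_ge0 // (le_trans _ le1) ?ell2_norm_ge0.
rewrite truncated_dft_norm.
have -> : energy (M ^ k) (cantor B k) (trunc_fourier (M ^ k) (cantor A k) f') =
   E^-1 * energy (M ^ k) (cantor B k) (trunc_fourier (M ^ k) (cantor A k) f).
  rewrite /energy mulr_sumr; apply: eq_bigr => xi _; rewrite -s2 -abs2M; congr abs2.
  rewrite /trunc_fourier mulrCA; congr (_ * _); rewrite mulr_sumr; apply: eq_bigr => x Ax.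
  by rewrite /f' Ax mulrA.
by rewrite mulrC ler_pdivrMr.
Qed.

Lemma fourier_bound_monotone k (c c' : R) : c <= c' -> fourier_bound A B k c -> fourier_bound A B k c'.
Proof. by move=> cc' bk f; apply: le_trans (bk f) _; rewrite ler_wpM2r ?energy_ge0. Qed.

Lemma fourier_bound_mul k q (c : R) : 0 <= c -> fourier_bound A B k c ->
  fourier_bound A B (k * q) (c ^+ q).
Proof.
move=> c0 bk; elim: q => [|q IH]; first by rewrite muln0; apply: fourier_bound1.
by rewrite mulnS exprS; apply: fourier_bound_add => //; rewrite exprn_ge0.
Qed.

(** A gain over the trivial exponent at a single scale propagates to all scales,
    because the norms are submultiplicative in [k]. *)
Lemma uncertainty_of_gap k0 c (beta0 : R) : (0 < k0)%N -> 0 <= c -> 0 <= beta0 ->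
  c < M%:R `^ (- (2 * k0%:R * beta0)) -> fourier_bound A B k0 c ->
  exists beta D : R, [/\ beta0 < beta, 0 < D & forall k : nat, (1 <= k)%N ->
    op_norm (@truncated_dft k) <= D * M%:R `^ (- (k%:R * beta))].
Proof.
move=> k00 c0 beta00 clt bk.
have M1 : 1 < M%:R :> R by rewrite ltr1n.
have M0 : 0 < M%:R :> R by rewrite ltr0n ltnW.
have lnM : 0 < ln M%:R :> R by rewrite ln_gt0.
have k0R : 0 < k0%:R :> R by rewrite ltr0n.
set t := M%:R `^ _ in clt.
pose c' := (c + t) / 2.
have [cc' c't] : c < c' /\ c' < t by rewrite /c'; split; lra.
have c'0 : 0 < c' by apply: le_lt_trans cc'.
pose beta := - ln c' / (2 * k0%:R * ln M%:R).
have den0 : 0 < 2 * k0%:R * ln M%:R :> R by rewrite !mulr_gt0.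
have c'E : c' = M%:R `^ (- (2 * k0%:R * beta)).
  rewrite /powR gt_eqF // -{1}(lnK c'0); congr expR; rewrite /beta.
  by field; rewrite !gt_eqF.
have bb : beta0 < beta.
  rewrite /beta ltr_pdivlMr //.
  have := c't; rewrite -ltr_ln ?posrE ?powR_gt0 // /t ln_powR.
  by move=> H; rewrite ltrNr (lt_le_trans H) // le_eqVlt; apply/orP; left; apply/eqP; ring.
have beta_gt0 : 0 < beta by apply: le_lt_trans bb.
exists beta, (M%:R `^ (k0%:R * beta)); split=> //; first by rewrite powR_gt0.
move=> k _; rewrite -powRD; last by apply/implyP => _; rewrite gt_eqF.
have Ek : k = (k0 * (k %/ k0) + k %% k0)%N by rewrite mulnC -divn_eq.
have bk' : fourier_bound A B k (c' ^+ (k %/ k0)).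
  rewrite {1}Ek -[c' ^+ _]mulr1; apply: fourier_bound_add => //; last exact: fourier_bound1.
  by apply: fourier_bound_mul; rewrite ?ltW //; apply: fourier_bound_monotone bk; rewrite ltW.
apply: le_trans (op_norm_le _ bk') _; first by rewrite exprn_ge0 // ltW.
have -> : Num.sqrt (c' ^+ (k %/ k0)) = M%:R `^ (- (k0%:R * (k %/ k0)%:R * beta)).
  have -> : c' ^+ (k %/ k0) = (M%:R `^ (- (k0%:R * (k %/ k0)%:R * beta))) ^+ 2.
    rewrite c'E -!powR_mulrn ?powR_ge0 // -!powRrM; congr (_ `^ _).
    by move: (k %/ k0)%:R => q; ring.
  by rewrite sqrtr_sqr ger0_norm ?powR_ge0.
apply: ler_powR; first exact: ltW.
rewrite {2}Ek natrD natrM.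
have : (k %% k0)%:R <= k0%:R :> R by rewrite ler_nat ltnW // ltn_pmod.
move: beta_gt0; move: (k %/ k0)%:R (k %% k0)%:R => q r b0 rk; nra.
Qed.

(** If the phases factorise over [P x Q] then the corresponding submatrix of the
    Fourier matrix has rank one, with all entries of the same modulus, and its norm
    is explicit. *)
Lemma rank_one_bound k (c : R) (P Q : {set 'I_(M ^ k) * 'I_(M ^ k)}) :
  0 <= c -> fourier_bound A B k c ->
  {subset P <= cantor_iterate A k} -> {subset Q <= cantor_iterate B k} ->
  (forall x x' xi xi', x \in P -> x' \in P -> xi \in Q -> xi' \in Q ->
     (x.1 * xi.1 + x.2 * xi.2 + (x'.1 * xi'.1 + x'.2 * xi'.2) =
      x.1 * xi'.1 + x.2 * xi'.2 + (x'.1 * xi.1 + x'.2 * xi.2) %[mod M ^ k])%N) ->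
  #|P|%:R * #|Q|%:R <= c * (M ^ k)%:R ^+ 2.
Proof.
move=> c0 bk PA QB PQ; set N := (M ^ k)%N.
have N0 : (0 < N)%N by apply: Mk_gt0.
have NR : 0 < N%:R :> R by rewrite ltr0n.
have rp := root_of_unity_prim R N0.
have rhs0 : 0 <= c * N%:R ^+ 2 by rewrite mulr_ge0 // exprn_ge0 // ltW.
have [->|[x0 x0P]] := set_0Vmem P; first by rewrite cards0 mul0r.
have [->|[xi0 xi0Q]] := set_0Vmem Q; first by rewrite cards0 mulr0.
have P0 : 0 < #|P|%:R :> R by rewrite ltr0n card_gt0; apply/set0Pn; exists x0.
pose e (x xi : 'I_N * 'I_N) : C := rho N ^+ (x.1 * xi.1 + x.2 * xi.2).
(* the conjugates of the phases at one frequency: extremal for a matrix of rank one *)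
have [f Ef] := sample_surj ([ffun x => if x \in P then (e x xi0)^-1 else 0] : ell2 R N).
have fE (x : 'I_N * 'I_N) : f x.1 x.2 = if x \in P then (e x xi0)^-1 else 0.
  by have := congr1 (fun F : ell2 R N => F x) Ef; rewrite !ffunE.
have abs_e x xi : abs2 (e x xi) = 1 by rewrite abs2_rho.
have e0 x xi : e x xi != 0 by rewrite expf_neq0 ?rho_neq0.
have en : energy N (cantor A k) f = #|P|%:R.
  rewrite /energy -sum1_card natr_sum big_mkcond [RHS]big_mkcond; apply: eq_bigr => x _.
  rewrite fE -(mem_cantor_iterate hM); case: (boolP (x \in P)) => [xP|_].
    by rewrite (PA _ xP) abs2V abs_e invr1.
  by case: ifP; rewrite ?abs20.
have val xi : xi \in Q -> abs2 (trunc_fourier N (cantor A k) f xi.1 xi.2) = #|P|%:R ^+ 2 / N%:R ^+ 2.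
  move=> xiQ; rewrite /trunc_fourier abs2M abs2V abs2_natr mulrC; congr (_ / _).
  have -> : \sum_(x : 'I_N * 'I_N | cantor A k x.1 x.2) f x.1 x.2 * rho N ^+ (x.1 * xi.1 + x.2 * xi.2) =
     #|P|%:R * ((e x0 xi0)^-1 * e x0 xi).
    rewrite mulr_natl -sumr_const big_mkcond [RHS]big_mkcond; apply: eq_bigr => x _.
    rewrite fE -(mem_cantor_iterate hM); case: (boolP (x \in P)) => [xP|_]; last first.
      by case: ifP; rewrite ?mul0r.
    rewrite (PA _ xP) -/(e x xi).
    have E : e x xi * e x0 xi0 = e x xi0 * e x0 xi.
      by rewrite /e -!exprD; apply/eqP; rewrite (eq_prim_root_expr rp); apply/eqP/PQ.
    apply: (mulfI (e0 x xi0)); rewrite mulVKf //; apply: (mulIf (e0 x0 xi0)).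
    by rewrite E -!mulrA; congr (_ * _); rewrite [in RHS]mulrC mulfK.
  by rewrite !abs2M abs2V !abs_e abs2_natr invr1 !mulr1.
have := bk f; rewrite en => le1.
have : \sum_(xi in Q) abs2 (trunc_fourier N (cantor A k) f xi.1 xi.2) <= c * #|P|%:R.
  apply: le_trans le1; rewrite /energy big_mkcond [leRHS]big_mkcond; apply: ler_sum => xi _.
  rewrite -(mem_cantor_iterate hM); case: ifP => [/QB -> //|_].
  by case: ifP; rewrite ?abs2_ge0.
rewrite (eq_bigr _ val) sumr_const -[_ *+ #|Q|]mulr_natr => H.
have : #|P|%:R ^+ 2 * #|Q|%:R <= c * #|P|%:R * N%:R ^+ 2.
  rewrite -ler_pdivrMr ?exprn_gt0 //; apply: le_trans H.
  by rewrite mulrAC.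
move=> H2; rewrite -(ler_pM2l P0).
have -> : #|P|%:R * (#|P|%:R * #|Q|%:R) = #|P|%:R ^+ 2 * #|Q|%:R :> R by ring.
by have -> : #|P|%:R * (c * N%:R ^+ 2) = c * #|P|%:R * N%:R ^+ 2 :> R by ring.
Qed.

End OperatorNorm.

(** * Strict improvements of the trivial bounds *)

Lemma sum_enum_rank (V : nmodType) (K : finType) (G : K -> V) :
  \sum_k G k = \sum_(k < #|K|) G (enum_val k).
Proof.
rewrite (reindex (fun k : 'I_#|K| => enum_val k)) //=.
by exists enum_rank => x _; rewrite ?enum_valK ?enum_rankK.
Qed.

Section Gaps.

Variable R : realType.
Local Notation C := R[i].
Local Notation rho N := (root_of_unity R N).

(** A left inverse of the matrix provides the constant. *)
Lemma injective_bounded_below (I J : finType) (w : I -> J -> C) :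
  (forall u : I -> C, (forall j, \sum_i u i * w i j = 0) -> forall i, u i = 0) ->
  exists2 eps : R, 0 < eps & forall u : I -> C,
    eps * \sum_i abs2 (u i) <= \sum_j abs2 (\sum_i u i * w i j).
Proof.
move=> inj_w.
pose W : 'M[C]_(#|I|, #|J|) := \matrix_(i, j) w (enum_val i) (enum_val j).
have /row_freeP [V WV] : row_free W.
  rewrite -kermx_eq0; apply/negPn/negP => /rowV0Pn [v /sub_kermxP vW /negP[]].
  apply/eqP/rowP => i; rewrite mxE -(enum_valK i).
  apply: (inj_w (fun i => v 0 (enum_rank i))) => j.
  rewrite sum_enum_rank; have /rowP /(_ (enum_rank j)) := vW; rewrite !mxE => E; rewrite -[RHS]E.
  by apply: eq_bigr => k _; rewrite enum_valK mxE enum_rankK.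
pose b : R := \sum_i \sum_j abs2 (V j i).
have b0 : 0 <= b by apply: sumr_ge0 => i _; apply: sumr_ge0 => j _; apply: abs2_ge0.
have uE (u : I -> C) i : u i = \sum_j (\sum_i' u i' * w i' j) * V (enum_rank j) (enum_rank i).
  transitivity (\sum_i' u i' * (W *m V) (enum_rank i') (enum_rank i)).
    rewrite WV (bigD1 i) //= big1 ?addr0 ?mxE ?eqxx ?mulr1 // => k ki.
    by rewrite mxE (inj_eq enum_rank_inj) (negPf ki) mulr0.
  under [RHS]eq_bigr => j _ do rewrite mulr_suml.
  rewrite exchange_big; apply: eq_bigr => i' _ /=.
  rewrite mxE mulr_sumr [RHS]sum_enum_rank; apply: eq_bigr => j _.
  by rewrite mxE enum_rankK enum_valK mulrA.
pose D : R := #|I|%:R * (#|J|%:R * b) + 1.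
have D0 : 0 < D by rewrite ltr_wpDl // mulr_ge0 ?mulr_ge0 ?ler0n.
exists D^-1; first by rewrite invr_gt0.
move=> u; set S := \sum_j abs2 (\sum_i _).
have S0 : 0 <= S by apply: sumr_ge0 => j _; apply: abs2_ge0.
rewrite mulrC ler_pdivrMr // mulrC.
apply: (@le_trans _ _ (\sum_(i : I) #|J|%:R * b * S)).
  apply: ler_sum => i _; rewrite {1}uE.
  apply: le_trans (abs2_sum_le _ _) _; rewrite -mulrA ler_wpM2l ?ler0n //.
  rewrite mulr_sumr; apply: ler_sum => j _; rewrite abs2M mulrC.
  apply: ler_wpM2r; first exact: abs2_ge0.
  rewrite /b (bigD1 (enum_rank i)) //= (bigD1 (enum_rank j)) //=.
  apply: ler_wpDr; first by apply: sumr_ge0 => *; apply: sumr_ge0 => *; apply: abs2_ge0.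
  by apply: ler_wpDr => //; apply: sumr_ge0 => *; apply: abs2_ge0.
by rewrite sumr_const -[_ *+ #|_|]mulr_natl /D mulrDl mul1r -!mulrA lerDl.
Qed.

Variables (M : nat) (hM : (2 <= M)%N) (A B : {set 'I_M * 'I_M}) (k : nat).
Local Notation N := (M ^ k)%N.
Local Notation T := ('I_N * 'I_N)%type.

Let N0 : (0 < N)%N. Proof. exact: Mk_gt0. Qed.
Let NR : 0 < N%:R :> R. Proof. by rewrite ltr0n. Qed.
Let e (x xi : T) : C := rho N ^+ (x.1 * xi.1 + x.2 * xi.2).

(** By Parseval's identity the defect in the bound [1] is the energy of the transform off
    the iterate of [B]; when it never vanishes it is bounded below by
    [injective_bounded_below]. *)
Lemma gap_of_no_extremizer :
  (forall f : T -> C, (forall xi : T, ~~ cantor B k xi.1 xi.2 ->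
      \sum_(x : T | cantor A k x.1 x.2) f x * e x xi = 0) ->
      forall x : T, cantor A k x.1 x.2 -> f x = 0) ->
  exists c : R, [/\ 0 <= c, c < 1 & fourier_bound A B k c].
Proof.
move=> Hf.
(* the equations indexed by [inr] confine the unknowns to the iterate of [A] *)
pose w (x : T) (j : T + T) : C := match j with
  | inl xi => if cantor A k x.1 x.2 && ~~ cantor B k xi.1 xi.2 then e x xi else 0
  | inr y => if ~~ cantor A k x.1 x.2 && (x == y) then 1 else 0 end.
have winl (u : T -> C) xi : \sum_x u x * w x (inl xi) = if cantor B k xi.1 xi.2 then 0
    else \sum_(x : T | cantor A k x.1 x.2) u x * e x xi.
  rewrite /w; case: ifP => Bxi.
    by rewrite big1 // => x _; rewrite andbF mulr0.
  rewrite [RHS]big_mkcond; apply: eq_bigr => x _; rewrite andbT.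
  by case: ifP; rewrite ?mulr0.
have winr (u : T -> C) y : \sum_x u x * w x (inr y) = if cantor A k y.1 y.2 then 0 else u y.
  rewrite (bigD1 y) //= big1 ?addr0 => [|x xy]; last by rewrite (negPf xy) andbF mulr0.
  by rewrite eqxx andbT; case: (cantor A k y.1 y.2); rewrite ?mulr0 ?mulr1.
have [u uw x|eps eps0 He] := @injective_bounded_below T (T + T)%type w.
  have [Ax|Ax] := boolP (cantor A k x.1 x.2); last first.
    by have := uw (inr x); rewrite winr (negPf Ax).
  by apply: Hf Ax => xi Bxi; have := uw (inl xi); rewrite winl (negPf Bxi).
pose c : R := Num.max 0 (1 - eps / N%:R ^+ 2).
have epsN : 0 < eps / N%:R ^+ 2 by rewrite divr_gt0 // exprn_gt0.
exists c; split; first by rewrite le_max lexx.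
  by rewrite gt_max ltr01 /= ltrBlDr ltrDl.
move=> f; set E := energy _ (cantor A k) f.
have E0 : 0 <= E by apply: energy_ge0.
have par := parseval (cantor A k) f N0; rewrite -/E in par.
have {}He := He (fun x => if cantor A k x.1 x.2 then f x.1 x.2 else 0).
have : eps * E <= N%:R ^+ 2 * \sum_(xi : T | ~~ cantor B k xi.1 xi.2)
     abs2 (trunc_fourier N (cantor A k) f xi.1 xi.2).
  apply: le_trans (le_trans _ He) _.
    rewrite ler_pM2l // /E /energy big_mkcond; apply: ler_sum => x _.
    by case: ifP; rewrite ?abs2_ge0.
  rewrite big_sumType /= [X in _ + X]big1 ?addr0 => [|y _]; last first.
    by rewrite winr; case: (cantor A k y.1 y.2); rewrite abs20.
  rewrite mulr_sumr [leRHS]big_mkcond; apply: ler_sum => xi _; rewrite winl.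
  case: (cantor B k xi.1 xi.2); first by rewrite abs20.
  rewrite /trunc_fourier abs2M abs2V abs2_natr mulVKf ?expf_neq0 ?gt_eqF //.
  rewrite le_eqVlt; apply/orP; left; apply/eqP; congr abs2; apply: eq_bigr => x Ax.
  by rewrite Ax.
have : energy N (cantor B k) (trunc_fourier N (cantor A k) f) +
   \sum_(xi : T | ~~ cantor B k xi.1 xi.2) abs2 (trunc_fourier N (cantor A k) f xi.1 xi.2) = E.
  by rewrite -par /energy [RHS](bigID (fun x : T => cantor B k x.1 x.2)).
set F1 := energy _ _ _; set F2 := \sum_(_ | _) _ => F12 epsE.
apply: (@le_trans _ _ ((1 - eps / N%:R ^+ 2) * E)); last first.
  by rewrite ler_wpM2r // le_max lexx orbT.
have : eps / N%:R ^+ 2 * E <= F2.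
  by rewrite mulrAC ler_pdivrMr ?exprn_gt0 // [leRHS]mulrC.
rewrite -F12; lra.
Qed.

(** The Hilbert-Schmidt bound comes from the Cauchy-Schwarz inequality at each frequency,
    whose defect is given by [lagrange_identity].  If the defect vanished at both [xi0] and
    [xi1] for the same nonzero [f], then the two frequencies would give the same ratio
    between the phases at [x0] and [y0]. *)
Lemma gap_of_independent_phases (x0 y0 xi0 xi1 : T) :
  x0 \in cantor_iterate A k -> y0 \in cantor_iterate A k ->
  xi0 \in cantor_iterate B k -> xi1 \in cantor_iterate B k ->
  e x0 xi0 * e y0 xi1 != e x0 xi1 * e y0 xi0 ->
  exists c : R, [/\ 0 <= c, c < #|cantor_iterate A k|%:R * #|cantor_iterate B k|%:R / N%:R ^+ 2
    & fourier_bound A B k c].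
Proof.
rewrite !(mem_cantor_iterate hM) => Ax0 Ay0 Bxi0 Bxi1 ne.
set nA := #|_|; set nB := #|_|.
have e0 x xi : e x xi != 0 by rewrite expf_neq0 ?rho_neq0.
have abs_e x xi : abs2 (e x xi) = 1 by rewrite abs2_rho.
pose valid (xi x y : T) := [&& cantor B k xi.1 xi.2, cantor A k x.1 x.2 & cantor A k y.1 y.2].
pose w (z : T) (j : T * (T * T) + T) : C := match j with
  | inl (xi, (x, y)) => if valid xi x y then (z == x)%:R * e x xi - (z == y)%:R * e y xi else 0
  | inr y => if ~~ cantor A k z.1 z.2 && (z == y) then 1 else 0 end.
have sumd (u : T -> C) y (a : C) : \sum_z u z * ((z == y)%:R * a) = u y * a.
  rewrite (bigD1 y) //= big1 ?addr0 => [|x xy]; last by rewrite (negPf xy) mul0r mulr0.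
  by rewrite eqxx mul1r.
have winl (u : T -> C) xi x y : \sum_z u z * w z (inl (xi, (x, y))) =
    if valid xi x y then u x * e x xi - u y * e y xi else 0.
  rewrite /w; case: ifP => _; last by rewrite big1 // => z _; rewrite mulr0.
  under eq_bigr => z _ do rewrite mulrBr.
  by rewrite sumrB !sumd.
have winr (u : T -> C) y : \sum_x u x * w x (inr y) = if cantor A k y.1 y.2 then 0 else u y.
  rewrite (bigD1 y) //= big1 ?addr0 => [|x xy]; last by rewrite (negPf xy) andbF mulr0.
  by rewrite eqxx andbT; case: (cantor A k y.1 y.2); rewrite ?mulr0 ?mulr1.
have [u uw z|eps eps0 He] := @injective_bounded_below T (T * (T * T) + T)%type w.
  have [Az|Az] := boolP (cantor A k z.1 z.2); last first.
    by have := uw (inr z); rewrite winr (negPf Az).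
  have rel xi x y : valid xi x y -> u x * e x xi = u y * e y xi.
    by move=> v; have := uw (inl (xi, (x, y))); rewrite winl v => /eqP; rewrite subr_eq0 => /eqP.
  have V (xi x y : T) : cantor B k xi.1 xi.2 -> cantor A k x.1 x.2 -> cantor A k y.1 y.2 ->
    valid xi x y by move=> ? ? ?; apply/and3P.
  have ux0 : u x0 = 0.
    apply/eqP; apply: contraT => ux0; exfalso; move/eqP: ne; apply.
    have r0 := rel _ _ _ (V _ _ _ Bxi0 Ax0 Ay0); have r1 := rel _ _ _ (V _ _ _ Bxi1 Ax0 Ay0).
    apply: (mulfI ux0); rewrite !mulrA r0 r1; ring.
  have := rel _ _ _ (V _ _ _ Bxi0 Az Ax0); rewrite ux0 mul0r => /eqP.
  by rewrite mulf_eq0 (negPf (e0 _ _)) orbF => /eqP.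
have N20 : 0 < N%:R ^+ 2 :> R by rewrite exprn_gt0.
pose c : R := Num.max 0 (nA%:R * nB%:R / N%:R ^+ 2 - eps / 2 / N%:R ^+ 2).
have nA0 : (0 < nA)%N by rewrite card_gt0; apply/set0Pn; exists x0; rewrite (mem_cantor_iterate hM).
have nB0 : (0 < nB)%N by rewrite card_gt0; apply/set0Pn; exists xi0; rewrite (mem_cantor_iterate hM).
exists c; split; first by rewrite le_max lexx.
  rewrite gt_max divr_gt0 ?mulr_gt0 ?ltr0n //= ltrBlDr ltrDl !divr_gt0 //.
move=> f; set E := energy _ (cantor A k) f.
have E0 : 0 <= E by apply: energy_ge0.
pose g (x : T) : C := if cantor A k x.1 x.2 then f x.1 x.2 else 0.
have {}He := He g.
pose dfc (xi : T) := \sum_(x : T | cantor A k x.1 x.2) \sum_(y : T | cantor A k y.1 y.2)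
   abs2 (f x.1 x.2 * e x xi - f y.1 y.2 * e y xi).
have : eps * E <= \sum_(xi : T | cantor B k xi.1 xi.2) dfc xi.
  apply: le_trans (le_trans _ He) _.
    rewrite ler_pM2l // /E /energy big_mkcond; apply: ler_sum => x _.
    by rewrite /g; case: ifP; rewrite ?abs2_ge0.
  rewrite big_sumType /= [X in _ + X]big1 ?addr0 => [|y _]; last first.
    by rewrite winr /g; case: (cantor A k y.1 y.2); rewrite abs20.
  pose F (xi x y : T) := abs2 (\sum_i g i * w i (inl (xi, (x, y)))).
  rewrite (eq_bigr (fun p : T * (T * T) => F p.1 p.2.1 p.2.2)); last by move=> [xi [x y]].
  rewrite -(pair_bigA _ (fun (xi : T) (q : T * T) => F xi q.1 q.2)) /=.
  rewrite [leRHS]big_mkcond; apply: ler_sum => xi _.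
  rewrite -(pair_bigA _ (F xi)) /= /F.
  rewrite le_eqVlt; apply/orP; left; apply/eqP.
  case: (boolP (cantor B k xi.1 xi.2)) => Bxi; last first.
    by rewrite big1 // => x _; rewrite big1 // => y _; rewrite winl /valid (negPf Bxi) abs20.
  rewrite /dfc [RHS]big_mkcond; apply: eq_bigr => x _.
  case: (boolP (cantor A k x.1 x.2)) => Ax; last first.
    by rewrite big1 // => y _; rewrite winl /valid (negPf Ax) andbF abs20.
  rewrite [RHS]big_mkcond; apply: eq_bigr => y _; rewrite winl /valid Bxi Ax /=.
  by case: (boolP (cantor A k y.1 y.2)) => Ay; rewrite ?abs20 // /g Ax Ay.
move=> epsE.
have cardE (D : {set 'I_M * 'I_M}) : #|cantor_iterate D k| = #|[pred x : T | cantor D k x.1 x.2]|.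
  by apply: eq_card => x; rewrite (mem_cantor_iterate hM).
have main : N%:R ^+ 2 * energy N (cantor B k) (trunc_fourier N (cantor A k) f) =
    nA%:R * nB%:R * E - 2^-1 * \sum_(xi : T | cantor B k xi.1 xi.2) dfc xi.
  rewrite /energy mulr_sumr.
  have -> : nA%:R * nB%:R * E = \sum_(xi : T | cantor B k xi.1 xi.2) nA%:R * E.
    by rewrite sumr_const -[RHS]mulr_natr /nB (cardE B) mulrAC.
  rewrite [2^-1 * _]mulr_sumr -sumrB; apply: eq_bigr => xi _.
  rewrite /trunc_fourier abs2M abs2V abs2_natr mulVKf ?gt_eqF //.
  have := lagrange_identity (fun x : T => cantor A k x.1 x.2) (fun x : T => f x.1 x.2 * e x xi).
  have -> : \sum_(i : T | cantor A k i.1 i.2) abs2 (f i.1 i.2 * e i xi) = E.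
    by apply: eq_bigr => x _; rewrite abs2M abs_e mulr1.
  by rewrite -/(dfc xi) /nA (cardE A) => <-; rewrite addrK.
apply: (@le_trans _ _ ((nA%:R * nB%:R / N%:R ^+ 2 - eps / 2 / N%:R ^+ 2) * E)); last first.
  by rewrite ler_wpM2r // le_max lexx orbT.
rewrite -(ler_pM2l N20) main.
have -> : N%:R ^+ 2 * ((nA%:R * nB%:R / N%:R ^+ 2 - eps / 2 / N%:R ^+ 2) * E) =
   nA%:R * nB%:R * E - 2^-1 * (eps * E) :> R by field; rewrite gt_eqF.
by rewrite lerD2l lerN2 ler_pM2l.
Qed.

End Gaps.

(** * Descent to algebraic numbers *)

Section Transfer.

Variables (F : numFieldType) (N : nat) (z : F) (zeta : algC).
Hypotheses (z_prim : N.-primitive_root z) (zeta_prim : N.-primitive_root zeta).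

Lemma root_Cyclotomic_prim : root (map_poly intr 'Phi_N : {poly F}) z.
Proof.
have N0 := prim_order_gt0 z_prim.
have E d : (0 < d)%N -> \prod_(e <- divisors d) (map_poly intr 'Phi_e : {poly F}) = 'X^d - 1.
  by move=> d0; rewrite -rmorph_prod prod_Cyclotomic // rmorphB rmorph1 /= map_polyXn.
have : root (\prod_(e <- divisors N) (map_poly intr 'Phi_e : {poly F})) z.
  by rewrite E // /root !hornerE (prim_expr_order z_prim) subrr.
rewrite /root horner_prod prodf_seq_eq0 => /hasP [d dN /= rd].
have d0 : (0 < d)%N by rewrite (dvdn_gt0 N0) // dvdn_divisors.
suff -> : N = d by [].
apply/eqP; rewrite eqn_dvd [(d %| N)%N]dvdn_divisors // dN andbT.
rewrite (prim_order_dvd z_prim) -subr_eq0.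
have <- : ('X^d - 1 : {poly F}).[z] = z ^+ d - 1 by rewrite !hornerE.
rewrite -E // horner_prod prodf_seq_eq0; apply/hasP; exists d => //.
by rewrite -dvdn_divisors.
Qed.

(** The cyclotomic polynomial, being irreducible over Q, divides every rational polynomial
    that vanishes at one primitive root of unity. *)
Lemma root_transfer (P : {poly rat}) :
  root (map_poly ratr P) z -> root (map_poly ratr P) zeta.
Proof.
move=> Pz; have [p [Ep mp Hp]] := minCpolyP zeta.
have pz : root (map_poly ratr p) z.
  have -> : p = map_poly intr 'Phi_N.
    apply: (map_inj_poly (fmorph_inj (@ratr algC))); first exact: rmorph0.
    rewrite -Ep (minCpoly_cyclotomic zeta_prim) -(Cintr_Cyclotomic zeta_prim).
    by rewrite -map_poly_comp; apply: eq_map_poly => x; rewrite /= rmorph_int.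
  have -> : map_poly ratr (map_poly intr 'Phi_N) = map_poly intr 'Phi_N :> {poly F}.
    by rewrite -map_poly_comp; apply: eq_map_poly => x; rewrite /= rmorph_int.
  exact: root_Cyclotomic_prim.
rewrite Hp; apply: contraT => npP; exfalso.
have p0 : p != 0 by apply: monic_neq0.
suff cop : coprimep p P.
  have /Bezout_eq1_coprimepP [[u v] /= uv] := cop.
  have := congr1 (fun q : {poly rat} => (map_poly ratr q : {poly F}).[z]) uv.
  rewrite /= rmorphD !rmorphM rmorph1 /= !hornerE (rootP pz) (rootP Pz) !mulr0 addr0.
  by move/eqP; rewrite eq_sym oner_eq0.
pose d := gcdp p P; have dp : d %| p by apply: dvdp_gcdl.
have d0 : d != 0 by rewrite gcdp_eq0 (negPf p0).
have Epd := divpK dp; set e := p %/ d in Epd.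
have : root (map_poly ratr (e * d)) zeta by rewrite Epd Hp dvdpp.
rewrite rmorphM rootM !Hp => /orP[pe|pd]; last first.
  by move: npP; rewrite (dvdp_trans pd) // dvdp_gcdr.
have e0 : e != 0 by apply: contra p0 => /eqP e0; rewrite -Epd e0 mul0r.
rewrite coprimep_def -/d; have := dvdp_leq e0 pe.
rewrite -Epd size_mul //; move: d0 e0; rewrite -!size_poly_gt0.
by move: (size d) (size e) => x y; lia.
Qed.

Definition monomial_matrix (K : fieldType) (x : K) (I J : finType)
    (b : I -> J -> bool) (n : I -> J -> nat) : 'M[K]_(#|I|, #|J|) :=
  \matrix_(i, j) if b (enum_val i) (enum_val j) then x ^+ n (enum_val i) (enum_val j) else 0.

(** A maximal minor is a polynomial with rational coefficients in the root of unity, to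
    which [root_transfer] applies. *)
Lemma monomial_matrix_free (I J : finType) (b : I -> J -> bool) (n : I -> J -> nat) :
  row_free (monomial_matrix zeta b n) -> row_free (monomial_matrix z b n).
Proof.
pose P : 'M[{poly rat}]_(#|I|, #|J|) := \matrix_(i, j)
  if b (enum_val i) (enum_val j) then 'X^(n (enum_val i) (enum_val j)) else 0.
pose ev (K : numFieldType) (x : K) : {rmorphism {poly rat} -> K} :=
  horner_eval x \o map_poly ratr.
have evE (K : numFieldType) (x : K) : monomial_matrix x b n = map_mx (ev K x) P.
  apply/matrixP => i j; rewrite !mxE /ev /=; case: ifP => _.
    by rewrite map_polyXn /horner_eval hornerXn.
  by rewrite rmorph0 /horner_eval horner0.
have tr_full (K : fieldType) (W : 'M[K]_(#|I|, #|J|)) : row_free W = row_full W^T.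
  by rewrite /row_free /row_full mxrank_tr.
rewrite !tr_full => full.
have := fullrowsub_unit full; set f := fullrankfun full.
have sub_ev (K : numFieldType) (x : K) :
    rowsub f (monomial_matrix x b n)^T = map_mx (ev K x) (rowsub f P^T).
  by rewrite evE map_trmx; apply/matrixP => i j; rewrite !mxE.
rewrite !unitmxE !sub_ev !det_map_mx !unitfE => zeta_det.
have z_det : ev F z (\det (rowsub f P^T)) != 0.
  apply: contra zeta_det => /eqP H; apply/eqP/rootP.
  by apply: root_transfer; apply/rootP.
have : rowsub f (monomial_matrix z b n)^T \in unitmx.
  by rewrite unitmxE sub_ev det_map_mx unitfE.
rewrite -row_full_unit /row_full => /eqP rk.
rewrite /row_full eqn_leq rank_leq_col -{1}rk.
by rewrite mxrankS // rowsub_sub.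
Qed.

(** Nonzero solutions exist exactly when the matrix of the system is not of full rank,
    and this does not depend on the choice of the root of unity. *)
Lemma solution_transfer (I J : finType) (b : I -> J -> bool) (n : I -> J -> nat) :
  (exists2 u : I -> F, exists i, u i != 0 &
     forall j, \sum_i u i * (if b i j then z ^+ n i j else 0) = 0) ->
  exists2 u : I -> algC, exists i, u i != 0 &
     forall j, \sum_i u i * (if b i j then zeta ^+ n i j else 0) = 0.
Proof.
move=> [u [i0 ui0] Hu].
have : ~~ row_free (monomial_matrix z b n).
  rewrite -kermx_eq0; apply/rowV0Pn; exists (\row_k u (enum_val k)).
    apply/sub_kermxP/rowP => j; rewrite !mxE -[RHS](Hu (enum_val j)) [RHS]sum_enum_rank.
    by apply: eq_bigr => k _; rewrite !mxE.
  apply: contra ui0 => /eqP /rowP /(_ (enum_rank i0)); rewrite !mxE enum_rankK.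
  by move/eqP.
move/(contra (@monomial_matrix_free I J b n)).
rewrite -kermx_eq0 => /rowV0Pn [v /sub_kermxP vW v0].
exists (fun i => v 0 (enum_rank i)).
  apply/existsP; apply: contraR v0; rewrite negb_exists => /forallP H.
  apply/eqP/rowP => i; rewrite mxE -(enum_valK i); apply/eqP.
  by have := H (enum_val i); rewrite negbK.
move=> j; have /rowP /(_ (enum_rank j)) := vW; rewrite !mxE => E; rewrite -[RHS]E [LHS]sum_enum_rank.
by apply: eq_bigr => k _; rewrite !mxE enum_valK enum_rankK.
Qed.

End Transfer.

(** * Supply of primes *)

Section PrimeSupply.

Lemma expn2_leq_central_bin n : (2 ^ n <= 'C(n + n, n))%N.
Proof.
rewrite -(binomial.Vandermonde n n n) -[X in (X ^ _)%N]/(1 + 1)%N expnDn.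
apply: leq_sum => j _; rewrite !exp1n !muln1 -[X in (X <= _)%N]muln1 leq_mul2l bin_gt0.
by rewrite leq_subr orbT.
Qed.

(** In Legendre's formula the power [p ^ i] contributes at most [1], and nothing once it
    exceeds [2 n]. *)
Lemma logn_central_bin p n K : prime p -> (n + n < 2 ^ K)%N ->
  (logn p 'C(n + n, n) <= K)%N.
Proof.
move=> pp nK; have p1 := prime_gt1 pp.
have E : (logn p 'C(n + n, n) + (logn p n`! + logn p n`!) = logn p (n + n)`!)%N.
  have := bin_fact (leq_addl n n); rewrite addnK => <-.
  by rewrite !lognM ?muln_gt0 ?fact_gt0 ?bin_gt0 ?leq_addl.
have ext m : (m <= n + n)%N -> logn p m`! = (\sum_(1 <= k < (n + n).+1) m %/ p ^ k)%N.
  move=> mn; rewrite logn_fact // (@big_cat_nat _ _ _ m.+1 1 (n + n).+1) //=.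
  rewrite [X in (_ + X)%N]big_nat_cond [X in (_ + X)%N]big1 ?addn0 // => k.
  rewrite andbT => /andP[mk _]; apply: divn_small.
  by apply: leq_trans mk _; apply: ltnW; apply: ltn_expl.
have nn : (n <= n + n)%N by apply: leq_addl.
rewrite !ext // in E.
have : (\sum_(1 <= k < (n + n).+1) (n + n) %/ p ^ k <=
   \sum_(1 <= k < (n + n).+1) (n %/ p ^ k + n %/ p ^ k + (k < K)))%N.
  apply: leq_sum => k _; have pk : (0 < p ^ k)%N by rewrite expn_gt0 ltnW.
  case: (ltnP k K) => kK /=.
    rewrite -ltnS ltn_divLR //.
    have := ltn_ceil n pk; have := ltn_ceil n pk.
    by move: (n %/ p ^ k)%N (p ^ k)%N => a b; nia.
  rewrite divn_small //; apply: leq_trans nK _.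
  apply: (@leq_trans (p ^ K)); last by rewrite leq_pexp2l // ltnW.
  by case: (posnP K) => [->|K0]; rewrite ?expn0 // leq_exp2r.
rewrite !big_split /= -E => H.
have {}H : (logn p 'C(n + n, n) <= \sum_(1 <= k < (n + n).+1) (k < K))%N.
  by move: H; rewrite [X in (_ <= X)%N]addnC leq_add2r.
apply: leq_trans H _.
have [Kn|Kn] := leqP K (n + n).+1; last first.
  apply: (@leq_trans (\sum_(1 <= k < (n + n).+1) 1)); first by apply: leq_sum => k _; case: (_ < _)%N.
  by rewrite sum_nat_const_nat muln1; lia.
case: K nK Kn => [|K] nK Kn.
  by rewrite big1.
rewrite (@big_cat_nat _ _ _ K.+1) //= [X in (_ + X)%N]big_nat_cond [X in (_ + X)%N]big1 ?addn0; last first.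
  by move=> k; rewrite andbT => /andP[Kk _]; rewrite ltnNge Kk.
apply: (@leq_trans (\sum_(1 <= k < K.+1) 1)); first by apply: leq_sum => k _; case: (_ < _)%N.
by rewrite sum_nat_const_nat muln1; lia.
Qed.

(** If every prime up to [2 n] divided [E], then so would, up to multiplicities, the
    central binomial coefficient, which is too large. *)
Lemma prime_not_dividing E n K : (0 < E)%N -> (n + n < 2 ^ K)%N -> (E ^ K < 2 ^ n)%N ->
  exists l, [/\ prime l, (l <= n + n)%N & ~~ (l %| E)%N].
Proof.
move=> E0 nK En; apply: contrapT => H.
have dvd l : prime l -> (l <= n + n)%N -> (l %| E)%N.
  by move=> pl ln; apply: contrapT => /negP lE; apply: H; exists l.
have C0 : (0 < 'C(n + n, n))%N by rewrite bin_gt0 leq_addl.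
have : ('C(n + n, n) %| E ^ K)%N.
  apply/dvdn_partP => // p; rewrite mem_primes => /and3P[pp _ pC].
  rewrite p_part pfactor_dvdn ?expn_gt0 ?E0 // lognX.
  apply: leq_trans (logn_central_bin pp nK) _.
  have pn : (p <= n + n)%N.
    have : (p %| (n + n)`!)%N.
      have := bin_fact (leq_addl n n); rewrite addnK => <-.
      by rewrite dvdn_mulr.
    elim: (n + n)%N => [|m IHm]; first by rewrite fact0 dvdn1 => /eqP p1; rewrite p1 in pp.
    by rewrite factS Euclid_dvdM // => /orP[/dvdn_leq -> //|/IHm/leqW].
  by rewrite -[X in (X <= _)%N]muln1 leq_mul2l -pfactor_dvdn // expn1 dvd ?orbT.
move/dvdn_leq; rewrite expn_gt0 E0 => /(_ isT) le1.
by have := leq_trans (expn2_leq_central_bin n) le1; rewrite leqNgt En.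
Qed.

Lemma cube_lt_expn2 k : (12 <= k)%N -> (k ^ 3 + k ^ 3 < 2 ^ k)%N.
Proof.
elim: k => // k IH; rewrite leq_eqVlt => /orP[/eqP <- //|].
rewrite ltnS => k12; have := IH k12; rewrite [(2 ^ k.+1)%N]expnS.
move: (2 ^ k)%N => x H.
have : (k.+1 ^ 3 <= 2 * k ^ 3)%N.
  by rewrite !expnS expn0; nia.
by move: H; lia.
Qed.

(** Bernoulli's inequality for [(1 + 1 / P) ^ q], cleared of denominators. *)
Lemma bernoulli_expn P q : (P ^ q * (P + q) <= P * P.+1 ^ q)%N.
Proof.
elim: q => [|q IH]; first by rewrite !expn0 addn0 mul1n muln1.
rewrite !expnS [X in (_ <= X)%N]mulnCA.
apply: (@leq_trans (P.+1 * (P ^ q * (P + q)))); last by rewrite leq_mul2l IH orbT.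
have -> : (P * P ^ q * (P + q.+1) = P ^ q * (P * (P + q.+1)))%N by ring.
have -> : (P.+1 * (P ^ q * (P + q)) = P ^ q * (P.+1 * (P + q)))%N by ring.
by rewrite leq_mul2l; apply/orP; right; nia.
Qed.

Variable M : nat.
Hypothesis hM : (2 <= M)%N.

Definition scale0 : nat := (2 ^ 11 * M * (M ^ 2 - 1) ^ 4 + M + 2)%N.

(** The proportion [(1 - M ^ (- 2)) ^ k] left by an alphabet that misses a digit beats any
    power of [k].  For the present power, taking [k] divisible by [8] reduces the claim to
    the eighth power of Bernoulli's inequality. *)
Lemma scale_growth q (k := (8 * q)%N) : (scale0 <= q)%N ->
  ((2 * k ^ 3 + 2) ^ 2 * M ^ 2 * (M ^ 2 - 1) ^ k <= M ^ (2 * k))%N.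
Proof.
move=> qq; pose P := (M ^ 2 - 1)%N; rewrite -/P.
have EP : P.+1 = (M ^ 2)%N by rewrite /P -addn1 subnK // expn_gt0 ltnW.
have P0 : (0 < P)%N by rewrite -ltnS EP; move: hM; rewrite expnS expn1; nia.
have q2 : (2 <= q)%N by apply: leq_trans qq; rewrite /scale0 leq_addl.
have q1 : (2 ^ 11 * M * P ^ 4 <= q)%N by apply: leq_trans qq; rewrite /scale0 -addnA leq_addr.
have W : ((2 * k ^ 3 + 2) ^ 2 * M ^ 2 * P ^ 8 <= q ^ 8)%N.
  apply: (@leq_trans ((2 ^ 11 * q ^ 3) ^ 2 * M ^ 2 * P ^ 8)).
    apply: leq_mul => //; apply: leq_mul => //; rewrite leq_exp2r //.
    by rewrite /k !expnS !expn0; nia.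
  apply: (@leq_trans ((2 ^ 11 * M * P ^ 4) ^ 2 * q ^ 6)).
    by clear; move: (2 ^ 11)%N P => c P'; apply/eq_leq; ring.
  apply: (@leq_trans (q ^ 2 * q ^ 6)); first by rewrite leq_mul2r leq_exp2r // q1 orbT.
  by rewrite -expnD.
rewrite -(@leq_pmul2l (P ^ 8)) ?expn_gt0 ?P0 //.
rewrite mulnC -mulnA [(P ^ k * _)%N]mulnC mulnA.
apply: (leq_trans (leq_mul W (leqnn _))).
rewrite expnM -EP /k [(8 * q)%N]mulnC !expnM -!expnMn leq_exp2r //.
apply: leq_trans (bernoulli_expn P q).
by rewrite mulnC leq_mul2l leq_addl orbT.
Qed.

(** The degree [m] is about the square root of the number of points of an iterate, which
    is exponentially smaller than [M ^ k]; on the other hand, primes not dividing [E M]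
    are found up to [2 k ^ 3]. *)
Lemma enough_primes q (k := (8 * q)%N) m : (scale0 <= q)%N ->
  (m * m <= (M ^ 2 - 1) ^ k)%N ->
  ((2 * k ^ 3 + 2) * m <= M ^ k.-1)%N /\
  (forall E, (0 < E)%N -> (E <= 2 * m * m)%N -> exists l,
     [/\ prime l, coprime l (M ^ k), ~~ (l %| E)%N & ((l + 2) * m <= M ^ k.-1)%N]).
Proof.
move=> qq mm; have g := scale_growth qq; rewrite -/k in g.
have q2 : (2 <= q)%N by apply: leq_trans qq; rewrite /scale0 leq_addl.
have qM : (M + 2 <= q)%N by apply: leq_trans qq; rewrite /scale0 -addnA leq_addl.
have k0 : (0 < k)%N by rewrite /k; lia.
have M0 : (0 < M)%N by apply: ltnW.
have km : ((2 * k ^ 3 + 2) * m <= M ^ k.-1)%N.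
  rewrite -(leq_pmul2r M0) -expnSr prednK // -(@leq_exp2r _ _ 2) // -expnM mulnC [(k * 2)%N]mulnC.
  apply: leq_trans g.
  have -> : ((M * ((2 * k ^ 3 + 2) * m)) ^ 2 = (2 * k ^ 3 + 2) ^ 2 * M ^ 2 * (m * m))%N by ring.
  by rewrite leq_mul2l mm orbT.
split=> // E E0 Em.
have mM : (m * m <= M ^ (2 * k))%N.
  apply: leq_trans mm _; rewrite expnM leq_exp2r //; exact: leq_subr.
have EM0 : (0 < E * M)%N by rewrite muln_gt0 E0.
have [||l [pl lk lE]] := @prime_not_dividing (E * M) (k ^ 3) k EM0.
- by apply: cube_lt_expn2; rewrite /k; lia.
- apply: (@leq_ltn_trans ((M ^ (2 * k + 2)) ^ k)).
    rewrite leq_exp2r // expnD.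
    apply: (@leq_trans (M * M ^ (2 * k) * M)).
      rewrite leq_mul2r; apply/orP; right; apply: leq_trans Em _.
      by rewrite -mulnA leq_mul.
    by rewrite -mulnA mulnC -mulnA.
  rewrite -expnM; apply: (@leq_ltn_trans ((2 ^ M) ^ ((2 * k + 2) * k))).
    by rewrite leq_exp2r ?muln_gt0 ?addn_gt0 ?k0 ?orbT //; apply/ltnW/ltn_expl.
  rewrite -expnM ltn_exp2l //; rewrite !expnS expn0 muln1 /k.
  by move: qM; clear; nia.
exists l; split=> //.
- rewrite coprimeXr // prime_coprime //; apply: contra lE; exact: dvdn_mull.
- by apply: contra lE; apply: dvdn_mulr.
apply: leq_trans km; rewrite leq_mul2r; apply/orP; right.
by move: lk; lia.
Qed.

End PrimeSupply.

(** * Extremizers produce discrete lines *)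

Section ExtremizersGiveLines.

Variable R : realType.
Variables (M : nat) (hM : (2 <= M)%N) (A B : {set 'I_M * 'I_M}).

(** The trace at scale [k] of a line of direction [(a, b)], blurred by an error [w] that is
    meant to be small compared with [M ^ k]. *)
Definition near_line (E : {set 'I_M * 'I_M}) (k w : nat) (a b : int) : Prop :=
  exists x y : nat, forall t : nat, exists s1 s2 : nat,
    [/\ (s1 <= w)%N, (s2 <= w)%N &
        cantor E k (x + t * `|(a %% (M ^ k)%:Z)%Z| + s1) (y + t * `|(b %% (M ^ k)%:Z)%Z| + s2)].

Definition line_points (E : {set 'I_M * 'I_M}) (k : nat) (a b kappa : int) :
    {set 'I_(M ^ k) * 'I_(M ^ k)} :=
  [set t | on_line a b kappa t && cantor E k t.1 t.2]%SET.

(** The leading digit of every point of the block is [p]. *)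
Lemma cantor_missing_block (E : {set 'I_M * 'I_M}) (p : 'I_M * 'I_M) k i j :
  p \notin E -> (0 < k)%N -> (i < M ^ k.-1)%N -> (j < M ^ k.-1)%N ->
  ~~ cantor E k (p.1 * M ^ k.-1 + i) (p.2 * M ^ k.-1 + j).
Proof.
move=> pE k0 ik jk; apply/negP => /cantorP /(_ k.-1); rewrite ltn_predL => /(_ k0).
have D0 := Mk_gt0 hM k.-1.
rewrite /digit !divnMDl // ![(_ %/ M ^ _)%N]divn_small // !addn0 !modn_small //.
by rewrite in_alphabetE (negPf pE).
Qed.

Variable k : nat.
Hypothesis k_gt0 : (0 < k)%N.
Local Notation N := (M ^ k)%N.
Local Notation D := (M ^ k.-1)%N.
Local Notation T := ('I_N * 'I_N)%type.
Local Notation z := (root_of_unity R N).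

Let N0 : (0 < N)%N. Proof. exact: Mk_gt0. Qed.

Definition reduce (y1 y2 : nat) : T :=
  (Ordinal (ltn_pmod y1 N0), Ordinal (ltn_pmod y2 N0)).

Variable f : T -> R[i].
Hypothesis f_extremal : forall xi : T, ~~ cantor B k xi.1 xi.2 ->
  \sum_(x : T | cantor A k x.1 x.2) f x * z ^+ (x.1 * xi.1 + x.2 * xi.2) = 0.
Hypothesis f_neq0 : exists2 x : T, cantor A k x.1 x.2 & f x != 0.

(** The conditions on [f] form a linear system whose coefficients are [0] and powers of
    the root of unity. *)
Lemma algebraic_extremizer (zeta : algC) : N.-primitive_root zeta ->
  exists g : T -> algC, [/\ exists x, g x != 0,
    forall x : T, g x != 0 -> cantor A k x.1 x.2
    & forall xi : T, ~~ cantor B k xi.1 xi.2 ->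
        \sum_x g x * zeta ^- (x.1 * xi.1 + x.2 * xi.2) = 0].
Proof.
move=> zp.
have zVp : N.-primitive_root zeta^-1.
  have := prim_root_neq0 zp => z0.
  have zV : zeta^-1 = zeta ^+ N.-1.
    by apply: (mulfI z0); rewrite -exprS prednK // divff // (prim_expr_order zp).
  by rewrite zV prim_root_exp_coprime // coprime_sym coprimenP.
pose b (x : T) (j : T + T) := match j with
  | inl xi => ~~ cantor B k xi.1 xi.2
  | inr y => ~~ cantor A k x.1 x.2 && (x == y) end.
pose n (x : T) (j : T + T) : nat := match j with
  | inl xi => (x.1 * xi.1 + x.2 * xi.2)%N | inr y => 0%N end.
have [|g g0 Hg] := @solution_transfer R[i] N z zeta^-1 (root_of_unity_prim R N0) zVp
    T (T + T)%type b n.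
  exists (fun x : T => if cantor A k x.1 x.2 then f x else 0).
    by case: f_neq0 => x Ax fx; exists x; rewrite Ax.
  move=> [xi|y]; rewrite /b /n.
    case: (boolP (cantor B k xi.1 xi.2)) => Bxi /=; first by rewrite big1 // => x _; rewrite mulr0.
    rewrite -[RHS](f_extremal Bxi) [RHS]big_mkcond; apply: eq_bigr => x _.
    by case: ifP; rewrite ?mul0r.
  by rewrite big1 // => x _; case: (cantor A k x.1 x.2); rewrite ?mul0r ?mulr0.
exists g; split=> //.
  move=> x; apply: contraR => Ax; apply/eqP; have := Hg (inr x).
  rewrite (bigD1 x) //= big1 ?addr0 => [|y yx]; last by rewrite (negPf yx) andbF mulr0.
  by rewrite Ax eqxx expr0 mulr1.
move=> xi Bxi; rewrite -[RHS](Hg (inl xi)); apply: eq_bigr => x _.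
by rewrite /b Bxi exprVn.
Qed.

(** Bringing the block of a missing digit to the origin modulates the transform and makes
    it orthogonal to a box, so that [uncertainty_line] applies.  On the line thus found the
    character of [(a, b)] is constant, hence the inverse transform of the function
    carried by it has a constant modulus along [(a, b)]; each of its values is a combination
    of values of the extremizer within the degrees of [q]. *)
Lemma extremizer_lines m : (exists p, p \notin A) ->
  (8 * m <= D)%N -> (#|cantor_iterate B k| < m.+1 * m.+1)%N ->
  (forall E, (0 < E)%N -> (E <= 2 * m * m)%N -> exists l,
     [/\ prime l, coprime l N, ~~ (l %| E)%N & ((l + 2) * m <= D)%N]) ->
  exists a b kappa : int,
    [/\ coprimez a b, (`|a| * D <= 2 * N)%N /\ (`|b| * D <= 2 * N)%N,
        near_line A k (2 * m) a b & (D < 2 * #|line_points B k a b kappa|)%N].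
Proof.
move=> [p pA] mD Bm primes.
have [zeta zp] := C_prim_root_exists N0.
have z0 := prim_root_neq0 zp.
have [g [[x0 gx0] gA gB]] := algebraic_extremizer zp.
pose ghat (xi : T) := \sum_x g x * zeta ^- (x.1 * xi.1 + x.2 * xi.2).
have NN : N%:R ^+ 2 != 0 :> algC by rewrite expf_neq0 // pnatr_eq0 -lt0n.
have inv (y1 y2 : nat) :
    \sum_(xi : T) ghat xi * zeta ^+ (y1 * xi.1 + y2 * xi.2) = N%:R ^+ 2 * g (reduce y1 y2).
  under eq_bigr => xi _ do rewrite mulr_suml.
  rewrite exchange_big (bigD1 (reduce y1 y2)) //= [X in _ + X]big1 ?addr0.
    under eq_bigr => xi _ do rewrite -mulrA [_^-1 * _]mulrC.
    by rewrite -mulr_sumr (orthogonality2 zp) /= !modn_mod !eqxx mulrC.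
  move=> x xy; under eq_bigr => xi _ do rewrite -mulrA [_^-1 * _]mulrC.
  rewrite -mulr_sumr (orthogonality2 zp); case: ifP => [/andP[e1 e2]|_]; last by rewrite mulr0.
  case/negP: xy; apply/eqP; rewrite [x]surjective_pairing /reduce.
  by congr (_, _); apply: val_inj; rewrite /= ?(eqP e1) ?(eqP e2) modn_small.
(* the corner of the block of the missing digit *)
pose c1 := (p.1 * D)%N; pose c2 := (p.2 * D)%N.
pose h (xi : T) := ghat xi * zeta ^+ (c1 * xi.1 + c2 * xi.2).
have hinv (y1 y2 : nat) : \sum_(xi : T) h xi * zeta ^+ (y1 * xi.1 + y2 * xi.2) =
    N%:R ^+ 2 * g (reduce (c1 + y1) (c2 + y2)).
  rewrite -inv; apply: eq_bigr => xi _; rewrite /h -mulrA -exprD; congr (_ * _ ^+ _).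
  by rewrite !mulnDl addnACA.
have g_cantor (y1 y2 : nat) : g (reduce y1 y2) != 0 -> cantor A k y1 y2.
  by move/gA => /=; rewrite cantor_mod.
have h0 : exists xi, h xi != 0.
  case: (pselect (exists xi, ghat xi != 0)) => [[xi gxi]|H].
    by exists xi; rewrite mulf_neq0 // expf_neq0.
  case/negP: gx0; have := inv x0.1 x0.2.
  rewrite big1 => [/esym/eqP|xi _].
    rewrite mulf_eq0 (negPf NN) /=; suff -> : reduce x0.1 x0.2 = x0 by [].
    by case: (x0) => a b; congr (_, _); apply: val_inj; rewrite /= modn_small.
  have -> : ghat xi = 0 by apply: contrapT => /eqP gx; apply: H; exists xi.
  by rewrite mul0r.
have hB xi : h xi != 0 -> xi \in cantor_iterate B k.
  rewrite (mem_cantor_iterate hM); apply: contraR => Bxi.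
  by rewrite /h /ghat gB ?mul0r.
have kh : kills (zcoord zeta) (wcoord zeta) h D D.
  move=> i j iD jD.
  have -> : \sum_t h t * (zcoord zeta t ^+ i * wcoord zeta t ^+ j) =
     \sum_(t : T) h t * zeta ^+ (i * t.1 + j * t.2).
    apply: eq_bigr => t _; congr (_ * _).
    by rewrite /zcoord /wcoord -!exprM -exprD [(t.1 * i)%N]mulnC [(t.2 * j)%N]mulnC.
  rewrite hinv; apply/eqP; rewrite mulf_eq0 (negPf NN) /=; apply/negPn/negP.
  by move/g_cantor; apply/negP; apply: cantor_missing_block.
have D0 : (0 < D)%N by apply: Mk_gt0.
have [a [b [kappa [q [[cab aD bD sq yq] [[t1 qh1] hline hcard]]]]]] :=
  uncertainty_line zp h0 hB Bm kh D0 mD primes.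
exists a, b, kappa; split=> //; last first.
  apply: leq_trans hcard _; rewrite leq_mul2l /=; apply: subset_leq_card; apply/fintype.subsetP => t.
  rewrite !inE => qht; rewrite hline //= -(mem_cantor_iterate hM); apply: hB.
  by apply: contra qht => /eqP->; rewrite mulr0.
pose h1 (t : T) := ev (zcoord zeta) (wcoord zeta) q t * h t.
(* the inverse transform of [q h], a combination of translates of [g] *)
pose G (y1 y2 : nat) := \sum_(t : T) h1 t * zeta ^+ (y1 * t.1 + y2 * t.2).
have GE y1 y2 : G y1 y2 = \sum_(j < (2 * m).+1) \sum_(i < (2 * m).+1)
    q`_j`_i * (N%:R ^+ 2 * g (reduce (c1 + (y1 + i)) (c2 + (y2 + j)))).
  rewrite /G; under eq_bigr => t _ do rewrite /h1 (evE _ _ t yq sq) !mulr_suml.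
  rewrite exchange_big; apply: eq_bigr => j _ /=.
  under eq_bigr => t _ do rewrite !mulr_suml.
  rewrite exchange_big; apply: eq_bigr => i _ /=.
  rewrite -hinv mulr_sumr; apply: eq_bigr => t _.
  rewrite /zcoord /wcoord -!exprM !mulnDl !exprD [(t.1 * i)%N]mulnC [(t.2 * j)%N]mulnC.
  by ring.
have [y [y' Gy]] : exists y y', G y y' != 0.
  apply: contrapT => H; case/negP: qh1; apply/eqP.
  have G0 y1 y2 : G y1 y2 = 0.
    by apply: contrapT => /eqP Gy; apply: H; exists y1, y2.
  apply: (mulfI NN); rewrite mulr0.
  transitivity (\sum_(y : T) G y.1 y.2 * zeta ^- (t1.1 * y.1 + t1.2 * y.2)); last first.
    by rewrite big1 // => y _; rewrite G0 mul0r.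
  under eq_bigr => y _ do rewrite /G mulr_suml.
  rewrite exchange_big (bigD1 t1) //= [X in _ + X]big1 ?addr0 => [|t tt1].
    under eq_bigr => y _ do rewrite -mulrA [(y.1 * t1.1)%N]mulnC [(y.2 * t1.2)%N]mulnC.
    by rewrite -mulr_sumr (orthogonality2 zp) !eqxx mulrC.
  under eq_bigr => y _ do rewrite -mulrA [(y.1 * t.1)%N]mulnC [(y.2 * t.2)%N]mulnC.
  rewrite -mulr_sumr (orthogonality2 zp); case: ifP => [/andP[]|_]; last by rewrite mulr0.
  rewrite !modn_small // => /eqP/val_inj e1 /eqP/val_inj e2.
  by case/negP: tt1; apply/eqP; rewrite [t]surjective_pairing e1 e2 -surjective_pairing.
pose a' := `|(a %% N%:Z)%Z|%N; pose b' := `|(b %% N%:Z)%Z|%N.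
have N0' : N%:Z != 0 by rewrite eqz_nat -lt0n.
have phase (t : T) : h1 t != 0 -> zeta ^+ (a' * t.1 + b' * t.2) = zeta ^ kappa.
  move=> ht; apply/eqP; rewrite exprnP (prim_expz_eq zp).
  have /dvdzP [n En] := hline t ht; apply/dvdzP.
  exists (n - (a %/ N%:Z)%Z * t.1%:Z - (b %/ N%:Z)%Z * t.2%:Z).
  rewrite PoszD !PoszM /a' /b' !gez0_abs ?modz_ge0 //.
  have -> : (a %% N%:Z)%Z = a - (a %/ N%:Z)%Z * N%:Z by rewrite {2}(divz_eq a N%:Z); ring.
  have -> : (b %% N%:Z)%Z = b - (b %/ N%:Z)%Z * N%:Z by rewrite {2}(divz_eq b N%:Z); ring.
  by rewrite !mulrBl -En; ring.
have Gt (t : nat) : G (y + t * a')%N (y' + t * b')%N = (zeta ^ kappa) ^+ t * G y y'.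
  rewrite /G mulr_sumr; apply: eq_bigr => x _.
  have [->|hx] := eqVneq (h1 x) 0; first by rewrite !mul0r mulr0.
  rewrite -(phase x hx) mulrCA -exprM -exprD; congr (_ * _ ^+ _); ring.
exists (c1 + y)%N, (c2 + y')%N => t.
have : G (y + t * a')%N (y' + t * b')%N != 0.
  by rewrite Gt mulf_neq0 // expf_neq0 // expfz_neq0.
rewrite GE => GN.
have [j [i gij]] : exists j i : 'I_(2 * m).+1,
    g (reduce (c1 + (y + t * a' + i)) (c2 + (y' + t * b' + j))) != 0.
  apply: contrapT => H; case/negP: GN; apply/eqP.
  rewrite big1 // => j _; rewrite big1 // => i _.
  suff -> : g (reduce (c1 + (y + t * a' + i)) (c2 + (y' + t * b' + j))) = 0 by rewrite !mulr0.
  by apply: contrapT => /eqP gij; apply: H; exists j, i.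
exists i, j; split; rewrite -1?ltnS //.
by have := g_cantor _ _ gij; rewrite !addnA.
Qed.

End ExtremizersGiveLines.

(** * From a proportion of a line to a full line *)

Section FullLines.

Variables (M : nat) (hM : (2 <= M)%N) (E : {set 'I_M * 'I_M}) (a b : int).

(** The [j] lowest digits lie on a line modulo [M ^ j]; once they are fixed, the other
    ones lie on a line modulo [M ^ l]. *)
Lemma line_points_add j l u w :
  (forall kappa, (#|line_points E j a b kappa| <= u)%N) ->
  (forall kappa, (#|line_points E l a b kappa| <= w)%N) ->
  forall kappa, (#|line_points E (j + l) a b kappa| <= u * w)%N.
Proof.
move=> Hu Hw kappa.
pose on (N : nat) (ka : int) (c d : nat) := (N%:Z %| a * c%:Z + b * d%:Z - ka)%Z.
have cardE k ka : #|line_points E k a b ka| =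
    (\sum_(t : 'I_(M ^ k) * 'I_(M ^ k)) (on (M ^ k)%N ka t.1 t.2 && cantor E k t.1 t.2))%N.
  by rewrite -sum1_card big_mkcond; apply: eq_bigr => t _; rewrite !inE; case: (_ && _).
rewrite cardE expnD.
rewrite (big_digits2 _ _ _ (fun c d => on (M ^ j * M ^ l)%N kappa c d && cantor E (j + l) c d : nat)).
set m := (M ^ j)%N; set n := (M ^ l)%N.
have m0 : m%:Z != 0 by rewrite eqz_nat -lt0n Mk_gt0.
apply: (@leq_trans (\sum_(y : 'I_m * 'I_m) (on m kappa y.1 y.2 && cantor E j y.1 y.2) * w)); last first.
  by rewrite -big_distrl leq_mul2r /= -cardE Hu orbT.
apply: leq_sum => y _.
have [oy|oy] := boolP (on m kappa y.1 y.2); last first.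
  rewrite mul0n leqn0 sum_nat_eq0; apply/forallP => z; apply/implyP => _.
  rewrite eqb0; apply: contra oy => /andP[/dvdzP [r Er] _]; apply/dvdzP.
  exists (r * n%:Z - a * z.1%:Z - b * z.2%:Z); rewrite !mulrBl.
  have : r * n%:Z * m%:Z = r * (m * n)%N%:Z by rewrite PoszM; ring.
  by move=> ->; rewrite -Er !PoszD !PoszM; ring.
have [cy|cy] := boolP (cantor E j y.1 y.2); last first.
  rewrite mul0n leqn0 sum_nat_eq0; apply/forallP => z; apply/implyP => _.
  by rewrite eqb0 (cantor_addM hM) // (negPf cy) andbF.
rewrite mul1n; have /dvdzP [r Er] := oy.
apply: leq_trans (Hw (- r)); rewrite cardE; apply: leq_sum => z _.
rewrite (cantor_addM hM) // cy /=; case: (boolP (cantor E l z.1 z.2)); rewrite ?andbF // !andbT.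
suff : on (m * n)%N kappa (y.1 + m * z.1)%N (y.2 + m * z.2)%N -> on n (- r) z.1 z.2.
  by case: (on _ _ _ _) => // ->.
move=> /dvdzP [s Es]; apply/dvdzP; exists s; apply: (mulIf m0).
have -> : s * n%:Z * m%:Z = s * (m * n)%N%:Z by rewrite PoszM; ring.
rewrite -Es !PoszD !PoszM opprK mulrDl -Er; ring.
Qed.

(** The counts are submultiplicative in the level, so that they would decay
    exponentially relative to [M ^ k] if at some level no line was full. *)
Lemma full_counts :
  (forall n, exists2 k, (n <= k)%N &
     exists kappa, (M ^ k.-1 < 2 * #|line_points E k a b kappa|)%N) ->
  forall l, (0 < l)%N -> exists kappa, (M ^ l <= #|line_points E l a b kappa|)%N.
Proof.
move=> H l l0; apply: contrapT => full.
pose u := (M ^ l).-1; have Eu : u.+1 = (M ^ l)%N by rewrite prednK // Mk_gt0.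
have Hl kappa : (#|line_points E l a b kappa| <= u)%N.
  rewrite -ltnS Eu ltnNge; apply/negP => le; apply: full; by exists kappa.
have Hq q kappa : (#|line_points E (l * q) a b kappa| <= u ^ q)%N.
  elim: q kappa => [|q IH] kappa.
    rewrite muln0 [(u ^ 0)%N]expn0 (leq_trans (max_card _)) // card_prod !card_ord.
    by rewrite expn0.
  by rewrite mulnS expnS; apply: line_points_add.
have Hs s kappa : (s < l)%N -> (#|line_points E s a b kappa| <= M ^ (2 * l))%N.
  move=> sl; rewrite (leq_trans (max_card _)) // card_prod !card_ord mul2n -addnn expnD.
  by rewrite leq_mul // leq_pexp2l ?M_gt0 // ltnW.
pose Q := (u * (2 * M ^ (2 * l + 1))).+1.
have [k lk [kappa Hk]] := H (l * Q.+1)%N.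
pose q := (k %/ l)%N; pose s := (k %% l)%N.
have Ek : k = (l * q + s)%N by rewrite mulnC -divn_eq.
have sl : (s < l)%N by rewrite ltn_pmod.
have Qq : (Q < q)%N by rewrite /q leq_divRL // mulnC.
have k0 : (0 < k)%N by apply: leq_trans lk; rewrite muln_gt0 l0.
have le1 : (#|line_points E k a b kappa| <= u ^ q * M ^ (2 * l))%N.
  by rewrite Ek; apply: line_points_add => // ka; apply: Hs.
have le2 : (u.+1 ^ q <= u ^ q * (2 * M ^ (2 * l + 1)))%N.
  rewrite Eu -expnM.
  apply: (@leq_trans (M ^ k)); first by rewrite leq_pexp2l ?M_gt0 // Ek leq_addr.
  rewrite -{1}(prednK k0) expnSr addn1 expnSr.
  apply: (@leq_trans (2 * #|line_points E k a b kappa| * M)).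
    by rewrite leq_mul2r (ltnW Hk) orbT.
  apply: (@leq_trans (2 * (u ^ q * M ^ (2 * l)) * M)).
    by rewrite leq_mul2r leq_mul2l le1 !orbT.
  by apply/eq_leq; ring.
case: (posnP u) => [u0|u0].
  by move: le2; rewrite u0 exp0n ?mul0n ?exp1n // (leq_ltn_trans _ Qq).
have le3 := bernoulli_expn u q.
have : (u ^ q * (u + q) <= u ^ q * (u * (2 * M ^ (2 * l + 1))))%N.
  by apply: leq_trans le3 _; rewrite [X in (_ <= X)%N]mulnCA leq_mul2l le2 orbT.
rewrite leq_mul2l expn_eq0 eqn0Ngt u0 /= leqNgt => /negP; apply.
by apply: (@leq_trans q); [exact: ltnW|exact: leq_addl].
Qed.

(** A line has at most [M ^ l] points, so that a full count misses none of them. *)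
Lemma near_line_of_full_counts l : coprimez a b ->
  (exists kappa, (M ^ l <= #|line_points E l a b kappa|)%N) -> near_line E l 0 (- b) a.
Proof.
move=> cab [kappa full]; have N0 := Mk_gt0 hM l.
have eqL : line_points E l a b kappa = [set t | on_line a b kappa t]%SET.
  apply/eqP; rewrite eqEcard (leq_trans (card_on_line kappa N0 cab)) // andbT.
  by apply/fintype.subsetP => t; rewrite !inE => /andP[].
have /card_gt0P [t0] : (0 < #|line_points E l a b kappa|)%N by apply: leq_trans full.
rewrite inE => /andP[lt0 _]; exists t0.1, t0.2 => t; exists 0%N, 0%N; split=> //.
rewrite !addn0 -(cantor_mod hM).
pose y : 'I_(M ^ l) * 'I_(M ^ l) := (Ordinal (ltn_pmod (t0.1 + t * `|((- b) %% (M ^ l)%:Z)%Z|) N0),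
  Ordinal (ltn_pmod (t0.2 + t * `|(a %% (M ^ l)%:Z)%Z|) N0)).
have : y \in line_points E l a b kappa; last by rewrite inE => /andP[].
rewrite eqL inE /on_line /= -!modz_nat; set N := (M ^ l)%N%:Z.
have N0' : N != 0 by rewrite eqz_nat -lt0n.
have mE (c : int) : exists r, (c %% N)%Z = c - r * N.
  by exists (c %/ N)%Z; rewrite {2}(divz_eq c N); ring.
rewrite !PoszD !PoszM !gez0_abs ?modz_ge0 //.
have [r1 ->] := mE (- b); have [r2 ->] := mE a.
have [r3 ->] := mE (t0.1%:Z + t%:Z * (- b - r1 * N)).
have [r4 ->] := mE (t0.2%:Z + t%:Z * (a - r2 * N)).
have /dvdzP [r Er] := lt0; apply/dvdzP.
exists (r - a * t%:Z * r1 - a * r3 - b * t%:Z * r2 - b * r4).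
rewrite !mulrBl -Er; ring.
Qed.

End FullLines.

Lemma infinite_pigeonhole (P : nat -> int -> int -> Prop) (q0 L : nat) :
  (forall q, (q0 <= q)%N -> exists a b : int, [/\ (`|a| <= L)%N, (`|b| <= L)%N & P q a b]) ->
  exists a b, forall n, exists2 q, (n <= q)%N & P q a b.
Proof.
move=> H; apply: contrapT => none.
have none' (c : int * int) : exists n, forall q, (n <= q)%N -> ~ P q c.1 c.2.
  apply: contrapT => H1; apply: none; exists c.1, c.2 => n; apply: contrapT => H2.
  by apply: H1; exists n => q nq Pq; apply: H2; exists q.
have [bound Hb] := choice none'.
pose I := ('I_(2 * L).+1 * 'I_(2 * L).+1)%type.
pose pt (i : I) : int * int := (i.1%:Z - L%:Z, i.2%:Z - L%:Z).
pose q := maxn q0 (\max_(i : I) bound (pt i)).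
have [a [b [aL bL Pq]]] := H q (leq_maxl _ _).
have lt (c : int) : (`|c| <= L)%N -> (`|(c + L%:Z)%R| < (2 * L).+1)%N by lia.
pose i : I := (Ordinal (lt a aL), Ordinal (lt b bL)).
have Ei : pt i = (a, b).
  have e (c : int) : (`|c| <= L)%N -> (`|(c + L%:Z)%R|)%N%:Z - L%:Z = c by lia.
  by rewrite /pt /= !e.
apply: (Hb (pt i) q); last by rewrite Ei.
by rewrite leq_max (leq_bigmax i) orbT.
Qed.

(** * Limits of discrete lines *)

Section TorusTopology.

Variable R : realType.
Local Open Scope classical_set_scope.
Implicit Types (p q v : R * R).

Lemma torus_projD p q : torus_proj (p + q) = torus_proj p + torus_proj q.
Proof. exact: Quotient.pi_add. Qed.

Lemma torus_projP p q : torus_proj p = torus_proj q <-> p - q \in @lattice R.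
Proof.
have E := @Quotient.idealrBE _ (@lattice R) p q.
split=> [H|H]; first by rewrite E; apply/eqP; exact: H.
by move: H; rewrite E => /eqP H; exact: H.
Qed.

Lemma torus_proj_surj (x : torus R) : exists p, x = torus_proj p.
Proof. by exists (repr x); rewrite /torus_proj reprK. Qed.

Lemma torus_proj_continuous : continuous (@torus_proj R).
Proof. exact: pi_continuous. Qed.

Lemma torus_proj_open (U : set (R * R)) : open U -> open (@torus_proj R @` U).
Proof.
move=> oU; suff : open (@torus_proj R @^-1` (@torus_proj R @` U)) by [].
have -> : @torus_proj R @^-1` (@torus_proj R @` U) =
    \bigcup_(v in [set v | v \in @lattice R]) ((fun p => p + v) @^-1` U).
  apply/seteqP; split=> [p [q Uq /torus_projP qp]|p [v /= lv Upv]].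
    by exists (q - p) => //=; rewrite addrC subrK.
  exists (p + v) => //; apply/torus_projP.
  by rewrite addrAC subrr add0r.
apply: bigcup_open => v _; apply: open_comp => // p _.
by apply: cvgD; [exact: cvg_id|exact: cvg_cst].
Qed.

Lemma int_lattice (a b : int) : ((a%:~R, b%:~R) : R * R) \in @lattice R.
Proof. by apply/andP; split; apply: intr_int. Qed.

End TorusTopology.

Section LinesInTorus.

Variable R : realType.
Variables (M : nat) (hM : (2 <= M)%N) (E : {set 'I_M * 'I_M}).
Local Open Scope classical_set_scope.

Definition digit_cells (k : nat) : set (R * R) :=
  [set p : R * R | [/\ 0 <= p.1 < 1, 0 <= p.2 < 1 &
       exists2 u, u \in cantor_iterate E k &
         Num.floor ((M ^ k)%:R * p.1) = Posz u.1 /\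
         Num.floor ((M ^ k)%:R * p.2) = Posz u.2]].

Lemma floor_divn (u m : nat) : (0 < m)%N -> Num.floor (u%:R / m%:R : R) = Posz (u %/ m).
Proof.
move=> m0; have mR : 0 < m%:R :> R by rewrite ltr0n.
apply: floor_def; apply/andP; split.
  by rewrite -pmulrn ler_pdivlMr // -natrM ler_nat leq_trunc_div.
by rewrite -PoszD addn1 -pmulrn ltr_pdivrMr // -natrM ltr_nat ltn_ceil.
Qed.

Lemma grid_point_in_cells j k u1 u2 : (j <= k)%N -> (u1 < M ^ k)%N -> (u2 < M ^ k)%N ->
  cantor E k u1 u2 -> digit_cells j (u1%:R / (M ^ k)%:R, u2%:R / (M ^ k)%:R).
Proof.
move=> jk u1k u2k cu.
have NR : 0 < (M ^ k)%:R :> R by rewrite ltr0n Mk_gt0.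
have Ek : k = ((k - j) + j)%N by rewrite subnK.
have m0 : (0 < M ^ (k - j))%N by apply: Mk_gt0.
have fl u : Num.floor ((M ^ j)%:R * (u%:R / (M ^ k)%:R) : R) = Posz (u %/ M ^ (k - j)).
  rewrite -floor_divn //; congr Num.floor.
  have -> : (M ^ k)%:R = (M ^ (k - j))%:R * (M ^ j)%:R :> R by rewrite -natrM -expnD subnK.
  by field; rewrite !pnatr_eq0 -!lt0n !Mk_gt0.
have top u : (u < M ^ k)%N -> (u %/ M ^ (k - j) < M ^ j)%N.
  by move=> uk; rewrite ltn_divLR // -expnD addnC subnK.
split=> /=; try by rewrite divr_ge0 ?ler0n //= ltr_pdivrMr // mul1r ltr_nat.
exists (Ordinal (top _ u1k), Ordinal (top _ u2k)); last by rewrite !fl.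
rewrite (mem_cantor_iterate hM) /=; move: cu; rewrite {1}Ek (cantor_add E).
by move/andP => [].
Qed.

(** The rescaled base points of the discrete lines accumulate somewhere, by compactness.
    Through such a cluster point, a line stays arbitrarily close to cells of any given
    level, because [w / M ^ k <= 1 / k]. *)
Lemma near_lines_torus_line (a b : int) :
  (forall n, exists k w, [/\ (n <= k)%N, (k * w <= M ^ k)%N & near_line E k w a b]) ->
  exists p : torus R, torus_line (a%:~R, b%:~R) p `<=` limit_cantor_set E.
Proof.
move=> H.
have H' n : exists kwxy : (nat * nat) * (nat * nat), let: ((k, w), (x, y)) := kwxy in
    [/\ (n <= k)%N, (k * w <= M ^ k)%N & forall t : nat, exists s1 s2 : nat,
    [/\ (s1 <= w)%N, (s2 <= w)%N &
        cantor E k (x + t * `|(a %% (M ^ k)%:Z)%Z| + s1) (y + t * `|(b %% (M ^ k)%:Z)%Z| + s2)]].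
  have [k [w [nk kw [x [y Hxy]]]]] := H n.
  by exists ((k, w), (x, y)).
have [F HF] := choice H'.
pose kk n := (F n).1.1; pose ww n := (F n).1.2; pose xx n := (F n).2.1; pose yy n := (F n).2.2.
have {}HF n : [/\ (n <= kk n)%N, (kk n * ww n <= M ^ kk n)%N & forall t : nat, exists s1 s2 : nat,
    [/\ (s1 <= ww n)%N, (s2 <= ww n)%N &
     cantor E (kk n) (xx n + t * `|(a %% (M ^ kk n)%:Z)%Z| + s1)
                     (yy n + t * `|(b %% (M ^ kk n)%:Z)%Z| + s2)]].
  by have := HF n; rewrite /kk /ww /xx /yy; case: (F n) => [[k w] [x y]].
pose NN n := (M ^ kk n)%N.
have NN0 n : (0 < NN n)%N by apply: Mk_gt0.
have NNR n : 0 < (NN n)%:R :> R by rewrite ltr0n.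
pose P (n : nat) : R * R := ((xx n %% NN n)%:R / (NN n)%:R, (yy n %% NN n)%:R / (NN n)%:R).
have P01 n : (`[0, 1]%classic `*` `[0, 1]%classic) (P n).
  have h x : 0 <= (x %% NN n)%:R / (NN n)%:R <= (1 : R).
    by rewrite divr_ge0 //= ler_pdivrMr // mul1r ler_nat ltnW // ltn_mod.
  by split; rewrite /= in_itv /= h.
have cpt : compact (`[0, 1]%classic `*` `[0, 1]%classic : set (R * R)).
  by apply: compact_setX; apply: segment_compact.
have [p [_ clp]] : (`[0, 1]%classic `*` `[0, 1]%classic) `&` cluster (P @ \oo) !=set0.
  by apply: cpt; exists 0%N => // n _; apply: P01.
exists (torus_proj p) => _ [t _ <-] j /= j1.
rewrite -torus_projD /cantor_level => U HU0.
have /nbhs_ballP [eps /= eps0 HU] := @torus_proj_continuous R _ U HU0.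
suff [z [z1 z2] Hz] : exists2 z : R * R,
    `|p.1 + t * a%:~R - z.1| < eps /\ `|p.2 + t * b%:~R - z.2| < eps &
    exists2 g, digit_cells j g & torus_proj z = torus_proj g.
  case: Hz => g gj Ezg; exists (torus_proj g); split; first by exists g.
  rewrite -Ezg; apply: HU; split => /=; rewrite /ball /=.
    by rewrite [t * _ + _]addrC.
  by rewrite [t * _ + _]addrC.
(* the errors of rounding, of the width and of the base point are all small *)
pose B : R := `|a%:~R| + `|b%:~R| + 1.
have B0 : 0 < B by rewrite ltr_wpDl // addr_ge0.
pose n0 := maxn j (Num.truncn (4 * B / eps)).+1.
have [n [n0n clpn]] : exists n, (n0 <= n)%N /\ ball p (eps / 4) (P n).
  have e4 : 0 < eps / 4 by rewrite divr_gt0.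
  have [_ [[n nn0 <-] Bn]] : (P @` [set n | (n0 <= n)%N]) `&` ball p (eps / 4) !=set0.
    apply: clp; last exact: nbhsx_ballx.
    by exists n0 => // n n0n; exists n.
  by exists n.
have [nk kw Hline] := HF n.
set k := kk n in nk kw Hline; set w := ww n in kw Hline.
set N := (M ^ k)%N in kw Hline.
have N0 : (0 < N)%N := NN0 n.
have NR : 0 < N%:R :> R := NNR n.
have Nz : N%:Z != 0 by rewrite eqz_nat -lt0n.
have n0k : (n0 <= k)%N by apply: leq_trans nk.
have jk : (j <= k)%N by apply: leq_trans (leq_maxl _ _) n0k.
have kB : 4 * B / eps < k%:R.
  apply: lt_le_trans (_ : (Num.truncn (4 * B / eps)).+1%:R <= _); last first.
    by rewrite ler_nat (leq_trans (leq_maxr _ _) n0k).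
  by rewrite truncnS_gt.
have kR : 0 < k%:R :> R by apply: lt_trans kB; rewrite divr_gt0 // mulr_gt0.
have keps : B / k%:R < eps / 4.
  by move: kB; rewrite !ltr_pdivrMr // => H1; lra.
have kN : k%:R <= N%:R :> R by rewrite ler_nat ltnW // ltn_expl.
have wN : w%:R / N%:R <= k%:R^-1 :> R.
  by rewrite ler_pdivrMr // ler_pdivlMl // -natrM ler_nat.
pose t' := Num.floor (t * N%:R).
have [s1 [s2 [s1w s2w cs]]] := Hline `|(t' %% N%:Z)%Z|%N.
pose Z1 : int := (xx n %% N)%N%:Z + t' * a + s1%:Z.
pose Z2 : int := (yy n %% N)%N%:Z + t' * b + s2%:Z.
pose u1 := ((xx n + `|(t' %% N%:Z)%Z| * `|(a %% N%:Z)%Z| + s1) %% N)%N.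
pose u2 := ((yy n + `|(t' %% N%:Z)%Z| * `|(b %% N%:Z)%Z| + s2) %% N)%N.
have mE (c : int) : exists r, (c %% N%:Z)%Z = c - r * N%:Z.
  by exists (c %/ N%:Z)%Z; rewrite {2}(divz_eq c N%:Z); ring.
have cong (c : int) x s : exists r, (x %% N)%N%:Z + t' * c + s%:Z =
    ((x + `|(t' %% N%:Z)%Z| * `|(c %% N%:Z)%Z| + s) %% N)%N%:Z + r * N%:Z.
  rewrite -!modz_nat !PoszD PoszM !gez0_abs ?modz_ge0 //.
  have [r1 ->] := mE c; have [r2 ->] := mE t'; have [r3 ->] := mE x.
  have [r4 ->] := mE (x%:Z + (t' - r2 * N%:Z) * (c - r1 * N%:Z) + s%:Z).
  exists (r4 - r3 + r2 * c + r1 * t' - r1 * r2 * N%:Z); ring.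
exists (Z1%:~R / N%:R, Z2%:~R / N%:R).
  have err x (c : int) (pc : R) (s : nat) : (s <= w)%N -> `|c%:~R| + 1 <= B ->
     `|pc - (x %% N)%:R / N%:R| < eps / 4 ->
     `|pc + t * c%:~R - ((x %% N)%N%:Z + t' * c + s%:Z)%:~R / N%:R| < eps.
    move=> sw cB xp.
    have -> : pc + t * c%:~R - ((x %% N)%N%:Z + t' * c + s%:Z)%:~R / N%:R =
       (pc - (x %% N)%:R / N%:R) + ((t * N%:R - t'%:~R) * c%:~R / N%:R - s%:R / N%:R).
      by rewrite !rmorphD rmorphM /=; field; rewrite gt_eqF.
    apply: le_lt_trans (ler_normD _ _) _.
    have -> : eps = eps / 4 + (eps / 4 + 2 * (eps / 4)) by field.
    apply: ltrD => //; apply: le_lt_trans (ler_normB _ _) _.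
    have fl : `|t * N%:R - t'%:~R| <= 1.
      have := floor_itv (t * N%:R); rewrite -/t' rmorphD /= => /andP[f1 f2].
      by rewrite ger0_norm; lra.
    apply: ltrD.
      apply: le_lt_trans keps; rewrite !normrM normfV (gtr0_norm NR).
      apply: (@le_trans _ _ (B / N%:R)).
        rewrite ler_pM2r ?invr_gt0 //; apply: le_trans (ler_wpM2r _ fl) _ => //.
        by rewrite mul1r; move: cB; lra.
      by rewrite ler_pM2l // lef_pV2 // posrE.
    rewrite ger0_norm ?divr_ge0 ?ler0n //.
    apply: (@le_lt_trans _ _ (k%:R^-1)).
      by apply: le_trans wN; rewrite ler_pM2r ?invr_gt0 // ler_nat.
    have : k%:R^-1 <= B / k%:R.
      rewrite ler_peMl ?invr_ge0 ?ler0n // /B; have := normr_ge0 (a%:~R : R); have := normr_ge0 (b%:~R : R); lra.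
    by move: keps eps0; lra.
  have [Ba Bb] : `|a%:~R| + 1 <= B /\ `|b%:~R| + 1 <= B.
    by rewrite /B; have := normr_ge0 (a%:~R : R); have := normr_ge0 (b%:~R : R); split; lra.
  by case: clpn => c1 c2; split; apply: err.
exists (u1%:R / N%:R, u2%:R / N%:R).
  apply: grid_point_in_cells; rewrite ?ltn_mod //.
  by rewrite (cantor_mod hM).
apply/torus_projP.
have [r1 Er1] := cong a (xx n) s1; have [r2 Er2] := cong b (yy n) s2.
have -> : (Z1%:~R / N%:R, Z2%:~R / N%:R) - (u1%:R / N%:R, u2%:R / N%:R) = (r1%:~R, r2%:~R) :> R * R.
  rewrite /Z1 /Z2 Er1 Er2 -/u1 -/u2 -[LHS]/(_ - _, _ - _) /=.
  by congr (_, _); rewrite rmorphD rmorphM /=; field; rewrite gt_eqF.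
exact: int_lattice.
Qed.

End LinesInTorus.

(** * Discretisation of lines of the torus *)

Section TorusLineToGrid.

Variable R : realType.
Variables (M : nat) (hM : (2 <= M)%N).
Local Open Scope classical_set_scope.

Lemma floor_close (x y : R) : `|x - y| < 1 -> (`|(Num.floor x - Num.floor y)%R| <= 1)%N.
Proof.
rewrite ltr_norml => /andP[h1 h2].
have /andP[x1 x2] := floor_itv x; have /andP[y1 y2] := floor_itv y.
move: x1 x2 y1 y2; rewrite !rmorphD /=; set m := Num.floor x; set n := Num.floor y => x1 x2 y1 y2.
have : m - n < 2 by rewrite -(ltr_int R) rmorphB /=; lra.
have : -2 < m - n by rewrite -(ltr_int R) rmorphB rmorphN /=; lra.
lia.
Qed.

(** Passing to the closure costs at most one unit of the grid in each coordinate. *)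
Lemma grid_point_near (E : {set 'I_M * 'I_M}) k (y : R * R) : cantor_level E k (torus_proj y) ->
  exists (u : 'I_(M ^ k) * 'I_(M ^ k)) (e : int * int),
  [/\ u \in cantor_iterate E k, (`|e.1| <= 1)%N /\ (`|e.2| <= 1)%N,
      ((M ^ k)%N%:Z %| Num.floor ((M ^ k)%:R * y.1) - e.1 - u.1%:Z)%Z &
      ((M ^ k)%N%:Z %| Num.floor ((M ^ k)%:R * y.2) - e.2 - u.2%:Z)%Z].
Proof.
set N := (M ^ k)%N; have N0 : (0 < N)%N by apply: Mk_gt0.
have NR : 0 < N%:R :> R by rewrite ltr0n.
move=> clos; have eps0 : 0 < N%:R^-1 :> R by rewrite invr_gt0.
have oU : open (ball y (N%:R^-1 : R)) by apply: ball_open.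
have nU : nbhs (torus_proj y) (@torus_proj R @` ball y (N%:R^-1 : R)).
  apply: open_nbhs_nbhs; split; first exact: torus_proj_open.
  by exists y => //; apply: ballxx.
have [_ [[g [g1 g2 [u uE [fl1 fl2]]] <-] [z [z1 z2] /torus_projP /andP[/= zg1 zg2]]]] := clos _ nU.
have key (yi zi gi : R) (ui : nat) : ball yi (N%:R^-1) zi -> zi - gi \is a Num.int ->
    Num.floor (N%:R * gi) = ui%:Z ->
    exists2 e : int, (`|e| <= 1)%N & (N%:Z %| Num.floor (N%:R * yi) - e - ui%:Z)%Z.
  move=> yz /intrP [n En] fl.
  exists (Num.floor (N%:R * yi) - Num.floor (N%:R * zi)).
    apply: floor_close; rewrite -mulrBr normrM gtr0_norm // mulrC -ltr_pdivlMr // mul1r.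
    exact: yz.
  have -> : N%:R * zi = N%:R * gi + (N%:Z * n)%:~R.
    by rewrite intrM -En mulrBr -pmulrn; ring.
  rewrite floorDrz ?intr_int // intrKfloor fl; apply/dvdzP; exists n; ring.
have [e1 e1l e1d] := key y.1 z.1 g.1 u.1 z1 zg1 fl1.
have [e2 e2l e2d] := key y.2 z.2 g.2 u.2 z2 zg2 fl2.
by exists u, (e1, e2).
Qed.

(** The pigeonhole principle for the fractional parts of the multiples of [alpha]. *)
Lemma dirichlet (alpha : R) K : (0 < K)%N -> exists (q : nat) (p : int),
  (0 < q)%N /\ `|q%:R * alpha - p%:~R| < K%:R^-1.
Proof.
move=> K0; have KR : 0 < K%:R :> R by rewrite ltr0n.
pose fr (i : nat) : R := i%:R * alpha - (Num.floor (i%:R * alpha))%:~R.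
have fr01 i : 0 <= fr i < 1.
  have := floor_itv (i%:R * alpha : R); rewrite rmorphD /= /fr => /andP[? ?].
  by apply/andP; split; lra.
have box i : exists o : 'I_K, o%:R <= K%:R * fr i < o%:R + 1.
  have /andP[f0 f1] := fr01 i.
  have f0' : 0 <= K%:R * fr i by rewrite mulr_ge0 // ltW.
  have /andP[t1 t2] := truncn_itv f0'.
  have tK : (Num.truncn (K%:R * fr i) < K)%N.
    by rewrite -(ltr_nat R) (le_lt_trans t1) // gtr_pMr.
  by exists (Ordinal tK); rewrite t1 -(natrD _ _ 1) addn1.
have [F HF] := choice box.
have : ~~ injectiveb (fun i : 'I_K.+1 => F i).
  apply/negP => /injectiveP inj; have := leq_card _ inj.
  by rewrite !card_ord ltnn.
case/injectivePn => i [j ij Fij].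
wlog lt : i j ij Fij / (i < j)%N.
  move=> H; case: (ltngtP i j) => [|ji|/val_inj e]; first exact: H.
    by apply: (H j i) => //; rewrite eq_sym.
  by rewrite e eqxx in ij.
exists (j - i)%N, (Num.floor (j%:R * alpha) - Num.floor (i%:R * alpha)); split.
  by rewrite subn_gt0.
have -> : (j - i)%:R * alpha - (Num.floor (j%:R * alpha) - Num.floor (i%:R * alpha))%:~R = fr j - fr i.
  rewrite /fr; move: (Num.floor _) (Num.floor _) => fj fi.
  by rewrite natrB ?[(i <= j)%N]ltnW // intrB; move: (j%:R : R) (i%:R : R) (fj%:~R : R) (fi%:~R : R) => u v w z; ring.
rewrite -(ltr_pM2l KR) divff ?gt_eqF // -{1}(gtr0_norm KR) -normrM mulrBr.
have := HF i; have := HF j; rewrite -Fij => /andP[j1 j2] /andP[i1 i2].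
by rewrite ltr_norml; apply/andP; split; lra.
Qed.

(** The multiples of a small nonzero [q alpha - p] come close to every real number. *)
Lemma irrational_line_dense (alpha beta eps : R) : 0 < eps ->
  (forall (q : nat) (p : int), (0 < q)%N -> q%:R * alpha != p%:~R) ->
  exists n m : int, `|beta + n%:~R * alpha - m%:~R| < eps.
Proof.
move=> eps0 irr.
pose K := (Num.truncn eps^-1).+1.
have KR : 0 < K%:R :> R by rewrite ltr0n.
have Keps : K%:R^-1 < eps.
  by rewrite -[ltRHS]invrK ltf_pV2 ?posrE ?invr_gt0 // truncnS_gt.
have [q [p [q0 qp]]] := @dirichlet alpha K isT.
set d := q%:R * alpha - p%:~R in qp.
have d0 : d != 0 by rewrite subr_eq0 irr.
pose m := Num.floor (- beta / d).
exists (m * q%:Z), (m * p).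
have -> : beta + (m * q%:Z)%:~R * alpha - (m * p)%:~R = d * (m%:~R - (- beta / d)).
  rewrite !intrM -pmulrn mulrBr [d * (_ / d)]mulrC divfK // /d.
  by move: (m%:~R : R) (q%:R : R) (p%:~R : R) => u w z; ring.
rewrite normrM; apply: le_lt_trans (lt_trans qp Keps).
rewrite ler_piMr //; have := floor_itv (- beta / d); rewrite -/m rmorphD /= => /andP[m1 m2].
by rewrite ler_norml; apply/andP; split; lra.
Qed.

(** Near the centre of a cell of level 1 the leading digit resists the rounding error of
    [grid_point_near].  Level 4 is deep enough because [M ^ 3 >= 8]. *)
Lemma top_digit_near (d1 d2 : 'I_M) (E : {set 'I_M * 'I_M}) (y : R * R) (m1 m2 : int) :
  `|y.1 - (d1%:R + 2^-1) / M%:R - m1%:~R| < (4 * M%:R)^-1 ->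
  `|y.2 - (d2%:R + 2^-1) / M%:R - m2%:~R| < (4 * M%:R)^-1 ->
  cantor_level E 4 (torus_proj y) -> (d1, d2) \in E.
Proof.
move=> y1 y2 /grid_point_near [u [[e1 e2] [uE [/= e1l e2l] u1 u2]]].
have M3 : (8 <= M ^ 3)%N by rewrite (@leq_exp2r 2 M 3).
have MR : 0 < M%:R :> R by rewrite ltr0n M_gt0.
have key (yi : R) (di : 'I_M) (mi ei : int) (ui : nat) : (ui < M ^ 4)%N -> (`|ei| <= 1)%N ->
    `|yi - (di%:R + 2^-1) / M%:R - mi%:~R| < (4 * M%:R)^-1 ->
    ((M ^ 4)%N%:Z %| Num.floor ((M ^ 4)%:R * yi) - ei - ui%:Z)%Z -> digit M 3 ui = di.
  move=> ui4 eil yil udiv.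
  have [C EC] : exists C, C = (M ^ 3)%N by eexists.
  rewrite -EC in M3.
  have C8 : 8 <= C%:R :> R by rewrite (ler_nat R 8).
  have E4 : (M ^ 4)%N = (M * C)%N by rewrite EC -expnS.
  rewrite E4 in udiv ui4.
  set fl := Num.floor _ in udiv.
  have bnd : C%:Z * di%:Z + 1 <= fl - (M * C)%N%:Z * mi /\ fl - (M * C)%N%:Z * mi + 2 <= C%:Z * (di%:Z + 1).
    have := floor_itv ((M * C)%:R * yi : R); rewrite -/fl rmorphD /= => /andP[f1 f2].
    rewrite natrM in f1 f2.
    have Ey : M%:R * C%:R * yi = C%:R * di%:R + C%:R / 2 + (M%:R * C%:R) * mi%:~R +
        (yi - (di%:R + 2^-1) / M%:R - mi%:~R) * (M%:R * C%:R) :> R.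
      by field; rewrite gt_eqF.
    set err := (yi - _ - _) * _ in Ey.
    have errl : `|err| < C%:R / 4.
      rewrite /err normrM [`|M%:R * _|]gtr0_norm ?mulr_gt0 //; last by lra.
      have -> : C%:R / 4 = (4 * M%:R)^-1 * (M%:R * C%:R) :> R.
        by field; rewrite gt_eqF.
      by rewrite ltr_pM2r // mulr_gt0 //; lra.
    move: errl; rewrite ltr_norml => /andP[l1 l2].
    split.
      rewrite -(ler_int R) !(rmorphD, rmorphB, rmorphM, rmorphN) /= -!pmulrn ?natrM; lra.
    rewrite -(ler_int R) !(rmorphD, rmorphB, rmorphM, rmorphN) /= -!pmulrn ?natrM; lra.
  have [r Er] := dvdzP udiv.
  have C0 : (0 < C)%N by apply: leq_trans M3.
  have diM := ltn_ord di.
  have lo : C%:Z * di%:Z <= ui%:Z + (r - mi) * (M * C)%N%:Z < C%:Z * (di%:Z + 1).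
    move: bnd Er eil.
    have -> : ui%:Z + (r - mi) * (M * C)%N%:Z = (r * (M * C)%N%:Z) + ui%:Z - (M * C)%N%:Z * mi by ring.
    by move=> [b1 b2] <- e3; lia.
  have r0 : r - mi = 0.
    have dC : (C * di.+1 <= M * C)%N by rewrite mulnC leq_mul2r diM orbT.
    move: lo; have -> : di%:Z + 1 = di.+1%:Z by rewrite -addn1 PoszD.
    rewrite -!PoszM => /andP[]; move: dC ui4; set MC := (M * C)%N.
    set w := r - mi; set v := (C * di.+1)%N => vMC uMC lo hi.
    case: (ltrgtP w 0) => [wn|wp|//]; exfalso.
      have : w * MC%:Z <= -1 * MC%:Z by rewrite ler_wpM2r //; move: wn; lia.
      by move: lo uMC; lia.
    have : 1 * MC%:Z <= w * MC%:Z by rewrite ler_wpM2r //; move: wp; lia.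
    by move: hi vMC; lia.
  move: lo; rewrite r0 mul0r addr0 => /andP[lo1 lo2].
  rewrite /digit -EC; suff -> : (ui %/ C)%N = di by rewrite modn_small.
  have {}lo2 : (ui < di.+1 * C)%N by rewrite mulnC -ltz_nat PoszM -addn1 PoszD.
  have {}lo1 : (di * C <= ui)%N by rewrite mulnC -lez_nat PoszM.
  by apply/eqP; rewrite eqn_leq -ltnS ltn_divLR // leq_divRL // lo1 lo2.
move: uE; rewrite (mem_cantor_iterate hM) => /cantorP /(_ 3 isT).
rewrite (key y.1 d1 m1 e1 u.1) // (key y.2 d2 m2 e2 u.2) //.
by rewrite -(in_alphabetE E (d1, d2)).
Qed.

End TorusLineToGrid.

Section LinesObstruct.

Variable R : realType.
Variables (M : nat) (hM : (2 <= M)%N).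
Local Open Scope classical_set_scope.

(** A line of irrational slope is dense, and would enter the cell of a missing digit. *)
Lemma torus_line_slope (E : {set 'I_M * 'I_M}) (v : R * R) (p : torus R) :
  (exists d, d \notin E) -> v <> 0 -> torus_line v p `<=` limit_cantor_set E ->
  exists (a b : int) (s : R), [/\ coprimez a b, s != 0 & v = (s * a%:~R, s * b%:~R)].
Proof.
move=> [[d1 d2] dE] v0 line.
have [v10|v10] := eqVneq v.1 0.
  exists 0, 1, v.2; split=> //; last by rewrite mulr0 mulr1 [LHS]surjective_pairing v10.
  by apply/eqP => v20; apply: v0; rewrite [LHS]surjective_pairing v10 v20.
pose alpha := v.2 / v.1.
case: (pselect (exists (q : nat) (r : int), (0 < q)%N /\ q%:R * alpha = r%:~R)) => [[q [r [q0 Er]]]|irr].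
  have qz : q%:Z != 0 by rewrite eqz_nat -lt0n.
  pose g := gcdz q%:Z r.
  have g0 : g != 0 by rewrite gcdz_eq0 (negPf qz).
  have gR : g%:~R != 0 :> R by rewrite intr_eq0.
  have qR : q%:R != 0 :> R by rewrite pnatr_eq0 -lt0n.
  have Eq : q%:Z = (q%:Z %/ g)%Z * g by rewrite divzK ?dvdz_gcdl.
  have Er' : r = (r %/ g)%Z * g by rewrite divzK ?dvdz_gcdr.
  have EqR : q%:R = (q%:Z %/ g)%Z%:~R * g%:~R :> R by rewrite -intrM -Eq -pmulrn.
  have ErR : r%:~R = (r %/ g)%Z%:~R * g%:~R :> R by rewrite -intrM -Er'.
  exists (q%:Z %/ g)%Z, (r %/ g)%Z, (v.1 / q%:R * g%:~R); split.
  - have g0' : `|g|%N%:Z != 0 by rewrite eqz_nat absz_eq0.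
    apply/eqP; apply: (mulIf g0'); rewrite mulz_gcdl -Eq -Er' mul1r.
    by [].
  - by rewrite !mulf_neq0 // invr_neq0.
  - rewrite [LHS]surjective_pairing -!mulrA ![g%:~R * _]mulrC -EqR -ErR -Er /alpha.
    by congr (_, _); field; rewrite ?qR ?v10.
case/negP: dE.
have MR : 0 < M%:R :> R by rewrite ltr0n M_gt0.
have [p0 Ep] := torus_proj_surj p.
pose t0 := (d1%:R + 2^-1) / M%:R - p0.1.
have eps0 : 0 < (4 * M%:R)^-1 :> R by rewrite invr_gt0 mulr_gt0.
have [|n [m nm]] := @irrational_line_dense R alpha (p0.2 + t0 * alpha - (d2%:R + 2^-1) / M%:R) _ eps0.
  by move=> q r q0; apply/eqP => Er; apply: irr; exists q, r.
pose t := (t0 + n%:~R) / v.1.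
apply: (@top_digit_near R M hM d1 d2 E (t * v.1 + p0.1, t * v.2 + p0.2) n m) => /=.
- rewrite /t divfK // /t0; set u := _ / _.
  by rewrite (_ : _ - _ - _ = 0) ?normr0 //; ring.
- move: nm; congr (`|_| < _).
  by rewrite /t /alpha; move: (_ / M%:R) (n%:~R : R) (m%:~R : R) => u w z; field.
have := line _ (ex_intro2 _ _ t I erefl) 4%N isT.
by rewrite Ep -torus_projD.
Qed.

(** Increasing the parameter by [1 / (M ^ k s)] moves the grid coordinates by exactly [(a, b)]. *)
Lemma torus_line_grid (E : {set 'I_M * 'I_M}) (a b : int) (s : R) (p : torus R) k :
  (0 < k)%N -> s != 0 -> torus_line (s * a%:~R, s * b%:~R) p `<=` limit_cantor_set E ->
  exists x y : int, forall t : int, exists (u : 'I_(M ^ k) * 'I_(M ^ k)) (e : int * int),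
  [/\ u \in cantor_iterate E k, (`|e.1| <= 1)%N /\ (`|e.2| <= 1)%N,
      ((M ^ k)%N%:Z %| x + t * a - e.1 - u.1%:Z)%Z &
      ((M ^ k)%N%:Z %| y + t * b - e.2 - u.2%:Z)%Z].
Proof.
move=> k0 s0 line; have [p0 Ep] := torus_proj_surj p.
set N := (M ^ k)%N; have N0 : (0 < N)%N by apply: Mk_gt0.
have NR : N%:R != 0 :> R by rewrite pnatr_eq0 -lt0n.
exists (Num.floor (N%:R * p0.1)), (Num.floor (N%:R * p0.2)) => t.
pose tau : R := t%:~R / (N%:R * s).
have := line (torus_proj (tau * (s * a%:~R), tau * (s * b%:~R)) + p) (ex_intro2 _ _ tau I erefl) k k0.
rewrite Ep -torus_projD => /(grid_point_near hM) [u [e [uE el u1 u2]]].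
exists u, e; split=> //.
  move: u1 => /=; rewrite -/N; have -> : N%:R * (tau * (s * a%:~R) + p0.1) = N%:R * p0.1 + (t * a)%:~R.
    by rewrite intrM /tau; move: (t%:~R : R) (a%:~R : R) => u3 u4; field; rewrite NR s0.
  by rewrite floorDrz ?intr_int // intrKfloor.
move: u2 => /=; rewrite -/N; have -> : N%:R * (tau * (s * b%:~R) + p0.2) = N%:R * p0.2 + (t * b)%:~R.
  by rewrite intrM /tau; move: (t%:~R : R) (b%:~R : R) => u3 u4; field; rewrite NR s0.
by rewrite floorDrz ?intr_int // intrKfloor.
Qed.

Lemma pigeonhole_fiber (T U : finType) (f : T -> U) : (0 < #|T|)%N ->
  exists o, (#|T| <= #|U| * #|[set t | f t == o]%SET|)%N.
Proof.
case/card_gt0P => t0 _.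
pose o := [arg max_(o > f t0) #|[set t | f t == o]%SET|]%N; exists o.
rewrite -[leqRHS]sum_nat_const -[leqLHS]sum1_card (partition_big f (mem U)) //=.
apply: leq_sum => i _; rewrite sum1dep_card.
rewrite /o; case: arg_maxnP => // j _ /(_ i isT); exact.
Qed.

(** There are nine possible rounding errors; fixing the most frequent one leaves points of
    an exact progression. *)
Lemma grid_line_sample (E : {set 'I_M * 'I_M}) (a b : int) k : coprimez a b ->
  (exists x y : int, forall t : int, exists (u : 'I_(M ^ k) * 'I_(M ^ k)) (e : int * int),
  [/\ u \in cantor_iterate E k, (`|e.1| <= 1)%N /\ (`|e.2| <= 1)%N,
      ((M ^ k)%N%:Z %| x + t * a - e.1 - u.1%:Z)%Z &
      ((M ^ k)%N%:Z %| y + t * b - e.2 - u.2%:Z)%Z]) ->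
  exists P : {set 'I_(M ^ k) * 'I_(M ^ k)},
  [/\ (M ^ k <= 9 * #|P|)%N, {subset P <= cantor_iterate E k} &
      exists x y : int, forall u, u \in P -> exists t : int,
       ((M ^ k)%N%:Z %| x + t * a - u.1%:Z)%Z /\ ((M ^ k)%N%:Z %| y + t * b - u.2%:Z)%Z].
Proof.
set N := (M ^ k)%N => cab [x [y H]]; have N0 : (0 < N)%N by apply: Mk_gt0.
have lt3 (e : int) : (`|e| <= 1)%N -> (`|(e + 1)%R| < 3)%N by lia.
have H' (t : 'I_N) : exists uo : ('I_N * 'I_N) * ('I_3 * 'I_3),
  [/\ uo.1 \in cantor_iterate E k, 
      (N%:Z %| x + t%:Z * a - (uo.2.1%:Z - 1) - uo.1.1%:Z)%Z &
      (N%:Z %| y + t%:Z * b - (uo.2.2%:Z - 1) - uo.1.2%:Z)%Z].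
  have [u [[e1 e2] [uE [/= /[dup] l1 /lt3 e13 /[dup] l2 /lt3 e23] d1 d2]]] := H t%:Z.
  exists (u, (Ordinal e13, Ordinal e23)); split=> //=.
    by have -> : `|(e1 + 1)%R|%N%:Z - 1 = e1 by move: l1; lia.
  by have -> : `|(e2 + 1)%R|%N%:Z - 1 = e2 by move: l2; lia.
have [F HF] := choice H'.
have [|o] := @pigeonhole_fiber 'I_N _ (fun t => (F t).2); first by rewrite card_ord.
rewrite card_ord card_prod !card_ord => cardo.
set T := [set t | _]%SET in cardo.
have Fo t : t \in T -> (F t).2 = o by rewrite inE => /eqP.
exists [set (F t).1 | t in T]%SET; split.
- rewrite card_in_imset // => t t' tT t'T Ftt.
  have [_ d1 d2] := HF t; have [_ d1' d2'] := HF t'.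
  rewrite (Fo t tT) Ftt in d1 d2; rewrite (Fo t' t'T) in d1' d2'.
  have {}d1 : (N%:Z %| (t%:Z - t'%:Z) * a)%Z.
    by move: (rpredB d1 d1'); congr (_ %| _)%Z; ring.
  have {}d2 : (N%:Z %| (t%:Z - t'%:Z) * b)%Z.
    by move: (rpredB d2 d2'); congr (_ %| _)%Z; ring.
  have [[u v] /= uv] := coprimezP _ _ cab.
  have : (N%:Z %| t%:Z - t'%:Z)%Z.
    have -> : t%:Z - t'%:Z = u * ((t%:Z - t'%:Z) * a) + v * ((t%:Z - t'%:Z) * b).
      by rewrite -[LHS]mulr1 -uv; ring.
    exact: (rpredD (dvdz_mull u d1) (dvdz_mull v d2)).
  rewrite -eqz_mod_dvd !modz_nat !modn_small // => /eqP [tt'].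
  exact: val_inj.
- by move=> u /imsetP [t _ ->]; have [] := HF t.
exists (x - (o.1%:Z - 1)), (y - (o.2%:Z - 1)) => u /imsetP [t tT ->].
have [_] := HF t; rewrite (Fo t tT) => d1 d2; exists t%:Z.
by split; [move: d1|move: d2]; congr (_ %| _)%Z; ring.
Qed.

(** Progressions with orthogonal directions give phases that factorise, hence a rank-one
    submatrix with sides at least [M ^ k / 9]. *)
Lemma orthogonal_lines_obstruct (A B : {set 'I_M * 'I_M}) (v : R * R) (p q : torus R) k (c : R) :
  (exists d, d \notin A) -> v <> 0 ->
  torus_line v p `<=` limit_cantor_set A -> torus_line (perp v) q `<=` limit_cantor_set B ->
  (0 < k)%N -> 0 <= c -> fourier_bound A B k c -> 1 <= 81 * c.
Proof.
move=> dA v0 lA lB k0 c0 bk; set N := (M ^ k)%N.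
have [a [b [s [cab s0 Ev]]]] := torus_line_slope dA v0 lA.
have cba : coprimez (- b) a by rewrite coprimeNz coprimez_sym.
have lB' : torus_line (s * (- b)%:~R, s * a%:~R) q `<=` limit_cantor_set B.
  by move: lB; rewrite Ev /perp /= rmorphN /= mulrN.
rewrite Ev in lA.
have [P [cP PA [x [y HP]]]] := grid_line_sample cab (torus_line_grid k0 s0 lA).
have [Q [cQ QB [z [w HQ]]]] := grid_line_sample cba (torus_line_grid k0 s0 lB').
have NR : 0 < N%:R :> R by rewrite ltr0n Mk_gt0.
have le1 : #|P|%:R * #|Q|%:R <= c * N%:R ^+ 2.
  apply: (rank_one_bound hM) => // u u' xi xi' uP u'P xiQ xi'Q.
  have [t [t1 t2]] := HP _ uP; have [t' [t1' t2']] := HP _ u'P.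
  have [r [r1 r2]] := HQ _ xiQ; have [r' [r1' r2']] := HQ _ xi'Q.
  apply/eqP; rewrite -eqz_nat -!modz_nat eqz_mod_dvd !PoszD !PoszM.
  (* the two differences are multiples of orthogonal vectors *)
  have U1 : (N%:Z %| (t - t') * a - (u.1%:Z - u'.1%:Z))%Z.
    by move: (rpredB t1 t1'); congr (_ %| _)%Z; ring.
  have U2 : (N%:Z %| (t - t') * b - (u.2%:Z - u'.2%:Z))%Z.
    by move: (rpredB t2 t2'); congr (_ %| _)%Z; ring.
  have X1 : (N%:Z %| (r - r') * (- b) - (xi.1%:Z - xi'.1%:Z))%Z.
    by move: (rpredB r1 r1'); congr (_ %| _)%Z; ring.
  have X2 : (N%:Z %| (r - r') * a - (xi.2%:Z - xi'.2%:Z))%Z.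
    by move: (rpredB r2 r2'); congr (_ %| _)%Z; ring.
  have [h1 E1] := dvdzP U1; have [h2 E2] := dvdzP U2.
  have [h3 E3] := dvdzP X1; have [h4 E4] := dvdzP X2.
  apply/dvdzP; exists (- ((xi.1%:Z - xi'.1%:Z) * h1 + (xi.2%:Z - xi'.2%:Z) * h2
     + (t - t') * a * h3 + (t - t') * b * h4)).
  rewrite mulNr !mulrDl -!mulrA -E1 -E2 -E3 -E4; ring.
have le2 : N%:R ^+ 2 <= 81 * (#|P|%:R * #|Q|%:R) :> R.
  have -> : 81 * (#|P|%:R * #|Q|%:R) = ((9 * #|P|) * (9 * #|Q|))%N%:R :> R by rewrite !natrM; ring.
  by rewrite -natrX ler_nat expnS expn1 leq_mul.
have N2 : 0 < N%:R ^+ 2 :> R by rewrite exprn_gt0.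
rewrite -(ler_pM2r N2) mul1r -mulrA; apply: le_trans le2 _.
by rewrite ler_pM2l // ltr0n.
Qed.

End LinesObstruct.

(** * Sufficiency *)

Section Characterisation.

Variable R : realType.
Variables (M : nat) (hM : (2 <= M)%N) (A B : {set 'I_M * 'I_M}).

Lemma missing_digit (E : {set 'I_M * 'I_M}) : alphabet E -> exists d, d \notin E.
Proof. by case=> _ /properP [_ [d _ dE]]; exists d. Qed.

Lemma alphabet_card_gt0 (E : {set 'I_M * 'I_M}) : alphabet E -> (0 < #|E|)%N.
Proof. by case=> E0 _; rewrite card_gt0. Qed.

Lemma card_alphabet (E : {set 'I_M * 'I_M}) : alphabet E ->
  #|E|%:R = M%:R `^ (alphabet_dim R E).
Proof.
move=> /alphabet_card_gt0 E0; have M1 : 1 < M%:R :> R by rewrite ltr1n.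
rewrite /powR /alphabet_dim gt_eqF ?(lt_trans ltr01) // divfK ?lnK ?posrE ?ltr0n //.
by rewrite gt_eqF // ln_gt0.
Qed.

Lemma card_alphabet_lt (E : {set 'I_M * 'I_M}) : alphabet E -> (#|E| <= M ^ 2 - 1)%N.
Proof.
case=> _ /proper_card; rewrite cardsT card_prod card_ord expnS expn1.
by case: (M * M)%N => // n; rewrite subn1.
Qed.

(** Points differing only in their lowest digit realise the given inner product, which
    stays nonzero modulo [M ^ 3] because its absolute value is less than [M ^ 3]. *)
Lemma gap_of_inner_product (j j' kk kk' : 'I_M * 'I_M) :
  j \in A -> j' \in A -> kk \in B -> kk' \in B ->
  int_inner (digit_vec j - digit_vec j') (digit_vec kk - digit_vec kk') <> 0 ->
  exists c : R, [/\ 0 <= c, c < (#|A| ^ 3)%:R * (#|B| ^ 3)%:R / (M ^ 3)%:R ^+ 2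
    & fourier_bound A B 3 c].
Proof.
move=> jA j'A kB k'B ne.
pose lift3 (p q : 'I_M) : nat := (p + M * (q + M * q))%N.
have lt3 (p q : 'I_M) : (lift3 p q < M ^ 3)%N.
  have := ltn_ord p; have := ltn_ord q; rewrite /lift3 => hq hp.
  have h1 : (q + M * q < M * M)%N.
    by apply: (@leq_trans (M + M * q)); rewrite ?ltn_add2r // -mulnS leq_mul.
  rewrite 2!expnS expn1; apply: (@leq_trans (M + M * (q + M * q))); first by rewrite ltn_add2r.
  by rewrite -mulnS leq_mul.
pose pt (p q : 'I_M * 'I_M) : 'I_(M ^ 3) * 'I_(M ^ 3) :=
  (Ordinal (lt3 p.1 q.1), Ordinal (lt3 p.2 q.2)).
have ptE (E : {set 'I_M * 'I_M}) p q : p \in E -> q \in E -> pt p q \in cantor_iterate E 3.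
  move=> pE qE; rewrite (mem_cantor_iterate hM) /= /lift3.
  have c1 (r : 'I_M * 'I_M) : r \in E -> cantor E 1 r.1 r.2 by rewrite cantor1 // in_alphabetE.
  have step l a b c d : (a < M)%N -> (b < M)%N ->
      cantor E l.+1 (a + M * c) (b + M * d) = cantor E 1 a b && cantor E l c d.
    by move=> aM bM; have := @cantor_addM M hM E 1 l a b c d; rewrite expn1 add1n => ->.
  by rewrite !step // !c1.
rewrite -!(card_cantor hM).
apply: (gap_of_independent_phases hM (ptE A _ _ jA jA) (ptE A _ _ j'A jA) (ptE B _ _ kB kB)
   (ptE B _ _ k'B kB)).
rewrite -!exprD; set z := root_of_unity R _.
have zp := root_of_unity_prim R (Mk_gt0 hM 3).
rewrite (eq_prim_root_expr zp) -eqz_nat -!modz_nat eqz_mod_dvd /= /lift3.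
set I := int_inner _ _ in ne.
have -> : ((j.1 + M * (j.1 + M * j.1)) * (kk.1 + M * (kk.1 + M * kk.1)) +
    (j.2 + M * (j.2 + M * j.2)) * (kk.2 + M * (kk.2 + M * kk.2)) +
    ((j'.1 + M * (j.1 + M * j.1)) * (kk'.1 + M * (kk.1 + M * kk.1)) +
    (j'.2 + M * (j.2 + M * j.2)) * (kk'.2 + M * (kk.2 + M * kk.2))))%N%:Z -
   ((j.1 + M * (j.1 + M * j.1)) * (kk'.1 + M * (kk.1 + M * kk.1)) +
    (j.2 + M * (j.2 + M * j.2)) * (kk'.2 + M * (kk.2 + M * kk.2)) +
    ((j'.1 + M * (j.1 + M * j.1)) * (kk.1 + M * (kk.1 + M * kk.1)) +
    (j'.2 + M * (j.2 + M * j.2)) * (kk.2 + M * (kk.2 + M * kk.2))))%N%:Z = I.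
  by rewrite /I /int_inner /digit_vec /=; ring.
have bound : (`|I| < M ^ 3)%N.
  have b (p q : 'I_M) : (`|(p%:Z - q%:Z)%R| <= M.-1)%N.
    by have := ltn_ord p; have := ltn_ord q; lia.
  have b2 (p q r s : 'I_M) : (`|((p%:Z - q%:Z) * (r%:Z - s%:Z))%R| <= M.-1 * M.-1)%N.
    by rewrite abszM leq_mul.
  have := b2 j.1 j'.1 kk.1 kk'.1; have := b2 j.2 j'.2 kk.2 kk'.2.
  rewrite /I /int_inner /digit_vec /=; set u := _ * _; set v := _ * _ => h1 h2.
  apply: (@leq_ltn_trans (2 * (M.-1 * M.-1))); first by lia.
  rewrite 2!expnS expn1; case: (M) hM => // n; rewrite ltnS /= => n0.
  apply: (@leq_ltn_trans (n.+1 * (n * n))); first by rewrite leq_mul2r ltnS n0 orbT.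
  by rewrite ltn_pmul2l // ltn_mul.
apply/negP => /dvdzP [r Er]; apply: ne; rewrite Er; move: bound; rewrite Er abszM.
case: (eqVneq r 0) => [->|r0]; first by rewrite mul0r.
by rewrite ltnNge leq_pmull // absz_gt0.
Qed.

Local Open Scope classical_set_scope.

(** The directions provided by [extremizer_lines] are bounded independently of the scale,
    so that one of them occurs at infinitely many scales. *)
Lemma lines_of_extremizers : alphabet A -> alphabet B ->
  (forall k, (0 < k)%N -> ~ exists c : R, [/\ 0 <= c, c < 1 & fourier_bound A B k c]) ->
  exists (v : R * R) (p q : torus R),
    [/\ v <> 0, torus_line v p `<=` limit_cantor_set A
      & torus_line (perp v) q `<=` limit_cantor_set B].
Proof.
move=> hA hB no_gap.
pose P (q : nat) (a b : int) : Prop := exists m kappa, let k := (8 * q)%N in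
  [/\ coprimez a b, (k * (2 * m) <= M ^ k)%N, near_line A k (2 * m) a b
    & (M ^ k.-1 < 2 * #|line_points B k a b kappa|)%N].
have HP q : (scale0 M <= q)%N ->
    exists a b : int, [/\ (`|a| <= 2 * M)%N, (`|b| <= 2 * M)%N & P q a b].
  move=> qq; set k := (8 * q)%N.
  have q0 : (0 < q)%N by apply: leq_trans qq; rewrite /scale0 addn2.
  have k0 : (0 < k)%N by rewrite muln_gt0.
  have [f f_ext f_neq0] : exists2 f : 'I_(M ^ k) * 'I_(M ^ k) -> R[i],
      forall xi : 'I_(M ^ k) * 'I_(M ^ k), ~~ cantor B k xi.1 xi.2 ->
         \sum_(x : 'I_(M ^ k) * 'I_(M ^ k) | cantor A k x.1 x.2)
         f x * root_of_unity R (M ^ k) ^+ (x.1 * xi.1 + x.2 * xi.2) = 0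
      & exists2 x : 'I_(M ^ k) * 'I_(M ^ k), cantor A k x.1 x.2 & f x != 0.
    apply: contrapT => none; apply: (no_gap k k0).
    apply: (gap_of_no_extremizer hM) => f fB x Ax; apply: contrapT => /eqP fx.
    by apply: none; exists f => //; exists x.
  have ex_m : exists m, (#|cantor_iterate B k| < m.+1 * m.+1)%N.
    by exists #|cantor_iterate B k|; rewrite mulSn addSn ltnS leq_addr.
  (* the least degree at which a curve through the iterate of [B] exists by counting *)
  have [m Bm m_min] := ex_minnP ex_m.
  have mm : (m * m <= (M ^ 2 - 1) ^ k)%N.
    apply: (@leq_trans #|cantor_iterate B k|).
      case: m Bm m_min => // m Bm m_min; rewrite leqNgt; apply/negP => /m_min.
      by rewrite ltnn.
    by rewrite (card_cantor hM) leq_exp2r // card_alphabet_lt.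
  have [mD primes] := enough_primes hM qq mm; rewrite -/k in mD primes.
  have D_le : (M ^ k.-1 <= M ^ k)%N by rewrite leq_pexp2l ?leq_pred // ltnW.
  have k3 : (k <= k ^ 3)%N by rewrite -{1}[k]expn1 leq_pexp2l.
  have k8 : (8 <= k)%N by rewrite leq_pmulr.
  have m8 : (8 * m <= M ^ k.-1)%N.
    by apply: leq_trans mD; rewrite leq_mul2r; apply/orP; right; lia.
  have [a [b [kappa [cab [aD bD] lA lB]]]] :=
    extremizer_lines hM k0 f_ext f_neq0 (missing_digit hA) m8 Bm primes.
  have small (c : int) : (`|c| * M ^ k.-1 <= 2 * M ^ k)%N -> (`|c| <= 2 * M)%N.
    by rewrite -{2}(prednK k0) expnS mulnA leq_pmul2r // Mk_gt0.
  exists a, b; split; rewrite ?small //; exists m, kappa; split=> //.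
  apply: leq_trans D_le; apply: leq_trans mD; rewrite mulnA leq_mul2r; apply/orP; right.
  by rewrite -/k; lia.
have [a [b Hab]] := infinite_pigeonhole HP.
have [q0 _ [m0 [kappa0 [cab _ _ _]]]] := Hab 0%N.
have [p Ap] : exists p : torus R, torus_line (a%:~R, b%:~R) p `<=` limit_cantor_set A.
  apply: (near_lines_torus_line R hM) => n; have [q nq [m [kappa [_ kw lA _]]]] := Hab n.
  by exists (8 * q)%N, (2 * m)%N; split=> //; apply: leq_trans nq _; rewrite leq_pmull.
have full := @full_counts M hM B a b _.
have [q Bq] : exists q : torus R, torus_line ((- b)%:~R, a%:~R) q `<=` limit_cantor_set B.
  apply: (near_lines_torus_line R hM) => n; exists n.+1, 0%N; split=> //.
    by rewrite muln0.
  apply: (near_line_of_full_counts hM cab); apply: full => // n'.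
  have [q nq [m [kappa [_ _ _ lB]]]] := Hab n'.
  exists (8 * q)%N; first by apply: leq_trans nq _; rewrite leq_pmull.
  by exists kappa.
exists (a%:~R, b%:~R), p, q; split=> //.
  case=> /eqP; rewrite intr_eq0 => /eqP a0 /eqP; rewrite intr_eq0 => /eqP b0.
  by move: cab; rewrite a0 b0.
by move: Bq; rewrite /perp /= rmorphN.
Qed.

End Characterisation.

(** * Necessity and conclusion *)

Section Converse.

Variable R : realType.
Variables (M : nat) (hM : (2 <= M)%N) (A B : {set 'I_M * 'I_M}).

(** Differences of points of an iterate are combinations of digit differences. *)
Lemma cantor_orthogonal (E : {set 'I_M * 'I_M}) (D1 D2 : int) k (x x' : nat * nat) :
  (forall j j' : 'I_M * 'I_M, j \in E -> j' \in E ->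
     (j.1%:Z - j'.1%:Z) * D1 + (j.2%:Z - j'.2%:Z) * D2 = 0) ->
  (x.1 < M ^ k)%N -> (x.2 < M ^ k)%N -> (x'.1 < M ^ k)%N -> (x'.2 < M ^ k)%N ->
  cantor E k x.1 x.2 -> cantor E k x'.1 x'.2 ->
  (x.1%:Z - x'.1%:Z) * D1 + (x.2%:Z - x'.2%:Z) * D2 = 0.
Proof.
move=> orth x1 x2 x1' x2' /cantorP cx /cantorP cx'.
have expand a : (a < M ^ k)%N -> a%:Z = \sum_(i < k) (digit M i a)%:Z * (M ^ i)%N%:Z.
  move=> ak; rewrite {1}(digit_expansion ak) (big_morph Posz PoszD erefl).
  by apply: eq_bigr => i _; rewrite PoszM.
rewrite (expand x.1) // (expand x.2) // (expand x'.1) // (expand x'.2) //.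
rewrite -!sumrB !mulr_suml -big_split big1 //= => i _.
have /existsP [j /and3P[jE /eqP j1 /eqP j2]] := cx i (ltn_ord i).
have /existsP [j' /and3P[j'E /eqP j1' /eqP j2']] := cx' i (ltn_ord i).
have := orth j j' jE j'E; rewrite j1 j2 j1' j2' -!mulrBl => /(congr1 ( *%R (M ^ i)%N%:Z)).
by rewrite mulr0 => <-; ring.
Qed.

Lemma orthogonal_alphabets_obstruct k (c : R) :
  (forall j j' kk kk' : 'I_M * 'I_M, j \in A -> j' \in A -> kk \in B -> kk' \in B ->
     int_inner (digit_vec j - digit_vec j') (digit_vec kk - digit_vec kk') = 0) ->
  0 <= c -> fourier_bound A B k c ->
  (#|A| ^ k)%:R * (#|B| ^ k)%:R <= c * (M ^ k)%:R ^+ 2.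
Proof.
move=> orth c0 bk; rewrite -!(card_cantor hM).
apply: (rank_one_bound hM) => // x x' xi xi'.
rewrite !(mem_cantor_iterate hM) => Ax Ax' Bxi Bxi'.
suff E0 : (x.1%:Z - x'.1%:Z) * (xi.1%:Z - xi'.1%:Z) + (x.2%:Z - x'.2%:Z) * (xi.2%:Z - xi'.2%:Z) = 0.
  congr (_ %% _)%N; apply/eqP; rewrite -eqz_nat !PoszD !PoszM -subr_eq0; apply/eqP.
  by rewrite -[RHS]E0; ring.
apply: (cantor_orthogonal (E := A) (k := k) (x := (nat_of_ord x.1, nat_of_ord x.2))
  (x' := (nat_of_ord x'.1, nat_of_ord x'.2))) => //= j j' jA j'A.
rewrite mulrC [X in _ + X]mulrC.
apply: (cantor_orthogonal (E := B) (k := k) (x := (nat_of_ord xi.1, nat_of_ord xi.2))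
  (x' := (nat_of_ord xi'.1, nat_of_ord xi'.2))) => //= kk kk' kB k'B.
by rewrite mulrC [X in _ + X]mulrC; apply: orth.
Qed.

Lemma bounded_powers_exponent_le0 (eta K : R) :
  (forall k, (1 <= k)%N -> M%:R `^ (k%:R * eta) <= K) -> eta <= 0.
Proof.
move=> H; rewrite leNgt; apply/negP => eta0.
have M1 : 1 < M%:R :> R by rewrite ltr1n.
have M0 : 0 < M%:R :> R by apply: lt_trans M1.
have L0 : 0 < eta * ln M%:R by rewrite mulr_gt0 // ln_gt0.
pose k := (Num.truncn (K / (eta * ln M%:R))).+1.
have := H k isT; apply/negP; rewrite -ltNge /powR gt_eqF //.
apply: lt_le_trans (expR_ge1Dx _).
have : K / (eta * ln M%:R) < k%:R by apply: truncnS_gt.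
rewrite ltr_pdivrMr // mulrA; lra.
Qed.

Lemma op_norm_ge0 N (T : ell2 R N -> ell2 R N) : 0 <= op_norm T.
Proof.
have h : lbound [set ell2_norm (T f) | f in [set f : ell2 R N | ell2_norm f <= 1]]%classic 0.
  by move=> _ [f _ <-]; apply: ell2_norm_ge0.
rewrite /op_norm; set S := (X in sup X) in h *.
case: (pselect (has_sup S)) => [hs|/sup_out -> //].
by case: (hs) => [[s Ss] ub]; apply: le_trans (h s Ss) _; apply: ub_le_sup.
Qed.

End Converse.

Local Open Scope classical_set_scope.
Local Open Scope ring_scope.

Theorem corollary1 (R : realType) (M : nat) (hM : (2 <= M)%N)
    (A B : {set 'I_M * 'I_M}) (hA : alphabet A) (hB : alphabet B) :
  let dA : R := alphabet_dim R A in
  let dB : R := alphabet_dim R B in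
  (exists beta C : R,
     [/\ Num.max 0 (1 - (dA + dB) / 2) < beta,
         0 < C &
         forall k : nat, (1 <= k)%N ->
           op_norm (fun f : ell2 R (M ^ k) =>
             indic_mul (cantor_iterate B k)
               (dft (indic_mul (cantor_iterate A k) f)))
           <= C * M%:R `^ (- (k%:R * beta))])
  <->
  ((2 <= dA + dB /\
    ~ (exists (v : R * R) (p q : torus R),
         [/\ v <> 0,
             torus_line v p `<=` limit_cantor_set A &
             torus_line (perp v) q `<=` limit_cantor_set B]))
   \/
   (dA + dB <= 2 /\
    exists j j' k k' : 'I_M * 'I_M,
      [/\ j \in A, j' \in A, k \in B, k' \in B &
          int_inner (digit_vec j - digit_vec j') (digit_vec k - digit_vec k')
            <> 0])).
Proof.
move=> dA dB.
have M0 : 0 < M%:R :> R by rewrite ltr0n ltnW.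
have MN0 : M%:R != 0 :> R by rewrite gt_eqF.
have EA : #|A|%:R = M%:R `^ dA by apply: card_alphabet.
have EB : #|B|%:R = M%:R `^ dB by apply: card_alphabet.
have powM (n : nat) (s t : R) : (M%:R `^ s) ^+ n * M%:R `^ t = M%:R `^ (n%:R * s + t).
  rewrite -powR_mulrn ?powR_ge0 // -powRrM [n%:R * _]mulrC powRD //.
  by rewrite (negPf MN0) implybT.
have powV (s : R) : M%:R `^ s * M%:R `^ (- s) = 1.
  by rewrite -powRD ?subrr ?powRr0 // (negPf MN0) implybT.
split.
  case=> beta [C [beta_gt C0 decay]].
  move: beta_gt; rewrite gt_max => /andP[beta0 beta_gt].
  pose c k := (C * M%:R `^ (- (k%:R * beta))) ^+ 2.
  have cE k : M%:R `^ (k%:R * (2 * beta)) * c k = C ^+ 2.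
    rewrite /c exprMn mulrC -mulrA powM [X in _ `^ X](_ : _ = 0); first by rewrite powRr0 mulr1.
    by ring.
  have c0 k : 0 <= c k by rewrite sqr_ge0.
  have bound k : (1 <= k)%N -> fourier_bound A B k (c k).
    move=> k1; apply: fourier_bound_monotone (@op_norm_bound R M hM A B k).
    rewrite ler_pXn2r ?nnegrE ?op_norm_ge0 ?decay //.
    by rewrite mulr_ge0 ?powR_ge0 // ltW.
  case: (lerP (dA + dB) 2) => [le2|gt2]; [right|left; split; first exact: ltW]; first split=> //.
    apply: contrapT => none.
    have orth j j' kk kk' : j \in A -> j' \in A -> kk \in B -> kk' \in B ->
        int_inner (digit_vec j - digit_vec j') (digit_vec kk - digit_vec kk') = 0.
      move=> jA j'A kB k'B; apply: contrapT => ne; apply: none.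
      by exists j, j', kk, kk'.
    (* rank one at every level makes the Hilbert-Schmidt bound an equality *)
    suff : dA + dB - 2 + 2 * beta <= 0 by lra.
    apply: (@bounded_powers_exponent_le0 R M hM _ (C ^+ 2)) => k k1.
    have := orthogonal_alphabets_obstruct hM orth (c0 k) (bound k k1).
    rewrite !natrX EA EB => le1.
    rewrite -(cE k) -subr_ge0.
    have -> : M%:R `^ (k%:R * (dA + dB - 2 + 2 * beta)) =
       M%:R `^ (k%:R * (2 * beta)) * M%:R `^ (- (2 * k%:R)) * ((M%:R `^ dA) ^+ k * (M%:R `^ dB) ^+ k).
      rewrite -!powR_mulrn ?powR_ge0 // -!powRrM -!powRD ?(negPf MN0) ?implybT //.
      by congr (_ `^ _); ring.
    rewrite -mulrA -mulrBr mulr_ge0 ?powR_ge0 // subr_ge0.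
    have pos : 0 < M%:R `^ (2 * k%:R) :> R by apply: powR_gt0.
    rewrite -(ler_pM2l pos) [leLHS]mulrA powV mul1r [leRHS]mulrC.
    apply: le_trans le1 _.
    by rewrite -exprM -powR_mulrn ?(ltW M0) // natrM [k%:R * 2]mulrC.
  case=> v [p [q [v0 lA lB]]].
  suff : 2 * beta <= 0 by lra.
  apply: (@bounded_powers_exponent_le0 R M hM _ (81 * C ^+ 2)) => k k1.
  have le1 := orthogonal_lines_obstruct hM (missing_digit hA) v0 lA lB k1 (c0 k) (bound k k1).
  rewrite -(cE k) [leRHS]mulrCA -[leLHS]mulr1.
  have pos : 0 < M%:R `^ (k%:R * (2 * beta)) :> R by apply: powR_gt0.
  by rewrite (ler_pM2l pos).
case=> [[ge2 no_lines]|[le2 [j [j' [kk [kk' [jA j'A kB k'B ne]]]]]]].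
  have -> : Num.max 0 (1 - (dA + dB) / 2) = 0 :> R by apply/max_idPl; lra.
  have [k k0 [c [c0 c1 bk]]] : exists2 k, (0 < k)%N &
      exists c : R, [/\ 0 <= c, c < 1 & fourier_bound A B k c].
    apply: contrapT => none; apply: no_lines.
    apply: (@lines_of_extremizers R M hM A B hA hB) => k k0 gap; apply: none.
    by exists k.
  apply: (uncertainty_of_gap hM k0 c0 (lexx 0) _ bk).
  by rewrite mulr0 oppr0 powRr0.
have [c [c0 clt bk]] := gap_of_inner_product R hM jA j'A kB k'B ne.
have -> : Num.max 0 (1 - (dA + dB) / 2) = 1 - (dA + dB) / 2 :> R by apply/max_idPr; lra.
apply: (uncertainty_of_gap hM (isT : (0 < 3)%N) c0 _ _ bk); first lra.
apply: lt_le_trans clt _; rewrite le_eqVlt; apply/orP; left; apply/eqP.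
rewrite !natrX EA EB -exprM.
have N0 : M%:R ^+ (3 * 2) != 0 :> R by rewrite expf_neq0.
apply: (mulIf N0); rewrite divfK //.
rewrite -!powR_mulrn ?powR_ge0 ?ltW // -!powRrM -!powRD ?(negPf MN0) ?implybT //.
by congr (_ `^ _); field.
Qed.
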